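(* Let $\underline{\boldsymbol\alpha}=(\boldsymbol\alpha,\boldsymbol u)$ be a finite list of augmented weights, and let $\gamma\in\mathfrak t\cong\mathfrak t^*$ be generic with respect to $\mathcal S=\mathcal S(\boldsymbol\alpha)$. Then, as functions on $\Lambda^*\times\mathbb N$, $$V_{\underline{\boldsymbol\alpha}}=\sum_{\Delta\in\mathcal S}\mathrm{Ver}_{(\underline{\boldsymbol\alpha}_\Delta;\gamma_\Delta)}\star P_{(\underline{\boldsymbol\alpha}^{\mathsf c}_\Delta,\tau_\Delta)}.$$ Here, for each $\Delta$, the term indexed by $\Delta$ is, for every fixed $\ell\in\mathbb N$, a well-defined convolution of functions on $\Lambda^*$, and the sum is locally finite (for every $(\lambda,\ell)\in\Lambda^*\times\mathbb N$ only finitely many $\Delta\in\mathcal S$ give a nonzero contribution at $(\lambda,\ell)$).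
   Context: Lattices. $\Lambda\subseteq\Xi$ are full-rank lattices in a finite-dimensional real vector space $\mathfrak t$; $\Lambda^*=\mathrm{Hom}(\Lambda,\mathbb Z)$ and $\Xi^*=\mathrm{Hom}(\Xi,\mathbb Z)$, viewed as lattices $\Xi^*\subseteq\Lambda^*\subset\mathfrak t^*$. $T=\mathfrak t/\Lambda$ is the torus, $\exp:\mathfrak t\to T$ the quotient map, and for $t=\exp(X)$, $\lambda\in\Lambda^*$ put $t^\lambda=e^{2\pi i\langle\lambda,X\rangle}$. For $\ell\in\mathbb N=\{1,2,\dots\}$, $T_\ell=(\ell^{-1}\Xi)/\Lambda\subset T$. Augmented weights. An augmented weight is a pair $(\alpha,u)$ with $\alpha\in\Lambda^*$ and $u\in\mathbb C$ a root of unity. A finite list (with multiplicities) of augmented weights $(\alpha_1,u_1),\dots,(\alpha_n,u_n)$ is written $\underline{\boldsymbol\alpha}=(\boldsymbol\alpha,\boldsymbol u)$, with $\boldsymbol\alpha=\{\alpha_1,\dots,\alpha_n\}$, $\boldsymbol u=\{u_1,\dots,u_n\}$. Verlinde sum. $V_{\underline{\boldsymbol\alpha}}:\Lambda^*\times\mathbb N\to\mathbb C$, $$V_{\underline{\boldsymbol\alpha}}(\lambda,\ell)=\sum_{t\in T_\ell}{}^{'}\ \frac{t^\lambda}{\prod_{(\alpha,u)\in\underline{\boldsymbol\alpha}}(1-u\,t^{-\alpha})},$$ the prime meaning summation only over $t\in T_\ell$ for which the denominator is nonzero. Admissible subspaces. $\mathcal S=\mathcal S(\boldsymbol\alpha)$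 is the collection of all affine subspaces of $\mathfrak t^*$ that are $\Xi^*$-translates of linear subspaces spanned by (possibly empty) sublists of $\boldsymbol\alpha$. For $\Delta\in\mathcal S$: $\mathfrak t_\Delta\subseteq\mathfrak t$ is the subspace of vectors annihilated by the linear subspace parallel to $\Delta$. A point $\mu\in\Delta$ is regular in $\Delta$ if it lies in no $\Delta'\in\mathcal S$ with $\dim\Delta'<\dim\Delta$; the chambers of $\Delta$ are the connected components of the set of regular points of $\Delta$. $\underline{\boldsymbol\alpha}_\Delta$ is the sublist of all $(\alpha,u)\in\underline{\boldsymbol\alpha}$ with $\alpha\in\mathrm{ann}(\mathfrak t_\Delta)$ (i.e. $\alpha$ parallel to $\Delta$), and $\underline{\boldsymbol\alpha}_\Delta^{\mathsf c}$ is the complementary sublist (similarly $\boldsymbol\alpha_\Delta,\boldsymbol\alpha_\Delta^{\mathsf c}$). Quasi-polynomial germ. A function on a subset $S$ of a lattice $\Gamma$ is quasi-polynomial if it is the restriction of a function on $\Gamma$ that is polynomial on each coset of some finite-index sublattice. If $\mathfrak c$ is a chamber of $\Delta\in\mathcal S$, it is known (Szenes) that $V_{\underline{\boldsymbol\alpha}_\Delta}$ is quasi-polynomial on $\{(\lambda,\ell)\in\Lambda^*\times\mathbb N:\lambda\in\ell\mathfrak c\}$. For $\mu\in\mathfrak c$, $\mathrm{Ver}_{(\underline{\boldsymbol\alpha}_\Delta;\mu)}:\Lambda^*\times\mathbb N\to\mathbb C$ is the unique function supported on $\{(\lambda,\ell):\lambda\in\ell\Delta\}$, quasi-polynomial on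 this set, and equal to $V_{\underline{\boldsymbol\alpha}_\Delta}$ on $\{(\lambda,\ell):\lambda\in\ell\mathfrak c\}$. Generalized partition function. For a list $\underline{\boldsymbol\beta}=(\boldsymbol\beta,\boldsymbol v)$ of augmented weights and $\tau\in\mathfrak t$ polarizing for $\boldsymbol\beta$ (i.e. $\langle\beta,\tau\rangle\ne0$ for all $\beta\in\boldsymbol\beta$), $P_{(\underline{\boldsymbol\beta},\tau)}:\Lambda^*\to\mathbb C$ is $$P_{(\underline{\boldsymbol\beta},\tau)}(\lambda)=\lim_{\epsilon\to0^+}\int_T\frac{t^\lambda}{\prod_{(\beta,v)\in\underline{\boldsymbol\beta}}(1-v\,t^{-\beta}e^{-\epsilon\langle\beta,\tau\rangle})}\,dt,$$ with $dt$ normalized Haar measure. Generic $\gamma$. Fix an inner product on $\mathfrak t$, used to identify $\mathfrak t\cong\mathfrak t^*$. For $\gamma\in\mathfrak t$ and $\Delta\in\mathcal S$ let $\gamma_\Delta\in\Delta$ be the orthogonal projection of $\gamma$ onto $\Delta$ and $\tau_\Delta=\gamma_\Delta-\gamma\in\mathfrak t_\Delta$. Call $\gamma$ generic if, for all $\Delta\in\mathcal S$, $\gamma_\Delta$ is regular in $\Delta$ and $\tau_\Delta$ is polarizing for $\boldsymbol\alpha_\Delta^{\mathsf c}$. Convolution. $(f\star g)(\lambda)=\sum_{\lambda_1+\lambda_2=\lambda}f(\lambda_1)g(\lambda_2)$ for functions on $\Lambda^*$, defined when addition is proper (finite-to-one) on the product of the supports. *)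

(* Defs.v *)
From HB Require Import structures.
From mathcomp Require Import all_boot all_order all_algebra.
From mathcomp Require Import generic_quotient.
From mathcomp Require Import all_classical all_reals all_analysis.
From mathcomp Require Import sesquilinear complex.
(* Not imported: its notations clash with those of mathcomp-analysis. *)
From mathcomp Require mpoly.

Set Implicit Arguments.
Unset Strict Implicit.
Unset Printing Implicit Defensive.

Import Order.TTheory GRing.Theory Num.Theory.
Import numFieldNormedType.Exports.

Local Open Scope classical_set_scope.
Local Open Scope ring_scope.
Local Open Scope quotient_scope.

(* Vectors of t and of its dual t^* are both row vectors: covectors are given
   by their coordinates in the dual basis of the standard basis of t = R^n. *)

Section Lattices.
Context {R : realType} {n : nat}.

Definition pairing (mu x : 'rV[R]_n) : R := (mu *m x^T) 0 0.

(* The lattice whose Z-basis is formed by the rows of [B]; it is full-rank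
   when [B] is invertible. *)
Definition lattice (B : 'M[R]_n) : set 'rV[R]_n :=
  [set map_mx intr z *m B | z in [set: 'rV[int]_n]].

Definition dual_lattice (B : 'M[R]_n) : set 'rV[R]_n :=
  [set mu | forall x, lattice B x -> pairing mu x \is a Num.int].

Lemma latticeB (B : 'M[R]_n) x y :
  lattice B x -> lattice B y -> lattice B (x - y).
Proof.
move=> [z _ <-] [w _ <-]; exists (z - w) => //.
by rewrite map_mxB mulmxBl.
Qed.

Lemma lattice0 (B : 'M[R]_n) : lattice B 0.
Proof. by exists 0 => //; rewrite map_mx0 mul0mx. Qed.

Definition lattice_rel (B : 'M[R]_n) : rel 'rV[R]_n :=
  fun x y => `[< lattice B (x - y) >].

Lemma lattice_rel_equiv (B : 'M[R]_n) : equiv_class_of (lattice_rel B).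
Proof.
split=> [x|x y|y x z].
- by apply/asboolP; rewrite subrr; exact: lattice0.
- by apply: asbool_equiv_eq; split=> h; rewrite -opprB -sub0r;
    apply: latticeB h; exact: lattice0.
- move=> /asboolP xy /asboolP yz; apply/asboolP.
  rewrite -(subrKA y) -[y - z]opprK; apply: latticeB => //.
  by rewrite -sub0r; apply: latticeB => //; exact: lattice0.
Qed.

Canonical lattice_equiv (B : 'M[R]_n) :=
  EquivRelPack (lattice_rel_equiv B).

Definition torus (B : 'M[R]_n) := {eq_quot (lattice_equiv B)}.

Definition torus_exp (B : 'M[R]_n) (x : 'rV[R]_n) : torus B :=
  \pi_(torus B) x.

(* e^(2 i pi theta) *)
Definition expi (theta : R) : R[i] :=
  Complex (cos (2 * pi * theta)) (sin (2 * pi * theta)).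

(* t^lambda; independent of the representative for lambda in the dual lattice,
   see [tpow_exp]. *)
Definition tpow (B : 'M[R]_n) (t : torus B) (lambda : 'rV[R]_n) : R[i] :=
  expi (pairing lambda (repr t)).

Lemma expiD (x y : R) : expi (x + y) = expi x * expi y.
Proof.
by apply/eqP; rewrite eq_complex /= mulrDr cosD sinD !eqxx /= addrC.
Qed.

Lemma expi_int (k : int) : expi k%:~R = 1.
Proof.
have expi_nat (m : nat) : expi (m%:R : R) = 1.
  elim: m => [|m IH].
    by rewrite /expi mulr0 cos0 sin0.
  by rewrite -natr1 expiD IH mul1r /expi mulr1 mulr_natl cos2pi sin2pi.
case: k => m; first exact: expi_nat.
rewrite NegzE mulrNz; apply: (@mulfI _ (expi (m.+1%:R : R))).
  by rewrite expi_nat oner_neq0.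
by rewrite -expiD pmulrn subrr expi_nat mul1r /expi mulr0 cos0 sin0.
Qed.

Lemma tpow_exp (B : 'M[R]_n) (x lambda : 'rV[R]_n) :
  dual_lattice B lambda ->
  tpow (torus_exp B x) lambda = expi (pairing lambda x).
Proof.
move=> Dl; rewrite /tpow /torus_exp.
case: (piP (torus B) x) => y /eqmodP /asboolP /Dl /intrP [k Hk].
have -> : pairing lambda x = pairing lambda (x - y) + pairing lambda y.
  by rewrite /pairing -[in LHS](subrK y x) linearD mulmxDr mxE.
by rewrite Hk expiD expi_int mul1r.
Qed.

(* Iterated Lebesgue integral over the unit cube [0, 1]^m. *)
Fixpoint cube_integral (m : nat) : ('rV[R]_m -> R) -> R :=
  match m with
  | 0 => fun F => F 0
  | k.+1 => fun F => \int[@lebesgue_measure R]_(x in `[0, 1])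
                       cube_integral (fun y : 'rV[R]_k => F (row_mx x%:M y))
  end.

(* Normalized Haar integral on the torus, computed in the coordinates
   x |-> exp (x_1 b_1 + ... + x_n b_n), with b_i the i-th row of [B]. *)
Definition haar_integral (B : 'M[R]_n) (F : torus B -> R) : R :=
  cube_integral (fun x : 'rV[R]_n => F (torus_exp B (x *m B))).

Definition haar_integralC (B : 'M[R]_n) (F : torus B -> R[i]) : R[i] :=
  Complex (haar_integral (fun t => complex.Re (F t)))
          (haar_integral (fun t => complex.Im (F t))).

End Lattices.

Section AffineSubspaces.
Context {R : realType} {n : nat}.

Definition affine_subspace (nu : 'rV[R]_n) (U : {vspace 'rV[R]_n}) :
  set 'rV[R]_n := [set mu | mu - nu \in U].

Definition direction (D : set 'rV[R]_n) : {vspace 'rV[R]_n} :=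
  xget 0%VS [set U | exists nu, D = affine_subspace nu U].

Definition affine_dim (D : set 'rV[R]_n) : nat := \dim (direction D).

(* t_Delta *)
Definition annihilated (D : set 'rV[R]_n) : set 'rV[R]_n :=
  [set x | forall v, v \in direction D -> pairing v x = 0].

Lemma direction_affine nu (U : {vspace 'rV[R]_n}) :
  direction (affine_subspace nu U) = U.
Proof.
rewrite /direction; case: xgetP => [V _ [nu' E]|/(_ U)]; last first.
  by case; exists nu.
have H mu : (mu - nu \in U) = (mu - nu' \in V).
  by apply/idP/idP => h; [have: affine_subspace nu U mu by []; rewrite E
    | have: affine_subspace nu' V mu by []; rewrite -E].
have nV : nu - nu' \in V by rewrite -H subrr mem0v.
apply/vspaceP => v; have := H (v + nu); rewrite addrK => ->.
by rewrite -addrA; apply/idP/idP => h; [rewrite rpredDr | rewrite -(rpredDr _ nV)].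
Qed.

End AffineSubspaces.

Section Projection.
Context {R : realType} {n : nat} (ip : {dot 'rV[R]_n for (@idfun R)}).

(* The identification of t with t^* given by the inner product. *)
Definition flat (x : 'rV[R]_n) : 'rV[R]_n :=
  \row_j ip x (delta_mx 0 j).

Lemma pairing_flat (x y : 'rV[R]_n) : pairing (flat x) y = ip x y.
Proof.
rewrite /pairing mxE [in RHS](row_sum_delta y) linear_sumr /=.
by apply: eq_bigr => j _; rewrite linearZr_LR /= !mxE mulrC.
Qed.

Definition orthogonal_projection (A : set 'rV[R]_n) (x : 'rV[R]_n) :
    'rV[R]_n :=
  xget x [set y | A y /\ forall a b, A a -> A b -> ip (y - x) (a - b) = 0].

(* gamma_Delta and tau_Delta as vectors of t, for [D] a subset of t^*. *)
Definition projection_point (D : set 'rV[R]_n) (gamma : 'rV[R]_n) :=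
  orthogonal_projection (flat @^-1` D) gamma.

Definition projection_dir (D : set 'rV[R]_n) (gamma : 'rV[R]_n) :=
  projection_point D gamma - gamma.

End Projection.

Section QuasiPolynomials.
Context {R : realType}.

Definition subgroup_of (V : zmodType) (G' G : set V) : Prop :=
  [/\ G' `<=` G, G' 0 & forall x y, G' x -> G' y -> G' (x - y)].

Definition finite_index (V : zmodType) (G' G : set V) : Prop :=
  exists s : seq V, forall x, G x -> exists2 y, y \in s & G' (x - y).

Definition poly_eval n (p : mpoly.mpoly n.+1 R[i]) (x : 'rV[R]_n * int) :
    R[i] :=
  mpoly.meval (fun i : 'I_n.+1 => if unlift ord_max i is Some j
                                  then (x.1 0 j)%:C%C else x.2%:~R) p.

(* [G] is a lattice in t^* x R, with last coordinates in int. *)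
Definition quasi_polynomial n (G : set ('rV[R]_n * int))
    (f : 'rV[R]_n * int -> R[i]) : Prop :=
  exists G' : set ('rV[R]_n * int),
    [/\ subgroup_of G' G, finite_index G' G &
      forall x, G x -> exists p : mpoly.mpoly n.+1 R[i],
        forall y, G' (y - x) -> f y = poly_eval p y].

Definition quasi_polynomial_on n (G S : set ('rV[R]_n * int))
    (f : 'rV[R]_n -> nat -> R[i]) : Prop :=
  exists2 g, quasi_polynomial G g &
    forall lambda (l : nat), S (lambda, l%:Z) -> f lambda l = g (lambda, l%:Z).

End QuasiPolynomials.

Section Verlinde.
Context {R : realType} {n : nat}.
(* Lambda and Xi are the lattices generated by the rows of [L] and [X]. *)
Context (L X : 'M[R]_n).

Local Notation weights := (seq ('rV[R]_n * R[i])).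
Implicit Types (alpha beta : weights) (D : set 'rV[R]_n).

Definition augmented_weight (a : 'rV[R]_n * R[i]) : Prop :=
  dual_lattice L a.1 /\ exists2 m, (0 < m)%N & m.-unity_root a.2.

(* T_l *)
Definition torus_points (l : nat) : set (torus L) :=
  [set torus_exp L (l%:R^-1 *: xi) | xi in lattice X].

Definition verlinde_denominator alpha (t : torus L) : R[i] :=
  \prod_(a <- alpha) (1 - a.2 * tpow t (- a.1)).

Definition verlinde_sum alpha (lambda : 'rV[R]_n) (l : nat) : R[i] :=
  \sum_(t \in [set t | torus_points l t /\ verlinde_denominator alpha t != 0])
    tpow t lambda / verlinde_denominator alpha t.

(* S(alpha) *)
Definition admissible alpha : set (set 'rV[R]_n) :=
  [set D | exists nu w, [/\ dual_lattice X nu, subseq w (map fst alpha) &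
                          D = affine_subspace nu <<w>>%VS]].

Definition regular_in alpha D : set 'rV[R]_n :=
  [set mu | D mu /\ ~ exists D', [/\ admissible alpha D',
                                   (affine_dim D' < affine_dim D)%N & D' mu]].

Definition chamber alpha D (mu : 'rV[R]_n) : set 'rV[R]_n :=
  connected_component (regular_in alpha D) mu.

Definition parallel D (a : 'rV[R]_n * R[i]) : bool :=
  `[< forall x, annihilated D x -> pairing a.1 x = 0 >].

Definition weights_par alpha D : weights := [seq a <- alpha | parallel D a].

Definition weights_compl alpha D : weights :=
  [seq a <- alpha | ~~ parallel D a].

Definition dilate (l : nat) (A : set 'rV[R]_n) : set 'rV[R]_n :=
  [set l%:R *: mu | mu in A].

(* The function Ver_(alpha_Delta; mu) is characterized on Lambda^* x N;
   by convention it also vanishes outside Lambda^* and for l = 0. *)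
Definition is_verlinde_germ alpha D (mu : 'rV[R]_n)
    (f : 'rV[R]_n -> nat -> R[i]) : Prop :=
  [/\ forall lambda l, f lambda l != 0 ->
        [/\ dual_lattice L lambda, (0 < l)%N & dilate l D lambda],
      quasi_polynomial_on
        [set x | dual_lattice L x.1]
        [set x | dual_lattice L x.1 /\
           exists2 l : nat, (0 < l)%N & x.2 = l%:Z /\ dilate l D x.1]
        f &
      forall lambda l, dual_lattice L lambda -> (0 < l)%N ->
        dilate l (chamber alpha D mu) lambda ->
        f lambda l = verlinde_sum (weights_par alpha D) lambda l].

Definition verlinde_germ alpha D (mu : 'rV[R]_n) : 'rV[R]_n -> nat -> R[i] :=
  xget (fun _ _ => 0) [set f | is_verlinde_germ alpha D mu f].

Definition polarizing beta (tau : 'rV[R]_n) : Prop :=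
  forall b, b \in beta -> pairing b.1 tau != 0.

Definition partition_integral beta (tau lambda : 'rV[R]_n) (eps : R) : R[i] :=
  haar_integralC (fun t : torus L =>
    tpow t lambda /
    \prod_(b <- beta)
      (1 - b.2 * tpow t (- b.1) * (expR (- (eps * pairing b.1 tau)))%:C%C)).

(* P_(beta, tau); the limit in C is taken componentwise. *)
Definition partition_function beta (tau lambda : 'rV[R]_n) : R[i] :=
  Complex
    (lim (complex.Re (partition_integral beta tau lambda eps)
            @[eps --> (0 : R)^'+]))
    (lim (complex.Im (partition_integral beta tau lambda eps)
            @[eps --> (0 : R)^'+])).

Definition convolution_defined (f g : 'rV[R]_n -> R[i]) : Prop :=
  forall lambda, dual_lattice L lambda ->
    finite_set [set p : 'rV[R]_n * 'rV[R]_n |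
      [/\ dual_lattice L p.1, dual_lattice L p.2, p.1 + p.2 = lambda,
          f p.1 != 0 & g p.2 != 0]].

Definition convolution (f g : 'rV[R]_n -> R[i]) (lambda : 'rV[R]_n) : R[i] :=
  \sum_(p \in [set p : 'rV[R]_n * 'rV[R]_n |
      [/\ dual_lattice L p.1, dual_lattice L p.2 & p.1 + p.2 = lambda]])
    f p.1 * g p.2.

Context (ip : {dot 'rV[R]_n for (@idfun R)}) (gamma : 'rV[R]_n).

Definition generic alpha : Prop :=
  forall D, admissible alpha D ->
    regular_in alpha D (flat ip (projection_point ip D gamma)) /\
    polarizing (weights_compl alpha D) (projection_dir ip D gamma).

(* Ver_(alpha_Delta; gamma_Delta) and P_(alpha_Delta^c, tau_Delta) *)
Definition germ_at alpha D : 'rV[R]_n -> nat -> R[i] :=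
  verlinde_germ alpha D (flat ip (projection_point ip D gamma)).

Definition partition_at alpha D : 'rV[R]_n -> R[i] :=
  partition_function (weights_compl alpha D) (projection_dir ip D gamma).

Definition decomposition_term alpha D (lambda : 'rV[R]_n) (l : nat) : R[i] :=
  convolution (fun mu => germ_at alpha D mu l) (partition_at alpha D) lambda.

End Verlinde.

(* Main.v *)
Require Import Defs.
From mathcomp Require Import all_boot all_order all_algebra.
From mathcomp Require Import generic_quotient.
From mathcomp Require Import all_classical all_reals all_analysis.
From mathcomp Require Import sesquilinear complex.
From mathcomp Require mpoly.
From mathcomp Require Import zify ring lra.

Set Implicit Arguments.
Unset Strict Implicit.
Unset Printing Implicit Defensive.

Import Order.TTheory GRing.Theory Num.Theory.
Import numFieldNormedType.Exports.

Local Open Scope classical_set_scope.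
Local Open Scope ring_scope.

(** Write M for the lattice of weights, V_A(., l) for the Verlinde sum of a list
    of weights A at the level l, and A_s for the sublist of the weights of A
    lying in a subspace s. Call flats the subspaces spanned by sublists of A, and
    strata the translates of flats by Xi^*.

    The difference operator attached to a weight (a, u), sending f to
    f - u f(. - a), multiplies the summand of a Verlinde sum by 1 - u t^-a. As
    0^-1 = 0 in a field, V_A is the sum over all of T_l of t^lambda times the
    product of the (1 - u t^-a)^-1. So the operators nabla of the weights of A_r
    outside s satisfy nabla^2 V_(A_r) = nabla V_(A_s) (vsum_rel), while they map
    P_(A_r minus A_s) to a delta function (nabs_pf).

    Choose for each stratum a polarizing vector of t annihilating its direction.
    Define functions g_r (gpart, germ) by recursion on the dimension of the flat
    r, so that V_(A_r) is the sum over the flats s of r of g_s convolved with the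
    partition functions P, the polarization at a point of the support of g_s
    being that of the stratum through this point. The decomposition formula then
    holds by construction (V_sum, vsum_contributions), provided that only
    finitely many strata matter at a time. If the
    polarizing vectors point from a base point to its projections on the strata,
    the term of a stratum is supported beyond it as seen from the base point, so
    that distant strata do not matter (good_polarization). What remains is to recognize g_r,
    on the cone over a stratum Delta parallel to r, as the quasi-polynomial
    extension of V_(A_r) from the cone over a chamber.

    For l fixed, the relation above implies that g_r solves a Dahmen-Micchelli
    system of difference equations (gpart_dm), so that it is quasi-polynomial
    along r (dm_system_killed). Next, if c in Delta is strictly on the negative
    side of all smaller strata inside Delta, these do not contribute near l c,
    and g_r is equal to V_(A_r) in a whole neighbourhood (germ_near). Finally,
    partial fractions on the torus (pfrac_factors) and finite Fourier expansions
    (fourier_ex) show that V is piecewise quasi-polynomial in (lambda, l), with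
    finitely many walls, in each cone |lambda| <= B l. Hence V agrees for l large
    with a single quasi-polynomial G over some small cell near c, and so does
    g_r, at first on that cell, then on the cone over Delta for l large by the
    difference equations, and for all l because l^K g_r is quasi-polynomial along
    the rays j (lambda, l) (germ_qp).

    For the generic gamma of the theorem, the condition on c holds at
    c = gamma_Delta, since the vectors tau are the differences
    between gamma and its projections (generic_near_vanishing). At any other regular point c of Delta, one may
    choose another system of polarizations, close to the projections of c
    (regular_polarization): near c too, V_(A_r) is given by a quasi-polynomial
    in all levels. These local quasi-polynomials agree along a chamber, as it is
    connected (germ_constant). This proves that g_r is equal to V_(A_r) on the
    cone over the chamber, so that it is the germ Ver there, which is unique as
    rational directions abound in a chamber (germ_unique).

    The integral defining P is evaluated by the recursion which it satisfies
    when a factor of the denominator is removed, and which a bounded function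
    satisfies only if it is the expansion into a geometric series
    (pintegral_pf). *)


(** * Functions killed by iterated differences *)

Section FiniteDifferences.
Context {G : zmodType} {K : comNzRingType}.
Implicit Types (f g : G -> K) (v w x : G).

Definition fdiff v f : G -> K := fun x => f (x + v) - f x.

Fixpoint killed v k f : Prop :=
  if k is k'.+1 then killed v k' (fdiff v f) else forall x, f x = 0.

Lemma killed_ext v k f g : f =1 g -> killed v k f -> killed v k g.
Proof. by move=> /funext ->. Qed.

Lemma killed0 v k f : (forall x, f x = 0) -> killed v k f.
Proof.
by elim: k f => [//|k IH] f f0 /=; apply: IH => x; rewrite /fdiff !f0 subrr.
Qed.

Lemma killedD v k f g : killed v k f -> killed v k g ->
  killed v k (fun x => f x + g x).
Proof.
elim: k f g => [|k IH] f g /= hf hg; first by move=> x; rewrite hf hg addr0.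
by apply: killed_ext (IH _ _ hf hg) => x; rewrite /fdiff addrACA opprD.
Qed.

Lemma killed_shift v k f w : killed v k f -> killed v k (fun x => f (x + w)).
Proof.
elim: k f => [|k IH] f /= hf; first by move=> x; rewrite hf.
by apply: killed_ext (IH _ hf) => x; rewrite /fdiff addrAC.
Qed.

Lemma killedZ v k f c : killed v k f -> killed v k (fun x => c * f x).
Proof.
elim: k f => [|k IH] f /= hf; first by move=> x; rewrite hf mulr0.
by apply: killed_ext (IH _ hf) => x; rewrite /fdiff mulrBr.
Qed.

Lemma killedN v k f : killed v k f -> killed v k (fun x => - f x).
Proof.
by move=> /(killedZ (-1)); apply: killed_ext => x; rewrite mulN1r.
Qed.

Lemma killed_diff v k f w : killed v k f -> killed v k (fdiff w f).
Proof. by move=> h; apply: killedD; [exact: killed_shift|exact: killedN]. Qed.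

Lemma killed_sum v k (I : Type) (r : seq I) (F : I -> G -> K) :
  (forall i, killed v k (F i)) -> killed v k (fun x => \sum_(i <- r) F i x).
Proof.
move=> h; elim: r => [|i r IH]; first by apply: killed0 => x; rewrite big_nil.
by apply: killed_ext (killedD (h i) IH) => x; rewrite big_cons.
Qed.

Lemma killedS v k f : killed v k f -> killed v k.+1 f.
Proof.
elim: k f => [|k IH] f hf; first by move=> x; rewrite /fdiff !hf subrr.
exact: IH hf.
Qed.

Lemma killedW v k k' f : (k <= k')%N -> killed v k f -> killed v k' f.
Proof.
move=> /subnK <-; elim: (k' - k)%N => [//|m IH] /IH hf.
by rewrite addSn; exact: killedS.
Qed.

Lemma fdiff_mulrn v m f x :
  fdiff (v *+ m) f x = \sum_(i < m) fdiff v f (x + v *+ i).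
Proof.
elim: m => [|m IH]; first by rewrite big_ord0 /fdiff mulr0n addr0 subrr.
by rewrite big_ord_recr /= -IH /fdiff mulrSr addrA; ring.
Qed.

Lemma killedMn v k f m : killed v k f -> killed (v *+ m) k f.
Proof.
elim: k f => [//|k IH] f /= hf.
apply: (@killed_ext _ _ (fun x => \sum_(i < m) fdiff v f (x + v *+ i))).
  by move=> x; rewrite fdiff_mulrn.
by apply: killed_sum => i; apply: IH; exact: killed_shift.
Qed.

Lemma killedNv v k f : killed v k f -> killed (- v) k f.
Proof.
elim: k f => [//|k IH] f /= hf.
apply: (@killed_ext _ _ (fun x => - fdiff v f (x - v))).
  by move=> x; rewrite /fdiff subrK opprB.
by apply/killedN/IH; exact: killed_shift.
Qed.

(** By f(x + v + w) - f(x) = (f(x + w + v) - f(x + w)) + (f(x + w) - f(x)), a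
    difference in direction v + w spends one difference in direction v or one in
    direction w. *)
Lemma killed_add v w k j f : killed v k f -> killed w j f ->
  killed (v + w) (k + j) f.
Proof.
move: {2}(k + j)%N (leqnn (k + j)) => m; elim: m k j f => [|m IH] [|k] [|j] f //.
all: try by move=> _ hv hw; apply: killed0.
- rewrite addnS ltnS => lm hv hw.
  change (killed (v + w) (k.+1 + j) (fdiff (v + w) f)).
  apply: (@killed_ext _ _ (fun x => fdiff v f (x + w) + fdiff w f x)).
    by move=> x; rewrite /fdiff [x + (v + w)]addrA [x + v + w]addrAC; ring.
  apply: killedD.
    rewrite addSnnS; apply: (IH k j.+1); first by rewrite -addSnnS.
      exact: (@killed_shift _ _ (fdiff v f)).
    exact/(@killed_shift _ j.+1 (fdiff v f))/(@killed_diff _ j.+1 _ v).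
  by apply: (IH k.+1 j) => //; exact: (@killed_diff _ k.+1).
Qed.

(** By the Leibniz rule for differences. *)
Lemma killedM v k j f g : killed v k f -> killed v j g ->
  killed v (k + j) (fun x => f x * g x).
Proof.
move: {2}(k + j)%N (leqnn (k + j)) => m; elim: m k j f g => [|m IH] [|k] [|j] f g //.
all: try by move=> _ hf hg; apply: killed0 => x; rewrite ?hf ?mul0r ?hg ?mulr0.
- rewrite addnS ltnS => lm hf hg.
  change (killed v (k.+1 + j) (fdiff v (fun x => f x * g x))).
  apply: (@killed_ext _ _ (fun x => fdiff v f x * g x + f (x + v) * fdiff v g x)).
    by move=> x; rewrite /fdiff; ring.
  apply: killedD.
    by rewrite addSnnS; apply: (IH k j.+1) => //; rewrite -addSnnS.
  by apply: (IH k.+1 j) => //; exact: (@killed_shift _ k.+1).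
Qed.

(** Along a line, such a function is polynomial in the parameter, so it has no
    infinite tail of zeros unless it vanishes. *)
Lemma killed_ray_large v k f x J : killed v k f ->
  (forall j, (J <= j)%N -> f (x + v *+ j) = 0) -> f x = 0.
Proof.
move=> hk h; have -> : x = x + v *+ 0 by rewrite mulr0n addr0.
elim: k f hk h 0%N => [|k IH] f //= hk h j.
have {}IH := IH _ hk.
have d0 i : fdiff v f (x + v *+ i) = 0.
  by apply: IH => m Jm; rewrite /fdiff -addrA -mulrSr !h ?subrr// leqW.
have fS i : f (x + v *+ i.+1) = f (x + v *+ i).
  by apply/eqP; rewrite -subr_eq0 mulrSr addrA; apply/eqP/d0.
have fD i m : f (x + v *+ (i + m)) = f (x + v *+ i).
  by elim: m => [|m IHm]; rewrite ?addn0// addnS fS.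
by rewrite -(fD _ J) h// leq_addl.
Qed.

(** Along a line, being killed by the k-th difference is a recurrence relation
    of order k, which k consecutive zeros propagate in both directions. *)
Lemma killed_ray_box v k f x : killed v k f ->
  (forall j, (j < k)%N -> f (x + v *+ j) = 0) -> forall j : int, f (x + v *~ j) = 0.
Proof.
elim: k f => [|k IH] f /= hk h j; first exact: hk.
have d0 i : fdiff v f (x + v *~ i) = 0.
  by apply: IH => // m Jm; rewrite /fdiff -addrA -mulrSr !h ?subrr// ltnS ltnW.
have fS i : f (x + v *~ (i + 1)) = f (x + v *~ i).
  by apply/eqP; rewrite -subr_eq0 mulrzDr addrA; apply/eqP/d0.
have f0 : f (x + v *~ 0) = 0 by rewrite (h 0%N).
elim/int_ind: j => [//|m|m] fm.
  by rewrite -addn1 PoszD fS.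
rewrite -[RHS]fm -[in RHS](subrK 1 (- _)) fS; congr (f (_ + _ *~ _)).
by rewrite -addn1 PoszD opprD.
Qed.

End FiniteDifferences.

Lemma killed_comp (G H : zmodType) (K : comNzRingType) (f : H -> K) (h : G -> H)
    v w k : (forall x, h (x + v) = h x + w) -> killed w k f ->
  killed v k (fun x => f (h x)).
Proof.
move=> hv; elim: k f => [|k IH] f /= hf; first by move=> x.
by apply: killed_ext (IH _ hf) => x; rewrite /fdiff hv.
Qed.

(** * Quasi-polynomials and piecewise quasi-polynomials *)

(** Integral linear forms: the walls of the piecewise functions below. *)
Record zlin (G : zmodType) := Zlin {
  zval :> G -> int;
  zvalD : forall x y, zval (x + y) = zval x + zval y }.

Section ZLin.
Context {G : zmodType}.
Implicit Types (c d : zlin G).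

Lemma zval0 c : c 0 = 0.
Proof. by apply: (addrI (c 0)); rewrite -zvalD !addr0. Qed.

Lemma zvalN c x : c (- x) = - c x.
Proof. by apply: (addrI (c x)); rewrite -zvalD !subrr zval0. Qed.

Lemma zvalMn c x m : c (x *+ m) = c x *+ m.
Proof. by elim: m => [|m IH]; rewrite ?mulr0n ?zval0// !mulrSr zvalD IH. Qed.

Lemma zvalMz c x m : c (x *~ m) = m * c x.
Proof.
case: m => m; first by rewrite -pmulrn zvalMn -mulr_natl natz.
by rewrite NegzE mulrNz zvalN -pmulrn zvalMn mulNr -mulr_natl natz.
Qed.

Lemma zlin_add_subproof c d x y :
  c (x + y) + d (x + y) = (c x + d x) + (c y + d y).
Proof. by rewrite !zvalD addrACA. Qed.
Definition zlin_add c d := @Zlin G (fun x => c x + d x) (zlin_add_subproof c d).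

Lemma zlin_scale_subproof (q : int) c x y : q * c (x + y) = q * c x + q * c y.
Proof. by rewrite zvalD mulrDr. Qed.
Definition zlin_scale q c := @Zlin G (fun x => q * c x) (zlin_scale_subproof q c).

End ZLin.

Lemma zlin_comp_subproof (G H : zmodType) (c : zlin H) (h : G -> H)
    (hD : forall x y, h (x + y) = h x + h y) x y :
  c (h (x + y)) = c (h x) + c (h y).
Proof. by rewrite hD zvalD. Qed.
Definition zlin_comp (G H : zmodType) (c : zlin H) (h : G -> H)
    (hD : forall x y, h (x + y) = h x + h y) : zlin G :=
  Zlin (zlin_comp_subproof c hD).

Section QuasiPolynomialFunctions.
Context {G : zmodType} {K : comNzRingType}.
Implicit Types (f g : G -> K) (v w x : G).

(** Being killed by a power of T^N - 1 for all translations T characterizes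
    quasi-polynomials, and is visibly stable under all operations used here. *)
Definition qpfun f := exists2 N, (0 < N)%N & exists k, forall v, killed (v *+ N) k f.

Lemma qpfun_ext f g : f =1 g -> qpfun f -> qpfun g.
Proof. by move=> /funext ->. Qed.

Lemma qpfun_two f g : qpfun f -> qpfun g ->
  exists2 N, (0 < N)%N & exists k,
    forall v, killed (v *+ N) k f /\ killed (v *+ N) k g.
Proof.
move=> [N N0 [k hf]] [M M0 [j hg]]; exists (N * M)%N; first by rewrite muln_gt0 N0.
exists (maxn k j) => v; split.
  by rewrite mulrnA; apply: killedMn; apply: killedW (hf v); rewrite leq_maxl.
rewrite mulnC mulrnA; apply: killedMn; apply: killedW (hg v).
by rewrite leq_maxr.
Qed.

Lemma qpfunD f g : qpfun f -> qpfun g -> qpfun (fun x => f x + g x).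
Proof.
move=> /qpfun_two H /H [N N0 [k h]]; exists N => //; exists k => v.
by have [] := h v; exact: killedD.
Qed.

Lemma qpfunM f g : qpfun f -> qpfun g -> qpfun (fun x => f x * g x).
Proof.
move=> /qpfun_two H /H [N N0 [k h]]; exists N => //; exists (k + k)%N => v.
by have [] := h v; exact: killedM.
Qed.

Lemma qpfun_periodic f N : (0 < N)%N -> (forall x v, f (x + v *+ N) = f x) ->
  qpfun f.
Proof.
by move=> N0 h; exists N => //; exists 1%N => v x; rewrite /= /fdiff h subrr.
Qed.

Lemma qpfun_cst c : qpfun (fun=> c).
Proof. exact: (@qpfun_periodic _ 1). Qed.

Lemma qpfunN f : qpfun f -> qpfun (fun x => - f x).
Proof.
move=> /(qpfunM (qpfun_cst (-1))); apply: qpfun_ext => x.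
by rewrite mulN1r.
Qed.

Lemma qpfun_shift f w : qpfun f -> qpfun (fun x => f (x + w)).
Proof.
by move=> [N N0 [k h]]; exists N => //; exists k => v; exact: killed_shift.
Qed.

Lemma qpfun_zlin (c : zlin G) : qpfun (fun x => (c x)%:~R).
Proof.
exists 1%N => //; exists 2%N => v /= x; rewrite /fdiff !zvalD !rmorphD /=.
by ring.
Qed.

(** Functions agreeing far enough in a direction agree; this is how identities
    known for large levels only are extended to all levels. *)
Lemma qpfun_ray f w x J : qpfun f ->
  (forall j, (J <= j)%N -> f (x + w *+ j) = 0) -> f x = 0.
Proof.
move=> [N N0 [k h]] hJ; apply: (killed_ray_large (v := w *+ N) (J := J) (h w)) => j Jj.
by rewrite -mulrnA hJ// (leq_trans Jj)// leq_pmull.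
Qed.

End QuasiPolynomialFunctions.

Lemma qpfun_comp (G H : zmodType) (K : comNzRingType) (f : H -> K) (h : G -> H) :
  (forall x y, h (x + y) = h x + h y) -> qpfun f -> qpfun (fun x => f (h x)).
Proof.
move=> hD [N N0 [k hf]]; exists N => //; exists k => v.
apply: killed_comp (hf (h v)) => x; rewrite hD; congr (_ + _).
have h0 : h 0 = 0 by apply: (addrI (h 0)); rewrite -hD !addr0.
by elim: (N) => [|m IH]; rewrite ?mulr0n// !mulrSr hD IH.
Qed.

Lemma qpfun_exp (G : zmodType) (K : fieldType) (u : K) (m : nat) (c : zlin G) :
  (0 < m)%N -> u ^+ m = 1 -> qpfun (fun x => u ^ (c x)).
Proof.
move=> m0 um; have u0 : u != 0.
  by apply/eqP => u0; move: um; rewrite u0 expr0n -[m]prednK//= => /esym/eqP; rewrite oner_eq0.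
apply: (@qpfun_periodic _ _ _ m) => // x v.
rewrite zvalD zvalMn expfzDr// -mulr_natl natz -exprz_exp -exprnP um exp1rz.
by rewrite mulr1.
Qed.

(** * Summation of piecewise quasi-polynomials *)

Section IntegerSums.
Context {K : comNzRingType}.
Implicit Types (h : int -> K) (a b k : int).

(** The antidifference of h vanishing at 0, also for negative arguments. *)
Definition asum h k : K :=
  match k with
  | Posz m => \sum_(i < m) h i
  | Negz m => - \sum_(i < m.+1) h (- (i.+1)%:Z)
  end.

Lemma asumS h k : asum h (k + 1) = asum h k + h k.
Proof.
case: k => m; first by rewrite -PoszD addn1 /= big_ord_recr.
case: m => [|m]; first by rewrite /= big_ord0 big_ord1 addNr.
have -> : Negz m.+1 + 1 = Negz m by rewrite !NegzE; lia.
by rewrite /= [in RHS]big_ord_recr /= opprD -addrA addNr addr0.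
Qed.

Lemma asumB h h' k : asum (fun i => h i - h' i) k = asum h k - asum h' k.
Proof. by case: k => m /=; rewrite big_split/= sumrN ?opprD. Qed.

Definition isum a b h : K := if a <= b then asum h b - asum h a else 0.

Lemma isumE h a (n : nat) : isum a (a + n%:Z) h = \sum_(i < n) h (a + i%:Z).
Proof.
rewrite /isum lerDl; elim: n => [|n IH] /=; first by rewrite addr0 subrr big_ord0.
by rewrite big_ord_recr /= -IH /= -addn1 PoszD addrA asumS addrAC.
Qed.

Lemma isum_empty h a b : b <= a -> isum a b h = 0.
Proof.
move=> ba; rewrite /isum; case: ifP => // ab.
by have -> : a = b; [lia|rewrite subrr].
Qed.

Lemma isum_eq h h' a b : (forall k, a <= k < b -> h k = h' k) ->
  isum a b h = isum a b h'.
Proof.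
move=> hh; have [ab|/ltW ba] := leP a b; last by rewrite !isum_empty.
have -> : b = a + (`|b - a|%N)%:Z by rewrite gez0_abs; lia.
rewrite !isumE; apply: eq_bigr => -[i /= ib] _; apply: hh.
by apply/andP; split; lia.
Qed.

Lemma isum_cat h a b c : a <= b -> b <= c ->
  isum a b h + isum b c h = isum a c h.
Proof.
by move=> ab bc; rewrite /isum ab bc (le_trans ab bc) addrC addrA subrK.
Qed.

Lemma isum_zero a b : isum a b (fun=> 0) = 0 :> K.
Proof.
have [ab|/ltW ba] := leP a b; last by rewrite !isum_empty.
have -> : b = a + (`|b - a|%N)%:Z by rewrite gez0_abs; lia.
by rewrite isumE big1.
Qed.

Lemma isumD a b h h' : isum a b (fun k => h k + h' k) = isum a b h + isum a b h'.
Proof.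
have [ab|/ltW ba] := leP a b; last by rewrite !isum_empty ?addr0.
have -> : b = a + (`|b - a|%N)%:Z by rewrite gez0_abs; lia.
by rewrite !isumE big_split.
Qed.

Lemma isum_lo h a b a' : a <= a' ->
  isum a b (fun k => if a' <= k then h k else 0) = isum a' b h.
Proof.
move=> aa'; have [ba'|a'b] := leP b a'.
  rewrite [RHS]isum_empty// -[RHS](isum_zero a b); apply: isum_eq => k kab.
  by rewrite lt_geF//; lia.
rewrite -(@isum_cat _ a a' b)//; last exact: ltW.
rewrite (@isum_eq _ (fun=> 0) a a'); last by move=> k ka; rewrite lt_geF//; lia.
by rewrite isum_zero add0r; apply: isum_eq => k /andP[->].
Qed.

Lemma isum_hi h a b b' : b' <= b ->
  isum a b (fun k => if k < b' then h k else 0) = isum a b' h.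
Proof.
move=> aa'; have [b'a|ab'] := leP b' a.
  rewrite [RHS]isum_empty// -[RHS](isum_zero a b); apply: isum_eq => k kab.
  by rewrite le_gtF//; lia.
rewrite -(@isum_cat _ a b' b)//; last exact: ltW.
rewrite (@isum_eq _ (fun=> 0) b' b); last by move=> k ka; rewrite le_gtF//; lia.
by rewrite isum_zero addr0; apply: isum_eq => k /andP[_ ->].
Qed.

End IntegerSums.

Lemma pairDE (G H : zmodType) (a b : G) (c d : H) :
  (a, c) + (b, d) = (a + b, c + d).
Proof. by []. Qed.

Lemma pairMzE (G H : zmodType) (a : G) (b : H) (m : int) :
  (a, b) *~ m = (a *~ m, b *~ m).
Proof. by case: m => m; rewrite ?NegzE ?mulrNz -!pmulrn pairMnE. Qed.

Section PiecewiseQuasiPolynomials.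
Context {K : comNzRingType}.

Lemma killedMz (G : zmodType) (f : G -> K) v k (m : int) :
  killed v k f -> killed (v *~ m) k f.
Proof.
case: m => m hv; first exact: killedMn.
by rewrite NegzE mulrNz; exact/killedNv/killedMn.
Qed.

(** The difference in the last variable of the antidifference is the function
    itself; in the other directions, differences commute with summation. *)
Lemma qpfun_asum (G : zmodType) (f : (G * int)%type -> K) : qpfun f ->
  qpfun (fun p : (G * int)%type => asum (fun k => f (p.1, k)) p.2).
Proof.
move=> [N N0 [k hf]]; set A := (fun p => _).
exists N => //; exists (k + k.+1)%N => -[v j].
have -> : (v, j) *+ N = ((v, 0) *+ N) + ((0, 1) *+ N) *~ j.
  rewrite !pairMnE pairMzE /= !mul0rn mul0rz /= pairDE addr0 add0r.
  by congr (_, _); rewrite -mulrzl intz mulr_natr.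
apply: killed_add.
  have : forall (g : (G * int)%type -> K) w, killed (w, 0 : int) k g ->
      killed (w, 0 : int) k (fun p : (G * int)%type => asum (fun k => g (p.1, k)) p.2).
    move=> g w; elim: (k) g => [|i IH] g /= hg.
      move=> [x m] /=; case: m => m /=; rewrite big1 ?oppr0//.
    apply: killed_ext (IH _ hg) => -[x m]; rewrite /fdiff /= addr0.
    by rewrite -asumB; congr asum; apply/funext => k0; rewrite pairDE addr0.
  move=> H; have := hf (v, 0); rewrite pairMnE mul0rn; exact: H.
apply: killedMz; change (killed ((0, 1) *+ N) k (fdiff ((0, 1) *+ N) A)).
apply: (@killed_ext _ _ _ _ (fun p => \sum_(i < N) f (p + (0, 1) *+ i))).
  move=> p; rewrite fdiff_mulrn; apply: eq_bigr => i _.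
  case: (p + _) => x m; rewrite /fdiff /A /= addr0 asumS addrC addrA addNr.
  by rewrite add0r.
by apply: killed_sum => i; exact: killed_shift.
Qed.

(** A floor is quasi-linear: it becomes linear on translates of a multiple of
    the lattice. *)
Lemma qpfun_floor (G : zmodType) (f : (G * int)%type -> K) (c : zlin G) (q : int) :
  0 < q -> qpfun f -> qpfun (fun x => f (x, (c x %/ q)%Z)).
Proof.
move=> q0 [N N0 [k hf]]; exists (`|q| * N)%N; first by rewrite muln_gt0 absz_gt0 gt_eqF.
exists k => v; apply: killed_comp (hf (v *+ `|q|, c v)) => x.
rewrite pairMnE pairDE mulrnA; congr (_, _).
have -> : c (x + v *+ `|q| *+ N) = c v *+ N * q + c x.
  rewrite zvalD !zvalMn addrC -mulrnA -mulr_natl natz PoszM gez0_abs ?ltW//.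
  by rewrite -mulr_natl natz; ring.
by rewrite divzMDl ?gt_eqF// addrC.
Qed.

(** The walls are homogeneous hyperplanes; this is enough since the level is one
    of the variables. *)
Inductive pwq {G : zmodType} : (G -> K) -> Prop :=
| pwq_qp f : qpfun f -> pwq f
| pwq_if (c : zlin G) f : pwq f -> pwq (fun x => if 0 <= c x then f x else 0)
| pwq_add f g : pwq f -> pwq g -> pwq (fun x => f x + g x).

Lemma pwq_ext (G : zmodType) (f g : G -> K) : f =1 g -> pwq f -> pwq g.
Proof. by move=> /funext ->. Qed.

Lemma pwq_cst (G : zmodType) c : pwq (fun _ : G => c).
Proof. by apply: pwq_qp; exact: qpfun_cst. Qed.

Lemma pwq_mul_qp (G : zmodType) (f g : G -> K) : qpfun f -> pwq g ->
  pwq (fun x => f x * g x).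
Proof.
move=> qf; elim=> {g} [g qg|c g _ IH|g h _ IHg _ IHh].
- by apply: pwq_qp; exact: qpfunM.
- by apply: pwq_ext (pwq_if c IH) => x; case: ifP; rewrite ?mulr0.
- by apply: pwq_ext (pwq_add IHg IHh) => x; rewrite mulrDr.
Qed.

Lemma pwqN (G : zmodType) (f : G -> K) : pwq f -> pwq (fun x => - f x).
Proof.
move=> /(pwq_mul_qp (qpfun_cst (-1))); apply: pwq_ext => x.
by rewrite mulN1r.
Qed.

Lemma pwqM (G : zmodType) (f g : G -> K) : pwq f -> pwq g ->
  pwq (fun x => f x * g x).
Proof.
move=> pf pg; elim: pf => {f} [f qf|c f _ IH|f h _ IHf _ IHh].
- exact: pwq_mul_qp.
- by apply: pwq_ext (pwq_if c IH) => x; case: ifP; rewrite ?mul0r.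
- by apply: pwq_ext (pwq_add IHf IHh) => x; rewrite mulrDl.
Qed.

Lemma pwq_comp (G H : zmodType) (f : H -> K) (h : G -> H) :
  (forall x y, h (x + y) = h x + h y) -> pwq f -> pwq (fun x => f (h x)).
Proof.
move=> hD; elim=> {f} [f qf|c f _ IH|f g _ IHf _ IHg].
- by apply: pwq_qp; exact: qpfun_comp.
- exact: (pwq_if (zlin_comp c hD) IH).
- exact: pwq_add.
Qed.

Lemma pwq_ite (G : zmodType) (c : zlin G) (f g : G -> K) : pwq f -> pwq g ->
  pwq (fun x => if 0 <= c x then f x else g x).
Proof.
move=> pf pg.
apply: pwq_ext (pwq_add (pwq_if c pf) (pwq_add pg (pwqN (pwq_if c pg)))) => x.
by case: ifP; rewrite ?subrr ?addr0// oppr0 addr0 add0r.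
Qed.

Lemma lower_boundE (c k q : int) : 0 < q ->
  (0 <= c + k * q) = (- (c %/ q)%Z <= k).
Proof. by move=> q0; rewrite lerNl lez_divRL// mulNr -subr_ge0 opprK. Qed.

Lemma upper_boundE (c k q : int) : 0 < q ->
  (0 <= c - k * q) = (k < (c %/ q)%Z + 1).
Proof. by move=> q0; rewrite ltzD1 lez_divRL// subr_ge0. Qed.

Lemma zlin_fst_subproof (G : zmodType) (c : zlin (G * int)%type) (x y : G) :
  c (x + y, 0) = c (x, 0) + c (y, 0).
Proof. by rewrite -zvalD. Qed.
Definition zlin_fst (G : zmodType) (c : zlin (G * int)%type) : zlin G :=
  Zlin (zlin_fst_subproof c).

Lemma zlin_pairE (G : zmodType) (c : zlin (G * int)%type) x k :
  c (x, k) = zlin_fst c x + k * c (0, 1).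
Proof.
rewrite -zvalMz /= -zvalD; congr (zval c _).
by rewrite pairMzE mul0rz pairDE addr0 add0r; congr (_, _); lia.
Qed.

(** The summation variable is bounded below by -c1/q1 and above by c2/q2; the
    remaining conditions cs are absorbed one at a time, each replacing one of
    the two bounds on the half-space where it is the sharper one. *)
Lemma pwq_isum_conds (G : zmodType) (f : (G * int)%type -> K)
    (cs : seq (zlin (G * int)%type)) (c1 c2 : zlin G) (q1 q2 : int) :
  qpfun f -> 0 < q1 -> 0 < q2 ->
  pwq (fun x => isum (- (c1 x %/ q1)%Z) ((c2 x %/ q2)%Z + 1)
    (fun k => if all (fun c : zlin (G * int)%type => 0 <= c (x, k)) cs then f (x, k) else 0)).
Proof.
move=> qf; elim: cs c1 c2 q1 q2 => [|c cs IH] c1 c2 q1 q2 q10 q20 /=.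
  pose d := zlin_add (zlin_scale q1 c2) (zlin_scale q2 c1).
  pose F1 x := asum (fun k => f (x, k)) ((c2 x %/ q2)%Z + 1).
  pose F2 x := asum (fun k => f (x, k)) (- (c1 x %/ q1)%Z).
  apply: (@pwq_ext _ (fun x => if 0 <= d x then F1 x - F2 x else 0)).
    move=> x; rewrite /isum /d /F1 /F2 /=; set a := - (c1 x %/ q1)%Z; set b := _ + 1.
    have ha k : (a <= k) = (0 <= c1 x + k * q1) by rewrite lower_boundE.
    have hb k : (k < b) = (0 <= c2 x - k * q2) by rewrite upper_boundE.
    have haa := ha a; rewrite lexx in haa.
    have hba := hb a.
    have ha1 := ha (a - 1); have hb1 := hb (b - 1); have hab1 := ha (b - 1).
    case: ifP => dx; case: ifP => // ab.
      have ba : b < a by lia.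
      by exfalso; have := hb (a - 1); nia.
    suff -> : a = b by rewrite subrr.
    by apply/eqP; rewrite eq_le ab /= leNgt hba; nia.
  apply: pwq_if; apply: pwq_add; last apply: pwqN; apply: pwq_qp.
    have := qpfun_floor c2 q20 (qpfun_shift (0, 1) (qpfun_asum qf)).
    by apply: qpfun_ext => x; rewrite /= addr0.
  have := qpfun_floor (zlin_scale 1 c1) q10
    (qpfun_comp (h := fun p : G * int => (p.1, - p.2)) _ (qpfun_asum qf)).
  move=> H; apply: qpfun_ext (H _) => [x|[x i] [y j]] /=; first by rewrite mul1r.
  by rewrite opprD.
set q := c (0, 1); set c0 := zlin_fst c.
have cE x k : c (x, k) = c0 x + k * q by exact: zlin_pairE.
have [q0|q0|q0] := ltgtP q 0.
- have q0' : 0 < - q by rewrite oppr_gt0.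
  pose d := zlin_add (zlin_scale q2 c0) (zlin_scale q c2).
  apply: pwq_ext (pwq_ite d (IH c1 c2 q1 q2 q10 q20) (IH c1 c0 q1 (- q) q10 q0')) => x.
  case: ifP => dx.
    apply: isum_eq => k /andP[_]; rewrite -upper_boundE// => hk.
    suff -> : 0 <= c (x, k) by [].
    by rewrite cE; move: dx => /=; nia.
  rewrite -(isum_hi _ _ (b := (c2 x %/ q2)%Z + 1)); last first.
    rewrite leNgt -upper_boundE//; apply/negP.
    have := upper_boundE (c0 x) ((c0 x %/ - q)%Z + 1) q0'; rewrite ltxx.
    have := upper_boundE (c0 x) (c0 x %/ - q)%Z q0'; rewrite ltrDl ltr01.
    by move: dx => /=; nia.
  apply: isum_eq => k _; rewrite -upper_boundE// cE mulrN opprK.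
  by case: ifP => // ->.
- have q0' : 0 < q by [].
  pose d := zlin_add (zlin_scale q1 c0) (zlin_scale (- q) c1).
  apply: pwq_ext (pwq_ite d (IH c1 c2 q1 q2 q10 q20) (IH c0 c2 q q2 q0' q20)) => x.
  case: ifP => dx.
    apply: isum_eq => k /andP[]; rewrite -lower_boundE// => hk _.
    suff -> : 0 <= c (x, k) by [].
    by rewrite cE; move: dx => /=; nia.
  rewrite -(isum_lo _ _ (a := - (c1 x %/ q1)%Z)); last first.
    rewrite -lower_boundE//.
    have := lower_boundE (c0 x) (- (c0 x %/ q)%Z) q0'; rewrite lexx.
    by move: dx => /=; nia.
  apply: isum_eq => k _; rewrite -lower_boundE// cE.
  by case: ifP => // ->.
- apply: pwq_ext (pwq_if c0 (IH c1 c2 q1 q2 q10 q20)) => x.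
  case: ifP => c0x.
    by apply: isum_eq => k _; rewrite cE q0 mulr0 addr0 c0x.
  by rewrite -[LHS](isum_zero (- (c1 x %/ q1)%Z) ((c2 x %/ q2)%Z + 1)); apply: isum_eq => k _; rewrite cE q0 mulr0 addr0 c0x.
Qed.

(** Fourier-Motzkin elimination: piecewise quasi-polynomials with homogeneous
    walls are stable under summation over a homogeneous range. *)
Lemma pwq_isum (G : zmodType) (F : (G * int)%type -> K) (e : zlin G) : pwq F ->
  pwq (fun x => isum 0 (e x + 1) (fun k => F (x, k))).
Proof.
move=> pF; suff H (cs : seq (zlin (G * int)%type)) : pwq (fun x => isum 0 (e x + 1)
    (fun k => if all (fun c : zlin (G * int)%type => 0 <= c (x, k)) cs then F (x, k) else 0)).
  exact: (H [::]).
elim: pF cs => {F} [f qf|c f _ IH|f g _ IHf _ IHg] cs.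
- apply: pwq_ext (pwq_isum_conds cs (zlin_scale 0 e) e qf ltr01 ltr01) => x /=.
  by rewrite mul0r div0z oppr0 divz1.
- apply: pwq_ext (IH (c :: cs)) => x; apply: isum_eq => k _ /=.
  by case: (0 <= c _); case: (all _ _).
- apply: pwq_ext (pwq_add (IHf cs) (IHg cs)) => x; rewrite -isumD.
  by apply: isum_eq => k _; case: ifP; rewrite ?addr0.
Qed.

End PiecewiseQuasiPolynomials.

(** * Rationality of lattice relations *)

Section Rationality.
Context {R : realType}.

Lemma map_intr_ratr m n (A : 'M[int]_(m, n)) :
  map_mx (intr : int -> R) A = map_mx (ratr : rat -> R) (map_mx intr A).
Proof. by apply/matrixP => i j; rewrite !mxE ratr_int. Qed.

Lemma map_intr_inj (F : numDomainType) m n (A B : 'M[int]_(m, n)) :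
  map_mx (intr : int -> F) A = map_mx intr B -> A = B.
Proof.
by move=> /matrixP h; apply/matrixP => i j; have := h i j; rewrite !mxE => /intr_inj.
Qed.

Lemma clear_denominators m n (A : 'M[rat]_(m, n)) :
  exists2 N : nat, (0 < N)%N & exists B : 'M[int]_(m, n),
    map_mx intr B = N%:R *: A.
Proof.
pose N := (\prod_(p : 'I_m * 'I_n) `|denq (A p.1 p.2)|)%N.
exists N; first by rewrite prodn_gt0// => p; rewrite absz_gt0 denq_neq0.
exists (\matrix_(i, j) (numq (A i j) *
  (\prod_(p : 'I_m * 'I_n | p != (i, j)) `|denq (A p.1 p.2)|)%N%:Z)).
apply/matrixP => i j; rewrite !mxE /N [in RHS](bigD1 (i, j))//=.
rewrite natrM rmorphM /= numqE natr_absz gtr0_norm ?denq_gt0// -pmulrn; ring.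
Qed.

Lemma submx_int k n (B : 'M[int]_(k, n)) (v : 'rV[int]_n) :
  (map_mx (intr : int -> R) v <= map_mx intr B)%MS ->
  exists2 N : nat, (0 < N)%N & exists c : 'rV[int]_k, v *+ N = c *m B.
Proof.
rewrite !map_intr_ratr map_submx => /submxP[x vx].
have [N N0 [c hc]] := clear_denominators x.
exists N => //; exists c; apply: (@map_intr_inj rat).
rewrite map_mxM hc -scalemxAl -vx; apply/matrixP => i j.
by rewrite -!scaler_nat !mxE rmorphM /= rmorph_nat.
Qed.

(** The cokernel of B is already defined over the rationals. *)
Lemma submx_int_equations k n (B : 'M[int]_(k, n)) :
  exists C : 'M[int]_n, forall v : 'rV[int]_n,
    (map_mx (intr : int -> R) v <= map_mx intr B)%MS = (v *m C == 0).
Proof.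
have [N N0 [C hC]] := clear_denominators (cokermx (map_mx intr B) : 'M[rat]_n).
exists C => v; rewrite !map_intr_ratr map_submx submxE.
apply/idP/idP => /eqP h; apply/eqP.
  apply: (@map_intr_inj rat); rewrite map_mxM hC -scalemxAr h scaler0.
  by rewrite map_mx0.
have /eqP : N%:R *: (map_mx intr v *m cokermx (map_mx intr B : 'M[rat]_(k, n))) = 0.
  by rewrite scalemxAr -hC -map_mxM h map_mx0.
by rewrite scaler_eq0 pnatr_eq0 gtn_eqF//= => /eqP.
Qed.

Lemma int_relation k n (B : 'M[int]_(k, n)) :
  ~~ row_free (map_mx (intr : int -> rat) B) ->
  exists2 c : 'rV[int]_k, c != 0 & c *m B = 0.
Proof.
rewrite -kermx_eq0 => /rowV0Pn[x /sub_kermxP xB x0].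
have [N N0 [c hc]] := clear_denominators x; exists c.
  apply: contra x0 => /eqP c0; move: hc; rewrite c0 map_mx0 => /esym/eqP.
  by rewrite scaler_eq0 pnatr_eq0 gtn_eqF.
by apply: (@map_intr_inj rat); rewrite map_mxM hc -scalemxAl xB scaler0 map_mx0.
Qed.

End Rationality.

(** * Twisted difference operators *)

Section Nabla.
Context {M : zmodType} {K : fieldType}.
Implicit Types (f g : M -> K) (a : M * K) (s t : seq (M * K)).

(** Multiplication by 1 - u e^a, for a = (a.1, a.2) with u = a.2, of the generating
    function of f. *)
Definition nab a f : M -> K := fun x => f x - a.2 * f (x - a.1).

Definition nabs s f : M -> K := foldr nab f s.

Lemma nabC a b f : nab a (nab b f) = nab b (nab a f).
Proof. by apply/funext => x; rewrite /nab [x - a.1 - b.1]addrAC; ring. Qed.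

Lemma nabs_nab s a f : nabs s (nab a f) = nab a (nabs s f).
Proof. by elim: s => //= b s IH; rewrite IH nabC. Qed.

Lemma nabs_cat s t f : nabs (s ++ t) f = nabs s (nabs t f).
Proof. exact: foldr_cat. Qed.

Lemma nabs_perm s t f : perm_eq s t -> nabs s f = nabs t f.
Proof.
elim: s t => [|a s IH] t; first by move=> /perm_size/esym/size0nil->.
move=> h; have at_ : a \in t by rewrite -(perm_mem h) mem_head.
have h' : perm_eq s (rem a t).
  by rewrite -(perm_cons a); apply: perm_trans h (perm_to_rem at_).
rewrite /= (IH _ h') {IH h h'}; elim: t at_ => //= b t IHt.
rewrite in_cons eq_sym; case: eqVneq => [->//|ba] /= /IHt <-.
exact: nabC.
Qed.

Lemma nabsC s t f : nabs s (nabs t f) = nabs t (nabs s f).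
Proof. by rewrite -!nabs_cat; apply: nabs_perm; rewrite perm_catC. Qed.

Lemma nabD a f g : nab a (fun x => f x + g x) = (fun x => nab a f x + nab a g x).
Proof. by apply/funext => x; rewrite /nab; ring. Qed.

Lemma nabs_zero s : nabs s (fun=> 0) = (fun=> 0).
Proof. by elim: s => //= a s ->; apply/funext => x; rewrite /nab mulr0 subrr. Qed.

Lemma nabsD s f g : nabs s (fun x => f x + g x) = (fun x => nabs s f x + nabs s g x).
Proof. by elim: s => //= a s ->; rewrite nabD. Qed.

Lemma nabsZ s c f : nabs s (fun x => c * f x) = (fun x => c * nabs s f x).
Proof. by elim: s => //= a s ->; apply/funext => x; rewrite /nab; ring. Qed.

Lemma nabsN s f : nabs s (fun x => - f x) = (fun x => - nabs s f x).
Proof.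
rewrite -[RHS]/(fun x => - nabs s f x).
have -> : (fun x => - f x) = (fun x => -1 * f x) by apply/funext => x; rewrite mulN1r.
by rewrite nabsZ; apply/funext => x; rewrite mulN1r.
Qed.

Lemma nabs_sum s (I : Type) (r : seq I) (P : pred I) (F : I -> M -> K) :
  nabs s (fun x => \sum_(i <- r | P i) F i x) =
  (fun x => \sum_(i <- r | P i) nabs s (F i) x).
Proof.
elim: r => [|i r IH].
  rewrite -[RHS](_ : (fun=> 0) = _); last by apply/funext => x; rewrite big_nil.
  by rewrite -[RHS](nabs_zero s); congr nabs; apply/funext => x; rewrite big_nil.
case Pi: (P i); last first.
  rewrite -[RHS](_ : (fun x => \sum_(j <- r | P j) nabs s (F j) x) = _); last first.
    by apply/funext => x; rewrite big_cons Pi.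
  by rewrite -IH; congr nabs; apply/funext => x; rewrite big_cons Pi.
transitivity (nabs s (fun x => F i x + \sum_(j <- r | P j) F j x)).
  by congr nabs; apply/funext => x; rewrite big_cons Pi.
by rewrite nabsD IH; apply/funext => x; rewrite big_cons Pi.
Qed.

Lemma nab_iter_fdiff a v k f :
  nab a (iter k (fdiff v) f) = iter k (fdiff v) (nab a f).
Proof.
elim: k => //= k <-; set h := iter _ _ _; apply/funext => x.
by rewrite /nab /fdiff [x + v - a.1]addrAC; ring.
Qed.

Lemma killed_iter v k f : killed v k f <-> iter k (fdiff v) f = (fun=> 0).
Proof.
elim: k f => [|k IH] f /=; first by split => [h|->//]; exact/funext.
by rewrite IH -iterSr.
Qed.

End Nabla.

Section LatticeEmbedding.
Context {R : realType} {n : nat} (D : 'M[R]_n).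
Hypothesis D_unit : D \in unitmx.
Notation M := 'rV[int]_n.

Definition emb (z : M) : 'rV[R]_n := map_mx intr z *m D.

Lemma embD x y : emb (x + y) = emb x + emb y.
Proof. by rewrite /emb map_mxD mulmxDl. Qed.

Lemma emb0 : emb 0 = 0.
Proof. by rewrite /emb map_mx0 mul0mx. Qed.

Lemma embN x : emb (- x) = - emb x.
Proof. by rewrite /emb map_mxN mulNmx. Qed.

Lemma embB x y : emb (x - y) = emb x - emb y.
Proof. by rewrite embD embN. Qed.

Lemma embMn x m : emb (x *+ m) = emb x *+ m.
Proof. by elim: m => [|m IH]; rewrite ?mulr0n ?emb0// !mulrSr embD IH. Qed.

Lemma embMz x m : emb (x *~ m) = emb x *~ m.
Proof. by case: m => m; rewrite ?NegzE ?mulrNz ?embN -!pmulrn embMn. Qed.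

Lemma emb_inj : injective emb.
Proof. by move=> x y /(can_inj (mulmxK D_unit))/map_intr_inj. Qed.

Definition span (bs : seq M) : {vspace 'rV[R]_n} := <<map emb bs>>%VS.

Lemma mem_spanE (bs : seq M) (x : M) :
  (emb x \in span bs) =
  (map_mx (intr : int -> R) x <= map_mx intr (\matrix_(i < size bs) bs`_i))%MS.
Proof.
apply/idP/idP => [xs|/submxP[c hc]].
  rewrite -[map_mx _ x](mulmxK D_unit) -/(emb x).
  have {xs}/coord_span -> : emb x \in <<in_tuple (map emb bs)>>%VS by [].
  rewrite mulmx_suml; apply: summx_sub => i _.
  rewrite -scalemxAl; apply: scalemx_sub.
  have ib : (i < size bs)%N by case: i => i /=; rewrite size_map.
  rewrite (nth_map 0)// mulmxK//.
  have -> : bs`_i = row (Ordinal ib) (\matrix_(i < size bs) bs`_i) by rewrite rowK.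
  by rewrite map_row row_sub.
rewrite /emb hc -mulmxA mulmx_sum_row; apply: memv_suml => i _; apply: memvZ.
rewrite row_mul -map_row rowK; apply: memv_span.
by apply/map_f/mem_nth.
Qed.

Lemma span_int (bs : seq M) (v : M) : emb v \in span bs ->
  exists2 N : nat, (0 < N)%N & exists c : nat -> int,
    v *+ N = \sum_(i < size bs) bs`_i *~ c i.
Proof.
rewrite mem_spanE => /submx_int[N N0 [c hc]]; exists N => //.
exists (fun i => if insub i is Some j then c 0 j else 0).
rewrite hc mulmx_sum_row; apply: eq_bigr => i _.
rewrite rowK insubT//= => p; rewrite -scaler_int intz; congr (c 0 _ *: _).
exact: val_inj.
Qed.

Lemma span_equations (bs : seq M) :
  exists C : 'M[int]_n, forall v : M, (emb v \in span bs) = (v *m C == 0).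
Proof.
have [C hC] := @submx_int_equations R _ _ (\matrix_(i < size bs) bs`_i).
by exists C => v; rewrite mem_spanE.
Qed.

End LatticeEmbedding.

Section DahmenMicchelli.
Context {R : realType} {n : nat} {K : fieldType} (D : 'M[R]_n).
Hypothesis D_unit : D \in unitmx.
Notation M := 'rV[int]_n.

Definition dm_system (v : M) (B : seq (M * K)) (g : M -> K) :=
  forall s : {vspace 'rV[R]_n}, emb D v \notin s ->
    nabs [seq b <- B | emb D b.1 \notin s] g = (fun=> 0).

(** For a weight b of B, translation by b multiplies h by the root of unity b.2,
    so translations by combinations of weights multiply it by roots of unity. *)
Lemma semiperiod_span (h : M -> K) (m : nat) (B : seq (M * K)) (c : nat -> int) :
  (0 < m)%N -> (forall b, b \in B -> b.2 ^+ m = 1) ->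
  (forall b, b \in B -> nab b h = (fun=> 0)) ->
  exists2 e, e ^+ m = 1 &
    forall x, h (x + \sum_(i < size B) (map fst B)`_i *~ c i) = e * h x.
Proof.
move=> m0 Bm hB; pose P w := exists2 e, e ^+ m = 1 & forall x, h (x + w) = e * h x.
have u0 e : e ^+ m = 1 -> e != 0 :> K.
  by apply: contra_eq_neq => ->; rewrite expr0n gtn_eqF// eq_sym oner_eq0.
have PD w w' : P w -> P w' -> P (w + w').
  move=> [e e1 he] [e' e1' he']; exists (e' * e); first by rewrite exprMn e1 e1' mulr1.
  by move=> x; rewrite addrA he' he mulrA.
have P0 : P 0 by exists 1; rewrite ?expr1n// => x; rewrite addr0 mul1r.
have PN w : P w -> P (- w).
  move=> [e e1 he]; exists e^-1; first by rewrite exprVn e1 invr1.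
  by move=> x; apply: (mulfI (u0 _ e1)); rewrite -he subrK mulrA mulfV ?mul1r// u0.
have PM w j : P w -> P (w *+ j).
  by move=> Pw; elim: j => [|j IH]; rewrite ?mulr0n// mulrSr; exact: PD.
have PMz w (j : int) : P w -> P (w *~ j).
  by move=> Pw; case: j => j; rewrite ?NegzE ?mulrNz -!pmulrn; [|apply: PN]; exact: PM.
apply: (big_ind P P0 PD) => i _; apply: PMz.
have bi : (nth (0, 0) B i) \in B by rewrite mem_nth.
rewrite (nth_map (0, 0))//; set b := nth _ _ _ in bi *.
exists b.2; first exact: Bm.
move=> x; have := congr1 (@^~ (x + b.1)) (hB _ bi).
by rewrite /nab addrK => /eqP; rewrite subr_eq0 => /eqP.
Qed.

(** Solutions of the Dahmen-Micchelli system of B are quasi-polynomial, by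
    induction on B: each nab b g solves the system of B minus b, hence a power
    of a difference operator in direction v maps g to a solution of
    nab b h = 0 for all b, that is to a semi-periodic function. *)
Lemma dm_system_killed (m : nat) (v : M) (B : seq (M * K)) : (0 < m)%N ->
  (forall b, b \in B -> b.2 ^+ m = 1) ->
  exists2 N, (0 < N)%N & exists k, forall g, dm_system v B g -> killed (v *+ N) k g.
Proof.
move=> m0; have outside B' g : emb D v \notin span D (map fst B') -> dm_system v B' g ->
    forall x, g x = 0.
  move=> vB /(_ _ vB) h x; rewrite -[RHS]/((fun=> 0) x) -h (_ : [seq b <- B' | _] = [::])//.
  apply/eqP; rewrite -[_ == _]negbK -has_filter -all_predC; apply/allP => b bB /=.
  by rewrite negbK memv_span// map_f// map_f.
move: {2}(size B) (leqnn (size B)) => sB.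
elim: sB B => [|sB IH] B hB Bm; have [vB|vB] := boolP (emb D v \in span D (map fst B)); last 1 first.
- by exists 1%N => //; exists 0%N => g hg x; exact: outside hg x.
- move: hB vB; rewrite leqn0 size_eq0 => /eqP -> /=.
  rewrite /span /= span_nil memv0 -(emb0 D) => /eqP/(emb_inj D_unit) ->.
  by exists 1%N => //; exists 1%N => g _ x /=; rewrite /fdiff mul0rn addr0 subrr.
- by exists 1%N => //; exists 0%N => g hg x; exact: outside hg x.
have sys b g : b \in B -> dm_system v B g -> dm_system v (rem b B) (nab b g).
  move=> bB hg s vs; have := hg s vs.
  have := perm_filter (fun b => emb D b.1 \notin s) (perm_to_rem bB).
  move=> /nabs_perm -> /=; case: ifP => bs /=; first by rewrite nabs_nab.
  by rewrite nabs_nab => ->; exact: (nabs_zero [:: b]).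
have [N1 N10 [k1 h1]] : exists2 N, (0 < N)%N & exists k, forall b g, b \in B ->
    dm_system v B g -> killed (v *+ N) k (nab b g).
  have : {subset B <= B} by [].
  move: {1 3}B => s; elim: s => [_|b s IHs sB'].
    by exists 1%N => //; exists 0%N.
  have [b' b's|N2 N20 [k2 h2]] := IHs; first by apply: sB'; rewrite in_cons b's orbT.
  have bB : b \in B by apply: sB'; rewrite mem_head.
  have [|b' /mem_rem b'B|N3 N30 [k3 h3]] := IH (rem b B).
  - by rewrite size_rem//; move: hB; case: (size B).
  - exact: Bm.
  exists (N2 * N3)%N; first by rewrite muln_gt0 N20.
  exists (maxn k2 k3) => b' g; rewrite in_cons => /orP[/eqP ->|b's] hg.
    rewrite mulnC mulrnA; apply/killedMn/(killedW (leq_maxr _ _)).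
    by apply: h3; exact: sys.
  by rewrite mulrnA; apply/killedMn/(killedW (leq_maxl _ _))/h2.
have [N2 N20 [c hc]] := span_int D_unit vB.
exists (N1 * (N2 * m))%N; first by rewrite !muln_gt0 N10 N20.
exists k1.+1 => g hg; set W := v *+ _.
have hW : W = (\sum_(i < size B) (map fst B)`_i *~ c i) *+ (m * N1).
  by rewrite size_map in hc; rewrite -hc -mulrnA /W; congr (_ *+ _); lia.
pose h := iter k1 (fdiff W) g.
have [|e e1 he] := @semiperiod_span h m B c m0 Bm.
  move=> b bB; rewrite nab_iter_fdiff; apply/killed_iter.
  by rewrite /W mulrnA; apply/killedMn/h1.
apply/killed_iter; rewrite iterS -/h; apply/funext => x; rewrite /fdiff hW.
have hj j : h (x + (\sum_(i < size B) (map fst B)`_i *~ c i) *+ j) = e ^+ j * h x.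
  elim: j => [|j IHj]; first by rewrite mulr0n addr0 expr0 mul1r.
  by rewrite mulrSr addrA he IHj exprS mulrA.
by rewrite hj exprM e1 expr1n mul1r subrr.
Qed.

End DahmenMicchelli.

(** * Generalized partition functions *)

Lemma fsumTE (T : choiceType) (K : nmodType) (S : seq T) (F : T -> K) : uniq S ->
  (forall x, F x != 0 -> x \in S) -> \sum_(x \in [set: T]) F x = \sum_(x <- S) F x.
Proof.
move=> uS hS; rewrite [RHS](@bigfs _ _ _ _ S xpredT)//.
  by congr (\big[_/_]_(_ \in _) _); apply/seteqP.
by move=> x _; apply: contraNeq; exact: hS.
Qed.

Section PartitionFunctions.
Context {R : realType} {M : zmodType} {K : fieldType}.
Implicit Types (tau : M -> R) (B : seq (M * K)) (x : M).

Definition pf_range tau (b : M * K) x := (Num.truncn (tau x / `|tau b.1|)).+1.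

(** The coefficients of the expansion of the product of the (1 - v e^b)^-1,
    (b, v) in B, into a geometric series in e^b or in e^-b according to the sign
    of tau b. The ranges are large enough to meet the whole support of the
    inner function. *)
Fixpoint pf tau B : M -> K :=
  if B is b :: B' then fun x =>
    if 0 < tau b.1 then
      \sum_(i < pf_range tau b x) b.2 ^+ i * pf tau B' (x - b.1 *+ i)
    else - \sum_(i < pf_range tau b x) b.2 ^- i.+1 * pf tau B' (x + b.1 *+ i.+1)
  else fun x => (x == 0)%:R.

Definition additive_map tau := forall x y, tau (x + y) = tau x + tau y.

Lemma additive_mapMn tau x i : additive_map tau -> tau (x *+ i) = tau x *+ i.
Proof.
move=> h; elim: i => [|i IH]; last by rewrite !mulrSr h IH.
by apply: (addrI (tau 0)); rewrite !mulr0n -h !addr0.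
Qed.

Lemma additive_mapN tau x : additive_map tau -> tau (- x) = - tau x.
Proof.
move=> h; apply: (addrI (tau x)); rewrite -h !subrr.
by have := additive_mapMn 0 0 h; rewrite !mulr0n.
Qed.

Lemma additive_mapB tau x y : additive_map tau -> tau (x - y) = tau x - tau y.
Proof. by move=> h; rewrite h additive_mapN. Qed.

Lemma sum_neq0 k (F : nat -> K) : \sum_(i < k) F i != 0 ->
  exists2 i, (i < k)%N & F i != 0.
Proof.
elim: k => [|k IH]; first by rewrite big_ord0 eqxx.
rewrite big_ord_recr /=; have [->|Fk _] := eqVneq (F k) 0; last by exists k.
by rewrite addr0 => /IH[i ik Fi]; exists i => //; rewrite ltnS ltnW.
Qed.

Lemma pf_cons_neq0 tau b B x : pf tau (b :: B) x != 0 ->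
  exists2 i : nat, (i < pf_range tau b x)%N &
    if 0 < tau b.1 then pf tau B (x - b.1 *+ i) != 0
    else pf tau B (x + b.1 *+ i.+1) != 0.
Proof.
rewrite /=; case: ifP => tb; rewrite ?oppr_eq0.
  move=> /(@sum_neq0 _ (fun i => b.2 ^+ i * pf tau B (x - b.1 *+ i)))[i ib].
  by rewrite mulf_eq0 negb_or => /andP[_ ?]; exists i.
move=> /(@sum_neq0 _ (fun i => b.2 ^- i.+1 * pf tau B (x + b.1 *+ i.+1)))[i ib].
by rewrite mulf_eq0 negb_or => /andP[_ ?]; exists i.
Qed.

Lemma pf_ge0 tau B x : additive_map tau -> pf tau B x != 0 -> 0 <= tau x.
Proof.
move=> h; elim: B x => [|b B IH] x.
  rewrite /=; case: (x =P 0) => [->|_]; last by rewrite eqxx.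
  by have := additive_mapMn 0 0 h; rewrite !mulr0n => ->.
move=> /pf_cons_neq0[i _]; case: ifP => tb /IH.
  rewrite additive_mapB// additive_mapMn// subr_ge0; apply: le_trans.
  by rewrite mulrn_wge0// ltW.
rewrite h additive_mapMn// => /le_trans; apply; rewrite gerDl mulrn_wle0//.
by rewrite leNgt tb.
Qed.

Lemma pf_ind (P : M -> Prop) tau B : P 0 ->
  (forall b x, b \in B -> P x -> P (x + b.1) /\ P (x - b.1)) ->
  forall x, pf tau B x != 0 -> P x.
Proof.
move=> P0; elim: B => [|b B IH] hP x.
  by rewrite /=; case: (x =P 0) => [->|_]; rewrite ?eqxx.
have {}IH y : pf tau B y != 0 -> P y.
  by apply: IH => b' z b'B; apply: hP; rewrite in_cons b'B orbT.
have PM y i : P y -> P (y + b.1 *+ i) /\ P (y - b.1 *+ i).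
  move=> Py; elim: i => [|i [IH1 IH2]]; first by rewrite mulr0n subr0 addr0.
  rewrite mulrSr addrA opprD addrA.
  by split; [have [] := hP b _ (mem_head _ _) IH1|have [] := hP b _ (mem_head _ _) IH2].
move=> /pf_cons_neq0[i _]; case: ifP => tb /IH /PM.
  by move=> /(_ i)[]; rewrite subrK.
by move=> /(_ i.+1)[_]; rewrite addrK.
Qed.

Lemma pf_finite tau B (c : R) : additive_map tau ->
  (forall b, b \in B -> tau b.1 != 0) ->
  exists S : seq M, forall x, tau x <= c -> pf tau B x != 0 -> x \in S.
Proof.
move=> h; elim: B c => [|b B IH] c hB.
  by exists [:: 0] => x _ /=; case: (x =P 0) => [->|_]; rewrite ?mem_head ?eqxx.
have [b' b'B|S hS] := IH c; first by apply: hB; rewrite in_cons b'B orbT.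
have tb0 := hB b (mem_head _ _).
pose k := (Num.truncn (c / `|tau b.1|)).+1.
exists ([seq s + b.1 *+ i | s <- S, i <- iota 0 k] ++
        [seq s - b.1 *+ i.+1 | s <- S, i <- iota 0 k]) => x xc.
move=> /pf_cons_neq0[i ik].
have {}ik : (i < k)%N.
  apply: leq_trans ik _; rewrite ltnS; apply: le_truncn.
  by rewrite ler_pM2r// invr_gt0 normr_gt0.
rewrite mem_cat; case: ifP => tb nz; apply/orP; [left|right].
  rewrite -[x](subrK (b.1 *+ i)); apply/allpairsP; exists (x - b.1 *+ i, i).
  split; rewrite ?mem_iota ?subrK//=.
  apply: hS => //; rewrite additive_mapB// additive_mapMn//.
  by apply: le_trans xc; rewrite lerBlDr lerDl mulrn_wge0// ltW.
rewrite -[x](addrK (b.1 *+ i.+1)); apply/allpairsP; exists (x + b.1 *+ i.+1, i).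
split; rewrite ?mem_iota ?addrK//=.
apply: hS => //; rewrite h additive_mapMn//.
by apply: le_trans xc; rewrite gerDl mulrn_wle0// leNgt tb.
Qed.

Lemma pf_rangeP tau b x i : additive_map tau -> tau b.1 != 0 ->
  (pf_range tau b x <= i)%N -> tau x < `|tau b.1| *+ i.
Proof.
move=> h tb hi; rewrite -[_ *+ i]mulr_natr -ltr_pdivrMl ?normr_gt0// mulrC.
apply: lt_le_trans (truncnS_gt _) _.
by rewrite ler_nat.
Qed.

Lemma pf_widen_pos tau b B x k : additive_map tau -> 0 < tau b.1 ->
  (pf_range tau b x <= k)%N ->
  pf tau (b :: B) x = \sum_(i < k) b.2 ^+ i * pf tau B (x - b.1 *+ i).
Proof.
move=> h tb xk; rewrite /= tb (big_ord_widen _ (fun i => b.2 ^+ i * pf tau B (x - b.1 *+ i)) xk).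
rewrite [RHS](bigID (fun i : 'I_k => (i < pf_range tau b x)%N))/= [X in _ = _ + X]big1 ?addr0//.
move=> i; rewrite -leqNgt => /(pf_rangeP h) hi.
suff -> : pf tau B (x - b.1 *+ i) = 0 by rewrite mulr0.
apply/eqP; rewrite -[_ == _]negbK; apply/negP => /(pf_ge0 h).
rewrite leNgt additive_mapB// additive_mapMn// subr_lt0.
by have := hi; rewrite gt_eqF// gtr0_norm// => ->.
Qed.

Lemma pf_widen_neg tau b B x k : additive_map tau -> tau b.1 < 0 ->
  (pf_range tau b x <= k)%N ->
  pf tau (b :: B) x = - \sum_(i < k) b.2 ^- i.+1 * pf tau B (x + b.1 *+ i.+1).
Proof.
move=> h tb xk; rewrite /= ltNge ltW//=; congr (- _).
rewrite (big_ord_widen _ (fun i => b.2 ^- i.+1 * pf tau B (x + b.1 *+ i.+1)) xk).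
rewrite [RHS](bigID (fun i : 'I_k => (i < pf_range tau b x)%N))/= [X in _ = _ + X]big1 ?addr0//.
move=> i; rewrite -leqNgt => /(pf_rangeP h) hi.
suff -> : pf tau B (x + b.1 *+ i.+1) = 0 by rewrite mulr0.
apply/eqP; rewrite -[_ == _]negbK; apply/negP => /(pf_ge0 h).
rewrite leNgt h additive_mapMn//.
have := hi; rewrite lt_eqF// ltr0_norm// mulNrn => /(_ isT) hi'.
by rewrite mulrSr addrA (lt_trans _ tb)// gtrDr -ltrBrDr sub0r.
Qed.

Lemma nab_pf tau b B : additive_map tau -> tau b.1 != 0 -> b.2 != 0 ->
  nab b (pf tau (b :: B)) = pf tau B.
Proof.
move=> h tb0 ub; apply/funext => x; rewrite /nab.
pose k := maxn (pf_range tau b x) (pf_range tau b (x - b.1)).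
have k1 : (pf_range tau b x <= k)%N by rewrite leq_maxl.
have k2 : (pf_range tau b (x - b.1) <= k)%N by rewrite leq_maxr.
have [tb|tb|tb] := ltgtP 0 (tau b.1); last by rewrite -tb eqxx in tb0.
  rewrite (pf_widen_pos _ h tb (leqW k1)) (pf_widen_pos _ h tb k2).
  rewrite big_ord_recl /= expr0 mul1r mulr0n subr0 mulr_sumr.
  rewrite -addrA -sumrB big1 ?addr0// => i _.
  by rewrite /bump /= add1n exprS mulrS opprD addrA mulrA subrr.
rewrite (pf_widen_neg _ h tb k1) (pf_widen_neg _ h tb (leqW k2)).
rewrite big_ord_recl /= expr1 mulr1n subrK mulrN opprK mulrDr mulrA mulfV// mul1r.
rewrite addrC -addrA mulr_sumr -sumrB big1 ?addr0// => i _.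
rewrite /bump /= add1n exprS invfM !mulrA mulfV// mul1r.
by rewrite mulrS addrA subrK subrr.
Qed.

(** A function invariant up to a factor under translation by b, and supported
    in a half-space, vanishes, since b is transverse to the boundary. *)
Lemma nab_zero_eq0 tau b (f : M -> K) (c : R) : additive_map tau ->
  tau b.1 != 0 -> b.2 != 0 -> (forall x, f x != 0 -> c <= tau x) ->
  nab b f = (fun=> 0) -> f = (fun=> 0).
Proof.
move=> h tb0 ub fc fb.
have f1 x : f x = b.2 * f (x - b.1).
  by have := congr1 (@^~ x) fb; rewrite /nab => /eqP; rewrite subr_eq0 => /eqP.
have f2 x : f (x - b.1) = b.2^-1 * f x by rewrite [in RHS]f1 mulrA mulVf// mul1r.
have h1 i x : (f x == 0) = (f (x - b.1 *+ i) == 0).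
  elim: i => [|i ->]; first by rewrite mulr0n subr0.
  by rewrite f1 mulf_eq0 (negPf ub) /= mulrSr opprD addrA.
have h2 i x : (f x == 0) = (f (x + b.1 *+ i) == 0).
  by rewrite [RHS](h1 i) addrK.
apply/funext => x; apply/eqP/negPn/negP => fx.
pose i := (Num.truncn ((tau x - c) / `|tau b.1|)).+1.
have hi : tau x - c < `|tau b.1| *+ i.
  by rewrite -[_ *+ i]mulr_natr -ltr_pdivrMl ?normr_gt0// mulrC truncnS_gt.
have [tb|tb|tb] := ltgtP 0 (tau b.1); last by rewrite -tb eqxx in tb0.
  have := fc (x - b.1 *+ i); rewrite -(h1 i) => /(_ fx).
  by rewrite leNgt additive_mapB// additive_mapMn// ltrBlDr -ltrBlDl (lt_le_trans hi)// gtr0_norm.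
have := fc (x + b.1 *+ i); rewrite -(h2 i) => /(_ fx).
move: hi; rewrite h additive_mapMn// ltr0_norm// mulNrn.
by rewrite ltrBlDr addrC ltrBrDr => h' /(lt_le_trans h'); rewrite ltxx.
Qed.

Lemma nabs_support tau s (f : M -> K) (c : R) : additive_map tau ->
  (forall x, f x != 0 -> c <= tau x) ->
  exists c', forall x, nabs s f x != 0 -> c' <= tau x.
Proof.
move=> h hf; elim: s => [|a s [c' IH]]; first by exists c.
exists (Num.min c' (c' + tau a.1)) => x; rewrite /= /nab => nz.
have : (nabs s f x != 0) || (nabs s f (x - a.1) != 0).
  by apply: contraNT nz; rewrite negb_or !negbK => /andP[/eqP -> /eqP ->]; rewrite mulr0 subrr.
move=> /orP[/IH h1|/IH]; first by rewrite ge_min h1.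
by rewrite additive_mapB// lerBrDr => h1; rewrite ge_min h1 orbT.
Qed.

(** Each operator cancels one factor of the product which pf expands. If the
    head factor is not the one cancelled, both sides are supported in a
    half-space and become equal after applying its operator. *)
Lemma nabs_pf tau (p : pred (M * K)) B : additive_map tau ->
  (forall b, b \in B -> tau b.1 != 0) -> (forall b, b \in B -> b.2 != 0) ->
  nabs [seq b <- B | p b] (pf tau B) = pf tau [seq b <- B | ~~ p b].
Proof.
move=> h; elim: B => [//|b B IH] tB uB.
have {}IH : nabs [seq b <- B | p b] (pf tau B) = pf tau [seq b <- B | ~~ p b].
  by apply: IH => b' b'B; [apply: tB|apply: uB]; rewrite in_cons b'B orbT.
have tb := tB b (mem_head _ _); have ub := uB b (mem_head _ _).
rewrite [X in nabs X]/= [X in _ = pf tau X]/=; case: ifP => pb.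
  change (nab b (nabs [seq b <- B | p b] (pf tau (b :: B))) = pf tau [seq b <- B | ~~ p b]).
  by rewrite -nabs_nab nab_pf.
change (nabs [seq b <- B | p b] (pf tau (b :: B)) = pf tau (b :: [seq b <- B | ~~ p b])).
set f := nabs _ _; set g := pf _ _.
have [c hc] := nabs_support [seq b <- B | p b] h (fun x => @pf_ge0 tau (b :: B) x h).
suff fg0 : (fun x => f x + (- g x)) = (fun=> 0).
  by apply/funext => x; have := congr1 (@^~ x) fg0 => /= /eqP; rewrite subr_eq0 => /eqP.
apply: (@nab_zero_eq0 tau b _ (Num.min c 0)) => //.
  move=> x; rewrite -/(f x) => nz.
  have : (f x != 0) || (g x != 0).
    by apply: contraNT nz; rewrite negb_or !negbK => /andP[/eqP -> /eqP ->]; rewrite subrr.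
  by move=> /orP[/hc h1|/pf_ge0 h1]; rewrite ge_min ?h1 ?orbT.
rewrite nabD -[nab b (fun x => - g x)]/(nabs [:: b] (fun x => - g x)) nabsN /=.
rewrite nab_pf// -/f /f -nabs_nab nab_pf// IH.
by apply/funext => x; rewrite subrr.
Qed.

End PartitionFunctions.

(** * The recursive decomposition *)

Section Decomposition.
Context {R : realType} {n : nat} {K : fieldType} (D : 'M[R]_n).
Notation M := 'rV[int]_n.
Notation E := 'rV[R]_n.
Notation weights := (seq (M * K)).
Implicit Types (r s : {vspace E}).

Definition wts (A : weights) r := [seq a <- A | emb D a.1 \in r].
Definition wts_diff (A : weights) r s := [seq a <- wts A r | emb D a.1 \notin s].

Definition wspan (A : weights) := span D (map fst A).

Definition flats (A : weights) : seq {vspace E} :=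
  undup [seq wspan (mask m A) | m : (size A).-tuple bool].

Lemma mem_flats (A : weights) (m : bitseq) : size m = size A ->
  wspan (mask m A) \in flats A.
Proof.
move=> sm; rewrite mem_undup; apply/mapP.
by exists (tcast sm (in_tuple m)); rewrite ?mem_enum// val_tcast.
Qed.

Lemma mem_flats_filter (A : weights) (p : pred (M * K)) :
  wspan [seq a <- A | p a] \in flats A.
Proof. by rewrite filter_mask; apply: mem_flats; rewrite size_map. Qed.

Lemma wspan_mem (A : weights) a : a \in A -> emb D a.1 \in wspan A.
Proof. by move=> aA; apply: memv_span; apply/map_f/map_f. Qed.

Lemma wspan_sub (A : weights) r : (forall a, a \in A -> emb D a.1 \in r) ->
  (wspan A <= r)%VS.
Proof.
move=> h; apply/span_subvP => _ /mapP[_ /mapP[a aA ->] ->]; exact: h.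
Qed.

(** A flat is spanned by any sublist of A which defines it, hence by all the
    weights of A which it contains. *)
Lemma flats_span (A : weights) r : r \in flats A -> r = wspan (wts A r).
Proof.
rewrite mem_undup => /mapP[m _ ->]; set B := mask m A.
have BA a : a \in B -> a \in A by move/mem_mask.
apply/eqP; rewrite eqEsubv; apply/andP; split.
  apply: wspan_sub => a aB; apply: wspan_mem.
  by rewrite mem_filter BA// wspan_mem.
by apply: wspan_sub => a; rewrite mem_filter => /andP[].
Qed.

Lemma wts_diff_sub (A : weights) r s a : a \in wts_diff A r s ->
  [/\ a \in A, emb D a.1 \in r & emb D a.1 \notin s].
Proof. by rewrite !mem_filter => /and3P[]. Qed.

Lemma vspace_properP r s : (s <= r)%VS -> s != r -> (\dim s < \dim r)%N.
Proof.
by move=> sr; apply: contraNT; rewrite -leqNgt => h; rewrite eqEdim sr.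
Qed.

(** Convolution of g with a kernel depending on the point of the support. *)
Definition cvf (g : M -> K) (F : M -> M -> K) : M -> K :=
  fun x => \sum_(y \in [set: M]) g y * F y (x - y).

Section Kernels.
Variable Y : M -> Prop.
Implicit Types (g : M -> K) (F : M -> M -> K).

Definition supported_on g := forall y, g y != 0 -> Y y.

Definition locally_finite F := forall x, exists S : seq M,
  forall y, Y y -> F y (x - y) != 0 -> y \in S.

Lemma cvf_seq g F x (S : seq M) : supported_on g -> uniq S ->
  (forall y, Y y -> F y (x - y) != 0 -> y \in S) ->
  cvf g F x = \sum_(y <- S) g y * F y (x - y).
Proof.
move=> gY uS hS; apply: fsumTE => // y; rewrite mulf_eq0 negb_or => /andP[gy Fy].
by apply: hS => //; exact: gY.
Qed.

Lemma eq_cvf g F F' : supported_on g -> (forall y, Y y -> F y = F' y) ->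
  cvf g F = cvf g F'.
Proof.
move=> gY FF; apply/funext => x; apply: eq_fsbigr => y _.
by have [->|/gY/FF->] := eqVneq (g y) 0; rewrite ?mul0r.
Qed.

Lemma nab_cvf a g F : supported_on g -> locally_finite F ->
  locally_finite (fun y => nab a (F y)) /\
  nab a (cvf g F) = cvf g (fun y => nab a (F y)).
Proof.
move=> gY lF.
have key x : exists S : seq M, [/\ uniq S, (forall y, Y y -> F y (x - y) != 0 -> y \in S)
    & (forall y, Y y -> F y (x - a.1 - y) != 0 -> y \in S)].
  have [S1 h1] := lF x; have [S2 h2] := lF (x - a.1).
  exists (undup (S1 ++ S2)); split; first exact: undup_uniq.
    by move=> y Yy /(h1 _ Yy) h; rewrite mem_undup mem_cat h.
  by move=> y Yy /(h2 _ Yy) h; rewrite mem_undup mem_cat h orbT.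
have key2 x S : (forall y, Y y -> F y (x - y) != 0 -> y \in S) ->
    (forall y, Y y -> F y (x - a.1 - y) != 0 -> y \in S) ->
    forall y, Y y -> nab a (F y) (x - y) != 0 -> y \in S.
  move=> h1 h2 y Yy; rewrite /nab [x - y - a.1]addrAC => nz.
  have [F0|/(h1 _ Yy)//] := eqVneq (F y (x - y)) 0; apply: (h2 _ Yy).
  by apply: contraNneq nz => ->; rewrite F0 mulr0 subrr.
split=> [x|]; first by have [S [_ h1 h2]] := key x; exists S; exact: key2.
apply/funext => x; have [S [uS h1 h2]] := key x.
rewrite {1}/nab !(cvf_seq (S := S))//; last exact: key2.
rewrite mulr_sumr -sumrB; apply: eq_bigr => y _.
by rewrite /nab [x - y - a.1]addrAC; ring.
Qed.

Lemma nabs_cvf (t : weights) g F : supported_on g -> locally_finite F ->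
  nabs t (cvf g F) = cvf g (fun y => nabs t (F y)).
Proof.
move=> gY lF; suff [] : locally_finite (fun y => nabs t (F y)) /\
  nabs t (cvf g F) = cvf g (fun y => nabs t (F y)) by [].
elim: t => [//|a t [IH1 IH2]] /=; rewrite IH2.
exact: nab_cvf.
Qed.

(** Difference operators along directions leaving the kernel invariant may act
    on g instead. *)
Lemma nab_cvf_l a g F : supported_on g -> locally_finite F ->
  (forall y, Y y -> Y (y + a.1)) -> (forall y, F (y + a.1) = F y) ->
  supported_on (nab a g) /\ nab a (cvf g F) = cvf (nab a g) F.
Proof.
move=> gY lF Ya Fa.
have gY' : supported_on (nab a g).
  move=> y; rewrite /nab => nz; have [g0|/gY//] := eqVneq (g y) 0.
  have : g (y - a.1) != 0 by apply: contraNneq nz => ->; rewrite g0 mulr0 subrr.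
  by move=> /gY/Ya; rewrite subrK.
split=> //; apply/funext => x.
have [S1 h1] := lF x; have [S2 h2] := lF (x - a.1).
have e2 : cvf g F (x - a.1) = \sum_(y \in [set: M]) g (y - a.1) * F y (x - y).
  rewrite /cvf (reindex_fsbigT (fun y => y - a.1)); last first.
    by exists (fun y => y + a.1) => y; rewrite ?subrK ?addrK.
  apply: eq_fsbigr => y _; rewrite -(Fa (y - a.1)) subrK opprB addrA.
  by rewrite subrK.
pose S := undup (S1 ++ [seq y + a.1 | y <- S2]).
have uS : uniq S by exact: undup_uniq.
have hS1 y : Y y -> F y (x - y) != 0 -> y \in S.
  by move=> Yy /(h1 _ Yy) h; rewrite mem_undup mem_cat h.
rewrite {1}/nab e2 (cvf_seq gY uS hS1) (cvf_seq gY' uS hS1).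
rewrite (@fsumTE _ _ S)//; last first.
  move=> y; rewrite mulf_eq0 negb_or => /andP[/gY Yy].
  rewrite -{1}[y](subrK a.1) Fa => Fy.
  rewrite mem_undup mem_cat; apply/orP; right; apply/mapP; exists (y - a.1); last by rewrite subrK.
  by apply: h2 => //; rewrite opprB addrA subrK.
rewrite mulr_sumr -sumrB; apply: eq_bigr => y _.
by rewrite /nab; ring.
Qed.

Lemma nabs_cvf_l (t : weights) g F : supported_on g -> locally_finite F ->
  (forall a, a \in t -> forall y, Y y -> Y (y + a.1)) ->
  (forall a, a \in t -> forall y, F (y + a.1) = F y) ->
  supported_on (nabs t g) /\ nabs t (cvf g F) = cvf (nabs t g) F.
Proof.
move=> gY lF; elim: t => [//|a t IH] hY hF.
have [||IH1 IH2] := IH.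
- by move=> b bt; apply: hY; rewrite in_cons bt orbT.
- by move=> b bt; apply: hF; rewrite in_cons bt orbT.
have [||h1 h2] := nab_cvf_l (a := a) IH1 lF.
- by apply: hY; rewrite mem_head.
- by apply: hF; rewrite mem_head.
by rewrite /= IH2.
Qed.

End Kernels.

(* V r is the function to be decomposed, T s y the linear form which polarizes
   the weights outside s at the point y, Y s the union of the strata parallel
   to s. *)
Variables (A : weights) (V : {vspace E} -> M -> K) (T : {vspace E} -> M -> M -> R).
Variable Y : {vspace E} -> M -> Prop.

Definition pker s (B : weights) y := pf (T s y) B.

(** The recursion runs over the proper subflats; d bounds the dimension. *)
Fixpoint grec (d : nat) r : M -> K :=
  if d is d'.+1 then fun x => V r x -
    \sum_(s <- flats A | (s <= r)%VS && (s != r))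
      cvf (grec d' s) (pker s (wts_diff A r s)) x
  else fun=> 0.

Definition gpart r := grec (\dim r).+1 r.

Lemma eq_grec d d' r : (\dim r < d)%N -> (\dim r < d')%N -> grec d r = grec d' r.
Proof.
elim: d d' r => [//|d IH] [//|d'] r rd rd' /=; apply/funext => x.
congr (_ - _); apply: eq_bigr => s /andP[sr srn]; congr cvf.
have := vspace_properP sr srn => sd.
by apply: IH; apply: (leq_trans sd); rewrite -ltnS.
Qed.

Lemma gpartE r x : gpart r x = V r x -
  \sum_(s <- flats A | (s <= r)%VS && (s != r))
    cvf (gpart s) (pker s (wts_diff A r s)) x.
Proof.
rewrite {1}/gpart /=; congr (_ - _); apply: eq_bigr => s /andP[sr srn].
by rewrite (@eq_grec _ (\dim s).+1)//; exact: vspace_properP.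
Qed.

Hypothesis A_unit : forall a, a \in A -> a.2 != 0.
Hypothesis Y_add : forall r s x z, (s <= r)%VS -> Y s x -> emb D z \in r -> Y r (x + z).
Hypothesis V_supp : forall r, r \in flats A -> supported_on (Y r) (V r).
Hypothesis V_rel : forall r s, (s <= r)%VS -> s \in flats A -> r \in flats A ->
  nabs (wts_diff A r s) (nabs (wts_diff A r s) (V r)) = nabs (wts_diff A r s) (V s).
Hypothesis T_add : forall s y, additive_map (T s y).
Hypothesis T_inv : forall s y z, emb D z \in s -> T s (y + z) = T s y.
Hypothesis T_pol : forall s y a, s \in flats A -> Y s y -> a \in A -> emb D a.1 \notin s ->
  T s y a.1 != 0.
Hypothesis T_lf : forall r s, s \in flats A -> locally_finite (Y s) (pker s (wts_diff A r s)).

Lemma cvf_delta g s : cvf g (pker s [::]) = g.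
Proof.
apply/funext => x; rewrite /cvf (@fsumTE _ _ [:: x])//.
  by rewrite big_seq1 /pker /= subrr eqxx mulr1.
move=> y; have [->|yx] := eqVneq y x; first by rewrite mem_head.
by rewrite mulf_eq0 /pker /= subr_eq0 [x == y]eq_sym (negPf yx) eqxx orbT.
Qed.

Lemma pker_supp s r y x : pker s (wts_diff A r s) y x != 0 -> emb D x \in r.
Proof.
apply: (@pf_ind _ _ _ (fun x => emb D x \in r)) => [|b z /wts_diff_sub[_ br _] zr].
  by rewrite emb0 mem0v.
by rewrite embB embD rpredB// rpredD.
Qed.

Lemma cvf_supp s r g : (s <= r)%VS -> supported_on (Y s) g ->
  supported_on (Y r) (cvf g (pker s (wts_diff A r s))).
Proof.
move=> sr gY x; rewrite /cvf => /eqP; apply: contra_notP => nY.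
apply: fsbig1 => y _; apply/eqP; rewrite mulf_eq0; apply/norP => -[gy Fy].
apply: nY; have := Y_add sr (gY _ gy) (pker_supp Fy).
by rewrite addrC subrK.
Qed.

Lemma gpart_supp r : r \in flats A -> supported_on (Y r) (gpart r).
Proof.
move: {2}(\dim r) (leqnn (\dim r)) => d; elim: d r => [|d IH] r rd rA x;
  rewrite gpartE => nz; apply: contrapT => nY; move: nz;
  rewrite (_ : V r x = 0) ?sub0r ?oppr_eq0; try by
    apply/eqP; apply: contra_notT nY; exact: V_supp.
- rewrite big1_seq ?eqxx// => s /andP[/andP[sr srn] _].
  by have := vspace_properP sr srn; rewrite ltnNge (leq_trans rd).
- rewrite big1_seq ?eqxx// => s /andP[/andP[sr srn] sA].
  apply/eqP; apply: contra_notT nY; apply: cvf_supp => //; apply: IH => //.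
  by rewrite -ltnS (leq_trans (vspace_properP sr srn)).
Qed.

(** The term s = r of the sum is gpart r itself, as no weight of r is outside r,
    and the others were subtracted from V r in its definition. *)
Lemma V_sum r x : r \in flats A ->
  V r x = \sum_(s <- flats A | (s <= r)%VS) cvf (gpart s) (pker s (wts_diff A r s)) x.
Proof.
move=> rA; rewrite big_mkcond (bigD1_seq r)//= ?undup_uniq// subvv -big_mkcondr.
rewrite (eq_bigl (fun s => (s <= r)%VS && (s != r))); last by move=> s; rewrite andbC.
rewrite (_ : wts_diff A r r = [::]) ?cvf_delta.
  by rewrite gpartE subrK.
apply/eqP; rewrite -[_ == _]negbK -has_filter; apply/hasPn => a.
by rewrite mem_filter => /andP[->].
Qed.

(** Let s be the span of the weights of r inside s', and C the operators of the
    other weights of r. Apply C twice to the decomposition of V r. On the left,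
    C C (V r) = C (V s), which decomposes into the terms of the subflats of s. On
    the right, the terms of the proper subflats r' of r which are not inside s
    die by induction, and for r' inside s, C turns the kernel relative to r into
    the kernel relative to s. What is left is C C (gpart r) = 0. *)
Lemma gpart_dm r (s' : {vspace E}) : r \in flats A -> ~~ (r <= s')%VS ->
  nabs (wts_diff A r s') (nabs (wts_diff A r s') (gpart r)) = (fun=> 0).
Proof.
move: {2}(\dim r) (leqnn (\dim r)) => d; elim: d r s' => [|d IH] r s' rd rA rs'.
  move: rd; rewrite leqn0 dimv_eq0 => /eqP r0; move: rs'.
  by rewrite r0 sub0v.
pose s := wspan [seq a <- wts A r | emb D a.1 \in s'].
have sA : s \in flats A by rewrite /s -filter_predI; exact: mem_flats_filter.
have sr : (s <= r)%VS by apply: wspan_sub => a; rewrite !mem_filter => /and3P[].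
have ss' : (s <= s')%VS by apply: wspan_sub => a; rewrite !mem_filter => /and3P[].
have srn : s != r by apply: contraNneq rs' => <-.
have eC : wts_diff A r s' = wts_diff A r s.
  apply: eq_in_filter => a; rewrite mem_filter => /andP[ar aA]; congr (~~ _).
  apply/idP/idP => [as'|/(subvP ss')//].
  by apply: wspan_mem; rewrite !mem_filter as' ar.
rewrite eC; set C := wts_diff A r s.
have Cu b : b \in C -> b.2 != 0 by move=> /wts_diff_sub[/A_unit].
have rel x : nabs C (nabs C (V r)) x =
    \sum_(r' <- flats A | (r' <= s)%VS)
       nabs C (cvf (gpart r') (pker r' (wts_diff A s r'))) x.
  rewrite V_rel// -/C -[RHS](congr1 (@^~ x) (nabs_sum _ _ _ _)) /=.
  by congr (nabs C _ x); apply/funext => y; exact: V_sum.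
apply/funext => x.
have -> : gpart r = fun x => V r x + - \sum_(s <- flats A | (s <= r)%VS && (s != r))
    cvf (gpart s) (pker s (wts_diff A r s)) x by apply/funext => y; exact: gpartE.
rewrite !nabsD !nabsN !nabs_sum rel; apply/eqP; rewrite subr_eq0; apply/eqP.
rewrite [RHS](bigID (fun r' => (r' <= s)%VS))/= [X in _ = _ + X]big1_seq ?addr0; last first.
  move=> r' /andP[/andP[/andP[r'r r'rn] r's] r'A].
  have r'd : (\dim r' <= d)%N by rewrite -ltnS (leq_trans (vspace_properP r'r r'rn)).
  have r'Y := gpart_supp r'A.
  have eB : wts_diff A r' s = [seq a <- C | emb D a.1 \in r'].
    rewrite /C /wts_diff /wts -!filter_predI; apply: eq_filter => a /=.
    by case: (boolP (emb D a.1 \in r')) => /= [/(subvP r'r) ->|_]; rewrite ?andbT ?andbF.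
  have pC : perm_eq C ([seq a <- C | emb D a.1 \notin r'] ++ wts_diff A r' s).
    by rewrite eB perm_sym perm_catC perm_filterC.
  rewrite !(nabs_perm _ pC) !nabs_cat [nabs (wts_diff A r' s) (nabs [seq _ <- C | _] _)]nabsC.
  have := @nabs_cvf_l (Y r') (wts_diff A r' s ++ wts_diff A r' s) (gpart r') _ r'Y (T_lf r r'A).
  rewrite nabs_cat => -[||_].
  - by move=> a; rewrite mem_cat orbb => /wts_diff_sub[_ ar' _] y Yy; exact: (Y_add (subvv _)).
  - by move=> a; rewrite mem_cat orbb => /wts_diff_sub[_ ar' _] y; rewrite /pker T_inv.
  rewrite nabs_cat => ->; rewrite IH//.
  rewrite (_ : cvf (fun=> 0) _ = fun=> 0) ?nabs_zero//.
  by apply/funext => y; rewrite /cvf fsbig1// => z _; rewrite mul0r.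
rewrite [LHS]big_mkcond [RHS]big_mkcond; apply: eq_big_seq => r' r'A /=.
case: (boolP (r' <= s)%VS) => r's; last by rewrite andbF.
have r'r := subv_trans r's sr.
have r'rn : r' != r.
  by apply: contraTneq r's => ->; apply: contra srn => rs; rewrite eqEsubv sr.
rewrite r'r r'rn /=; congr (nabs C _ x); rewrite (nabs_cvf _ (gpart_supp r'A) (T_lf r r'A)).
apply: (eq_cvf (gpart_supp r'A)) => y Yy; rewrite /pker.
have -> : C = [seq a <- wts_diff A r r' | emb D a.1 \notin s].
  rewrite /C /wts_diff -filter_predI; apply: eq_filter => a /=.
  have := subvP r's (emb D a.1).
  by case: (_ \in r') => [/(_ isT) ->|_] //=; rewrite andbT.
rewrite nabs_pf//.
- congr pf; rewrite /wts_diff /wts -!filter_predI; apply: eq_filter => a /=.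
  have := subvP sr (emb D a.1); rewrite negbK.
  by case: (_ \in s) => [/(_ isT) ->|_]; rewrite ?andbT ?andbF.
- by move=> b /wts_diff_sub[bA _ br']; exact: T_pol.
- by move=> b /wts_diff_sub[bA _ _]; exact: A_unit.
Qed.

End Decomposition.

(** * Iterated integrals of bounded Lipschitz functions over the cube *)

Section CubeIntegral.
Context {R : realType}.

Definition dist1 m (x y : 'rV[R]_m) : R := \sum_i `|x 0 i - y 0 i|.

(** A class of functions that is visibly stable under partial integration. *)
Definition blip m (F : 'rV[R]_m -> R) : Prop := exists2 B : R, 0 <= B &
  (forall x, `|F x| <= B) /\ (forall x y, `|F x - F y| <= B * dist1 x y).

Lemma dist1_ge0 m (x y : 'rV[R]_m) : 0 <= dist1 x y.
Proof. by apply: sumr_ge0. Qed.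

Lemma blip_cst m c : blip (fun _ : 'rV[R]_m => c).
Proof.
exists `|c| => //; split=> // x y; rewrite subrr normr0 mulr_ge0//.
exact: dist1_ge0.
Qed.

Lemma blipD m (F G : 'rV[R]_m -> R) : blip F -> blip G -> blip (fun x => F x + G x).
Proof.
move=> [B B0 [hB lB]] [C C0 [hC lC]]; exists (B + C); first exact: addr_ge0.
split=> [x|x y]; first by rewrite (le_trans (ler_normD _ _))// lerD.
rewrite opprD addrACA mulrDl (le_trans (ler_normD _ _))//.
by rewrite lerD.
Qed.

Lemma blipM m (F G : 'rV[R]_m -> R) : blip F -> blip G -> blip (fun x => F x * G x).
Proof.
move=> [B B0 [hB lB]] [C C0 [hC lC]]; exists (B * C + B * C).
  by rewrite addr_ge0// mulr_ge0.
have BC : 0 <= B * C by rewrite mulr_ge0.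
split=> [x|x y].
  by rewrite normrM (@le_trans _ _ (B * C))// ?ler_pM// lerDl.
have -> : F x * G x - F y * G y = (F x - F y) * G x + F y * (G x - G y) by ring.
rewrite (le_trans (ler_normD _ _))// !normrM mulrDl; apply: lerD.
  by rewrite [B * C]mulrC -mulrA [C * _]mulrC ler_pM//.
by rewrite -mulrA ler_pM.
Qed.

Lemma blipN m (F : 'rV[R]_m -> R) : blip F -> blip (fun x => - F x).
Proof.
move=> /(blipM (blip_cst m (-1))); congr blip.
by apply/funext => x; rewrite mulN1r.
Qed.

Lemma blipV m (F : 'rV[R]_m -> R) (c : R) : 0 < c -> (forall x, c <= F x) ->
  blip F -> blip (fun x => (F x)^-1).
Proof.
move=> c0 hc [B B0 [hB lB]].
have F0 x : 0 < F x by exact: lt_le_trans (hc x).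
have ic x : (F x)^-1 <= c^-1 by rewrite lef_pV2// posrE.
have c20 : 0 <= c^-1 * c^-1 by rewrite mulr_ge0// invr_ge0 ltW.
exists (c^-1 + B * (c^-1 * c^-1)).
  by rewrite addr_ge0// ?invr_ge0 ?(ltW c0)// mulr_ge0.
split=> [x|x y].
  by rewrite gtr0_norm ?invr_gt0// (le_trans (ic x))// lerDl mulr_ge0.
have -> : (F x)^-1 - (F y)^-1 = - (F x - F y) * ((F x)^-1 * (F y)^-1).
  by field; rewrite !gt_eqF.
rewrite normrM normrN (@le_trans _ _ (B * dist1 x y * (c^-1 * c^-1)))//.
  rewrite ler_pM// ger0_norm ?mulr_ge0 ?invr_ge0 ?(ltW (F0 _))//.
  by rewrite ler_pM ?invr_ge0 ?(ltW (F0 _)).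
rewrite mulrDl mulrAC lerDr mulr_ge0 ?dist1_ge0// invr_ge0 ltW//.
Qed.

Lemma dist1_row m (x x' : R) (y y' : 'rV[R]_m) :
  dist1 (row_mx x%:M y : 'rV_(1 + m)) (row_mx x'%:M y') = `|x - x'| + dist1 y y'.
Proof.
rewrite /dist1 big_split_ord /= big_ord1; congr (_ + _).
  by rewrite !row_mxEl !mxE eqxx !mulr1n.
by apply: eq_bigr => i _; rewrite !row_mxEr.
Qed.

Lemma blip_row m (F : 'rV[R]_(1 + m) -> R) x : blip F ->
  blip (fun y : 'rV[R]_m => F (row_mx x%:M y)).
Proof.
move=> [B B0 [hB lB]]; exists B => //; split=> // y y'.
by rewrite (le_trans (lB _ _))// dist1_row subrr normr0 add0r.
Qed.

Lemma lip_continuous (f : R -> R) (k : R) :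
  (forall x y, `|f x - f y| <= k * `|x - y|) -> continuous f.
Proof.
move=> hf x; apply/cvgrPdist_lt => e e0.
have k0 : 0 < `|k| + 1 by rewrite ltr_wpDl.
near=> y; rewrite (le_lt_trans (hf _ _))// (@le_lt_trans _ _ ((`|k| + 1) * `|x - y|))//.
  by rewrite ler_wpM2r// (le_trans (ler_norm _))// lerDl.
rewrite -ltr_pdivlMl//; near: y; apply: cvgr_dist_lt => //.
by rewrite mulr_gt0// invr_gt0.
Unshelve. all: by end_near. Qed.

Local Notation mu := (@lebesgue_measure R).

Lemma integrable01 (f : R -> R) : continuous f ->
  mu.-integrable `[0, 1]%classic (EFin \o f).
Proof.
move=> cf; apply: continuous_compact_integrable; first exact: segment_compact.
by apply: continuous_subspaceT.
Qed.

Lemma Rint01_cst (c : R) : \int[mu]_(x in `[0, 1]%classic) c = c.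
Proof.
by rewrite Rintegral_cst//= lebesgue_measure_itv/= lte01 oppr0 adde0 mulr1.
Qed.

Lemma Rint01_bound (f : R -> R) (B : R) : continuous f -> (forall x, `|f x| <= B) ->
  `|\int[mu]_(x in `[0, 1]%classic) f x| <= B.
Proof.
move=> cf hf.
apply: le_trans (le_normr_Rintegral _ (integrable01 cf)) _ => //.
rewrite -[leRHS](Rint01_cst B); apply: le_Rintegral => //.
- have cn : continuous (fun x => `|f x|).
    by move=> x; apply: cvg_norm; exact: cf.
  exact: integrable01 cn.
- by apply: (@integrable01 (fun=> B)) => x; exact: cvg_cst.
Qed.

(** Boundedness and linearity are proved together by induction on the dimension,
    as the partial integrals have to be continuous for either to make sense. *)
Lemma cube_integral_props m :
  (forall (F : 'rV[R]_m -> R) B, blip F -> (forall x, `|F x| <= B) ->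
     `|cube_integral F| <= B) /\
  (forall (F G : 'rV[R]_m -> R) c, blip F -> blip G ->
     cube_integral (fun x => F x + c * G x) = cube_integral F + c * cube_integral G).
Proof.
elim: m => [|m [IHb IHl]]; first by split => [F B bF hF|F G c bF bG]; first exact: hF.
have cont (F : 'rV[R]_(1 + m) -> R) : blip F ->
    continuous (fun x : R => cube_integral (fun y : 'rV[R]_m => F (row_mx x%:M y))).
  move=> bF; have [B B0 [hB lB]] := bF.
  apply: (@lip_continuous _ B) => x x'.
  have -> : cube_integral (fun y => F (row_mx x%:M y)) -
            cube_integral (fun y => F (row_mx x'%:M y)) =
     cube_integral (fun y => F (row_mx x%:M y) + (-1) * F (row_mx x'%:M y)).
    by rewrite (IHl _ _ (-1) (blip_row x bF) (blip_row x' bF)) mulN1r.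
  apply: IHb.
    by apply: (blipD (blip_row x bF)); apply: (blipM (blip_cst _ _)); exact: blip_row.
  move=> y; rewrite mulN1r (le_trans (lB _ _))// dist1_row.
  rewrite [X in _ + X]/dist1 [X in _ + X]big1 ?addr0// => i _.
  by rewrite subrr normr0.
split=> [F B bF hF|F G c bF bG] /=.
  by apply: Rint01_bound; [exact: cont|move=> x; apply: IHb; [exact: blip_row|]].
under eq_Rintegral do rewrite (IHl _ _ c (blip_row _ bF) (blip_row _ bG)).
have iF := integrable01 (cont _ bF); have iG := integrable01 (cont _ bG).
rewrite RintegralD ?RintegralZl//.
have cG : continuous (fun x : R => c * cube_integral (fun y : 'rV[R]_m => G (row_mx x%:M y))).
  by move=> x; apply: cvgM; [exact: cvg_cst|exact: (cont _ bG)].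
exact: integrable01 cG.
Qed.

Lemma cube_integral_bound m (F : 'rV[R]_m -> R) B : blip F ->
  (forall x, `|F x| <= B) -> `|cube_integral F| <= B.
Proof. exact: (cube_integral_props m).1. Qed.

Lemma cube_integral_lin m (F G : 'rV[R]_m -> R) c : blip F -> blip G ->
  cube_integral (fun x => F x + c * G x) = cube_integral F + c * cube_integral G.
Proof. exact: (cube_integral_props m).2. Qed.

Lemma sin_lip (a b : R) : `|sin a - sin b| <= `|a - b|.
Proof.
wlog ab : a b / a <= b.
  move=> h; have [|/ltW ba] := leP a b; first exact: h.
  by rewrite distrC [leRHS]distrC; exact: (h _ _ ba).
rewrite distrC [leRHS]distrC.
have [|c _ ->] := @MVT_segment _ sin cos a b ab.
- by apply: continuous_subspaceT => x; exact: continuous_sin.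
by rewrite normrM ler_piMl// cos_max.
Qed.

Lemma cos_lip (a b : R) : `|cos a - cos b| <= `|a - b|.
Proof.
have cE x : cos x = sin (x + pi / 2) :> R.
  by rewrite sinD cos_pihalf sin_pihalf mulr0 add0r mulr1.
rewrite !cE (le_trans (sin_lip _ _))//.
by rewrite (_ : _ + _ - _ = a - b)//; ring.
Qed.

Definition phase m (z : 'rV[int]_m) (x : 'rV[R]_m) : R := \sum_i (z 0 i)%:~R * x 0 i.

Lemma phase_lip m (z : 'rV[int]_m) : exists2 k : R, 0 <= k &
  forall x y, `|phase z x - phase z y| <= k * dist1 x y.
Proof.
exists (\sum_i `|(z 0 i)%:~R|); first by apply: sumr_ge0.
move=> x y; rewrite /phase -sumrB (le_trans (ler_norm_sum _ _ _))//.
rewrite mulr_suml; apply: ler_sum => i _; rewrite -mulrBr normrM ler_wpM2l//.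
by rewrite /dist1 (bigD1 i)//= lerDl sumr_ge0.
Qed.

Lemma blip_cos m (z : 'rV[int]_m) (th : R) :
  blip (fun x => cos (th + 2 * pi * phase z x)).
Proof.
have [k k0 hk] := phase_lip z; have pi0 : 0 <= 2 * pi :> R by rewrite mulr_ge0// pi_ge0.
exists (1 + 2 * pi * k); first by rewrite addr_ge0// mulr_ge0.
split=> [x|x y]; first by rewrite (le_trans (cos_max _))// lerDl mulr_ge0.
rewrite (le_trans (cos_lip _ _))//.
rewrite (_ : _ - _ = 2 * pi * (phase z x - phase z y)); last by ring.
move: pi0; set p := 2 * pi => pi0; rewrite normrM (ger0_norm pi0) mulrDl mul1r.
apply: (@le_trans _ _ (p * (k * dist1 x y))); first by rewrite ler_wpM2l.
by rewrite mulrA lerDr dist1_ge0.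
Qed.

Lemma Rint01_cos (z : int) (th : R) :
  \int[mu]_(x in `[0, 1]%classic) cos (th + 2 * pi * (z%:~R * x)) =
  if z == 0 then cos th else 0.
Proof.
case: eqP => [->|/eqP z0].
  under eq_Rintegral do rewrite mul0r mulr0 addr0.
  by rewrite Rint01_cst.
set w : R := 2 * pi * z%:~R.
have w0 : w != 0 by rewrite !mulf_eq0 intr_eq0 (negPf z0) gt_eqF//= gt_eqF ?pi_gt0.
pose f x := cos (th + w * x); pose G x := w^-1 * sin (th + w * x).
have fE x : cos (th + 2 * pi * (z%:~R * x)) = f x by rewrite /f /w; congr cos; ring.
under eq_Rintegral do rewrite fE.
have dG (x : R) : is_derive x 1 G (f x).
  have dl : is_derive x 1 (fun x => th + w * x) w.
    by apply: is_derive_eq; rewrite /GRing.scale /=; ring.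
  have ds := @is_derive1_comp _ sin (fun x => th + w * x) x _ _ (is_derive_sin _) dl.
  have dc := @is_deriveZ _ _ _ (sin \o (fun x => th + w * x)) (w^-1) x 1 _ ds.
  rewrite (_ : f x = w^-1 *: (cos (th + w * x) * w)); first exact: dc.
  by rewrite /GRing.scale /= mulrCA mulVf// mulr1.
have cl : continuous (fun x : R => th + w * x).
  move=> x; apply: cvgD; first exact: cvg_cst.
  by apply: cvgM; [exact: cvg_cst|exact: cvg_id].
have cG : continuous G.
  move=> x; apply: cvgM; first exact: cvg_cst.
  exact: (continuous_comp (cl x) (@continuous_sin _ _)).
rewrite /Rintegral (@continuous_FTC2 _ f G)//=.
- rewrite /G mulr1 mulr0 addr0 sinD.
  have [] := @expi_int R z; rewrite -/w => -> ->.
  by rewrite mulr1 mulr0 addr0 subrr.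
- apply: continuous_subspaceT => x.
  exact: (continuous_comp (cl x) (@continuous_cos _ _)).
- split.
  + by move=> x _; exact: ex_derive.
  + by apply: cvg_at_right_filter; exact: cG.
  + by apply: cvg_at_left_filter; exact: cG.
- by move=> x _; rewrite derive1E; exact: derive_val.
Qed.

Lemma cube_integral_cos m (z : 'rV[int]_m) (th : R) :
  cube_integral (fun x => cos (th + 2 * pi * phase z x)) = if z == 0 then cos th else 0.
Proof.
elim: m z th => [|m IH] z th /=.
  by rewrite /phase big_ord0 mulr0 addr0 (_ : z == 0)//; apply/eqP/rowP => -[].
pose z0 := z 0 0; pose z' : 'rV[int]_m := \row_i z 0 (rshift 1 i).
have pE (x : R) (y : 'rV[R]_m) :
    phase z (row_mx x%:M y : 'rV_(1 + m)) = z0%:~R * x + phase z' y.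
  rewrite /phase [LHS](@big_split_ord _ _ _ 1 m) /= big_ord1; congr (_ + _).
    congr ((z 0 _)%:~R * _); first exact: val_inj.
    by transitivity ((x%:M : 'M[R]_1) 0 0); [exact: row_mxEl|rewrite mxE eqxx mulr1n].
  apply: eq_bigr => i _; rewrite [z' 0 i]mxE; congr (_ * _); exact: row_mxEr.
have zE : (z == 0) = (z0 == 0) && (z' == 0).
  apply/eqP/andP => [zz|[/eqP h0 /eqP h1]].
    split; apply/eqP; first by rewrite /z0 zz mxE.
    by apply/rowP => i; rewrite !mxE zz mxE.
  apply/rowP => i; rewrite mxE.
  have [j|j] := split_ordP (i : 'I_(1 + m)).
    by rewrite ord1 => ->; rewrite -[RHS]h0; congr (z 0 _); exact: val_inj.
  by move=> ->; have := congr1 (fun u : 'rV[int]_m => u 0 j) h1; rewrite !mxE.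
have -> : (fun x : R => cube_integral (fun y : 'rV[R]_m =>
      cos (th + 2 * pi * phase z (row_mx x%:M y : 'rV_(1 + m))))) =
    (fun x : R => if z' == 0 then cos (th + 2 * pi * (z0%:~R * x)) else 0).
  apply/funext => x; rewrite -IH; congr cube_integral; apply/funext => y.
  by rewrite pE mulrDr addrA.
rewrite zE andbC; case: (z' == 0) => /=; first exact: Rint01_cos.
exact: Rint01_cst.
Qed.

End CubeIntegral.

(** * The integral formula for partition functions *)

Section ComplexCubeIntegral.
Context {R : realType}.
Local Notation C := R[i].
Local Notation Re := (@complex.Re R).
Local Notation Im := (@complex.Im R).

Definition cubeC m (F : 'rV[R]_m -> C) : C :=
  Complex (cube_integral (fun x => Re (F x))) (cube_integral (fun x => Im (F x))).

Definition blipC m (F : 'rV[R]_m -> C) :=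
  blip (fun x => Re (F x)) /\ blip (fun x => Im (F x)).

Lemma ReM (x y : C) : Re (x * y) = Re x * Re y - Im x * Im y.
Proof. by case: x y => [a b] [c d]. Qed.

Lemma ImM (x y : C) : Im (x * y) = Re x * Im y + Im x * Re y.
Proof. by case: x y => [a b] [c d] /=; rewrite addrC. Qed.

Lemma ReD (x y : C) : Re (x + y) = Re x + Re y.
Proof. by case: x y => [a b] [c d]. Qed.

Lemma ImD (x y : C) : Im (x + y) = Im x + Im y.
Proof. by case: x y => [a b] [c d]. Qed.

Lemma blipCM m (F G : 'rV[R]_m -> C) : blipC F -> blipC G -> blipC (fun x => F x * G x).
Proof.
move=> [F1 F2] [G1 G2]; split.
  under eq_fun do rewrite ReM.
  by apply: blipD; [exact: blipM|apply: blipN; exact: blipM].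
under eq_fun do rewrite ImM.
by apply: blipD; exact: blipM.
Qed.

Lemma blipCD m (F G : 'rV[R]_m -> C) : blipC F -> blipC G -> blipC (fun x => F x + G x).
Proof.
move=> [F1 F2] [G1 G2]; split.
  by under eq_fun do rewrite ReD; exact: blipD.
by under eq_fun do rewrite ImD; exact: blipD.
Qed.

Lemma blipC_cst m c : blipC (fun _ : 'rV[R]_m => c).
Proof. by split; exact: blip_cst. Qed.

Lemma blipCV m (F : 'rV[R]_m -> C) (c : R) : 0 < c ->
  (forall x, c <= Re (F x) ^+ 2 + Im (F x) ^+ 2) -> blipC F -> blipC (fun x => (F x)^-1).
Proof.
move=> c0 hc [F1 F2].
have b : blip (fun x => (Re (F x) ^+ 2 + Im (F x) ^+ 2)^-1).
  by apply: blipV c0 hc _; apply: blipD; exact: blipM.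
have e x : (F x)^-1 = Complex (Re (F x) * (Re (F x) ^+ 2 + Im (F x) ^+ 2)^-1)
                              (- (Im (F x) * (Re (F x) ^+ 2 + Im (F x) ^+ 2)^-1)).
  by case: (F x).
split; under eq_fun do rewrite e /=; first exact: blipM.
by apply: blipN; exact: blipM.
Qed.

Lemma cubeC_lin m (F G : 'rV[R]_m -> C) c : blipC F -> blipC G ->
  cubeC (fun x => F x + c * G x) = cubeC F + c * cubeC G.
Proof.
move=> [F1 F2] [G1 G2]; apply/eqP; rewrite eq_complex /cubeC ReD ImD ReM ImM /=.
apply/andP; split; apply/eqP.
  under [X in cube_integral X]eq_fun do rewrite ReD ReM.
  have -> : (fun x => Re (F x) + (Re c * Re (G x) - Im c * Im (G x))) =
     (fun x => (Re (F x) + Re c * Re (G x)) + (- Im c) * Im (G x)).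
    by apply/funext => x; ring.
  rewrite cube_integral_lin// ?cube_integral_lin//; first by ring.
  by apply: blipD => //; apply: blipM => //; exact: blip_cst.
under [X in cube_integral X]eq_fun do rewrite ImD ImM.
have -> : (fun x => Im (F x) + (Re c * Im (G x) + Im c * Re (G x))) =
   (fun x => (Im (F x) + Re c * Im (G x)) + Im c * Re (G x)).
  by apply/funext => x; ring.
rewrite cube_integral_lin// ?cube_integral_lin//; first by ring.
by apply: blipD => //; apply: blipM => //; exact: blip_cst.
Qed.

Lemma blipC_expi m (z : 'rV[int]_m) : blipC (fun x => expi (phase z x)).
Proof.
split => /=.
  by have := @blip_cos R m z 0; congr blip; apply/funext => x; rewrite add0r.
have := @blip_cos R m z (- (pi / 2)); congr blip; apply/funext => x.
by rewrite addrC cosBpihalf.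
Qed.

Lemma cubeC_expi m (z : 'rV[int]_m) : cubeC (fun x => expi (phase z x)) = (z == 0)%:R.
Proof.
apply/eqP; rewrite eq_complex /cubeC /=.
have := @cube_integral_cos R m z 0.
under [X in cube_integral X = _]eq_fun do rewrite add0r; move=> ->.
have := @cube_integral_cos R m z (- (pi / 2)).
under [X in cube_integral X = _]eq_fun do rewrite addrC cosBpihalf.
by move=> ->; rewrite cos0 cosN cos_pihalf; case: (z == 0); rewrite /= ?eqxx.
Qed.

Local Notation normc := (@Normc.normc R).

Lemma normc_expi (t : R) : normc (expi t) = 1.
Proof. by rewrite /Normc.normc /expi cos2Dsin2 sqrtr1. Qed.

Lemma abs_Re_le (x : C) : `|Re x| <= normc x.
Proof.
case: x => a b; rewrite /Normc.normc /= -sqrtr_sqr ler_sqrt ?addr_ge0 ?sqr_ge0//.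
by rewrite lerDl sqr_ge0.
Qed.

Lemma normc_ge0 (x : C) : 0 <= normc x.
Proof. by case: x => a b; exact: sqrtr_ge0. Qed.

Lemma normc_leD (x : C) : normc x <= `|Re x| + `|Im x|.
Proof.
case: x => a b; rewrite /Normc.normc /=.
rewrite -[leRHS]ger0_norm ?addr_ge0// -sqrtr_sqr ler_sqrt ?sqr_ge0//.
by rewrite sqrrD !real_normK ?num_real// lerD2r lerDl mulrn_wge0// mulr_ge0.
Qed.

Lemma normcX (x : C) k : normc (x ^+ k) = normc x ^+ k.
Proof. by elim: k => [|k IH]; rewrite ?expr0 ?Normc.normc1// !exprS Normc.normcM IH. Qed.

Variable m : nat.
Notation M := 'rV[int]_m.
Implicit Types (B : seq (M * C)) (q : M -> R) (z : M).

Definition pden q (b : M * C) (x : 'rV[R]_m) : C :=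
  1 - b.2 * expi (phase (- b.1) x) * (q b.1)%:C%C.

Definition pintegrand q B z x : C := expi (phase z x) / \prod_(b <- B) pden q b x.

Lemma phaseD (z w : M) (x : 'rV[R]_m) : phase (z + w) x = phase z x + phase w x.
Proof.
by rewrite /phase -big_split; apply: eq_bigr => i _; rewrite mxE intrD mulrDl.
Qed.

Lemma pden_lower q b x : normc b.2 = 1 ->
  (1 - q b.1) ^+ 2 <= Re (pden q b x) ^+ 2 + Im (pden q b x) ^+ 2 \/ q b.1 < 0.
Proof.
move=> b1; have [q0|] := leP 0 (q b.1); last by right.
left; set w := b.2 * expi (phase (- b.1) x).
have w1 : normc w = 1 by rewrite Normc.normcM b1 normc_expi mulr1.
have wR : Re w <= 1 by rewrite -w1 (le_trans (ler_norm _))// abs_Re_le.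
have wS : Re w ^+ 2 + Im w ^+ 2 = 1.
  move: w1; rewrite /Normc.normc; case: (w) => a b' /= h.
  by rewrite -[LHS]sqr_sqrtr ?h ?expr1n// addr_ge0 ?sqr_ge0.
have -> : Re (pden q b x) ^+ 2 + Im (pden q b x) ^+ 2 =
    (1 - q b.1) ^+ 2 + 2 * q b.1 * (1 - Re w) + q b.1 ^+ 2 * (Re w ^+ 2 + Im w ^+ 2 - 1).
  rewrite /pden -/w; case: (w) => a b' /=.
  by ring.
by rewrite wS subrr mulr0 addr0 lerDl !mulr_ge0// subr_ge0.
Qed.

Lemma pden_blip q b : normc b.2 = 1 -> 0 <= q b.1 -> q b.1 != 1 ->
  (forall x, pden q b x != 0) /\ blipC (fun x => (pden q b x)^-1).
Proof.
move=> b1 q0 q1; have c0 : 0 < (1 - q b.1) ^+ 2.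
  by rewrite exprn_even_gt0//= subr_eq0 eq_sym.
have hc x : (1 - q b.1) ^+ 2 <= Re (pden q b x) ^+ 2 + Im (pden q b x) ^+ 2.
  by have [//|] := pden_lower q x b1; rewrite ltNge q0.
split=> [x|].
  apply/eqP => h; have := hc x; rewrite h /= expr0n addr0 leNgt.
  by rewrite c0.
apply: blipCV c0 hc _; rewrite /pden.
have -> : (fun x => 1 - b.2 * expi (phase (- b.1) x) * ((q b.1)%:C)%C) =
  (fun x => 1 + (- b.2 * (q b.1)%:C%C) * expi (phase (- b.1) x)).
  by apply/funext => x; ring.
apply: blipCD; first exact: blipC_cst.
by apply: blipCM; [exact: blipC_cst|exact: blipC_expi].
Qed.

Lemma pprod_blip q B : (forall b, b \in B -> [/\ normc b.2 = 1, 0 <= q b.1 & q b.1 != 1]) ->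
  blipC (fun x => (\prod_(b <- B) pden q b x)^-1).
Proof.
elim: B => [|b B IH] hB.
  by under eq_fun do rewrite big_nil; exact: blipC_cst.
under eq_fun do rewrite big_cons invfM.
apply: blipCM; first by have [b1 q0 q1] := hB b (mem_head _ _); have [] := pden_blip b1 q0 q1.
by apply: IH => b' b'B; apply: hB; rewrite in_cons b'B orbT.
Qed.

(** Multiplying the integrand by the denominator of b gives the integrand for
    the remaining weights. *)
Lemma pintegral_rec q b B z :
  (forall b', b' \in b :: B -> [/\ normc b'.2 = 1, 0 <= q b'.1 & q b'.1 != 1]) ->
  cubeC (pintegrand q (b :: B) z) =
  cubeC (pintegrand q B z) + b.2 * (q b.1)%:C%C * cubeC (pintegrand q (b :: B) (z - b.1)).
Proof.
move=> hB; have [b1 q0 q1] := hB b (mem_head _ _).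
have [nz _] := pden_blip b1 q0 q1.
rewrite -cubeC_lin; first last.
- by apply: blipCM; [exact: blipC_expi|exact: pprod_blip].
- apply: blipCM; [exact: blipC_expi|apply: pprod_blip => b' b'B; apply: hB].
  by rewrite in_cons b'B orbT.
congr cubeC; apply/funext => x; rewrite /pintegrand !big_cons phaseD expiD.
set P := \prod_(_ <- _) _; have [->|P0] := eqVneq P 0.
  by rewrite !mulr0 invr0 !mulr0 addr0.
have -> : expi (phase z x) / (pden q b x * P) =
  expi (phase z x) / P * (pden q b x)^-1 by rewrite invfM; ring.
rewrite invfM.
have : pden q b x * (pden q b x)^-1 = 1 by rewrite mulfV.
rewrite {1}/pden mulrBl mul1r => /eqP; rewrite subr_eq => /eqP {1}->.
ring.
Qed.

(** A bounded sequence times w^j tends to zero if |w| < 1. *)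
Lemma geometric_zero (f0 w : C) (g : nat -> C) (c : R) (J : nat) : normc w < 1 ->
  (forall j, (J <= j)%N -> f0 = w ^+ j * g j) -> (forall j, (J <= j)%N -> normc (g j) <= c) ->
  f0 = 0.
Proof.
move=> w1 hf hg; apply: Normc.eq0_normc; apply/eqP; rewrite eq_le normc_ge0 andbT.
have c0 : 0 <= c by exact: le_trans (normc_ge0 _) (hg J (leqnn _)).
have h j : (J <= j)%N -> normc f0 <= normc w ^+ j * c.
  by move=> Jj; rewrite (hf j Jj) Normc.normcM normcX ler_wpM2l ?exprn_ge0 ?normc_ge0 ?hg.
have cv : (fun j => normc w ^+ j * c) @ \oo --> (0 : R).
  rewrite -[X in _ --> X](mul0r c); apply: cvgM; last exact: cvg_cst.
  by apply: cvg_expr; rewrite ger0_norm ?normc_ge0.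
rewrite -(cvg_lim (@Rhausdorff R) cv); apply: limr_ge; first by apply/cvg_ex; exists 0.
by exists J => // j /= Jj; exact: h.
Qed.

(** After multiplication by exp(eps tau), the integral satisfies the recursion
    which characterizes pf. The difference of two solutions is multiplied by a
    root of unity under translation by b; the damping factor makes it vanish,
    because the integrals are bounded and pf is zero far away in one direction. *)
Lemma pintegral_pf (tau : M -> R) (eps : R) B z : additive_map tau -> 0 < eps ->
  (forall b, b \in B -> normc b.2 = 1 /\ tau b.1 != 0) ->
  cubeC (pintegrand (fun z => expR (- (eps * tau z))) B z) =
  (expR (- (eps * tau z)))%:C%C * pf tau B z.
Proof.
move=> h e0; set q := fun z => _; elim: B z => [|b B IH] z hB.
  rewrite /= (_ : pintegrand q [::] z = fun x => expi (phase z x)) ?cubeC_expi.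
    case: eqP => [->|_]; last by rewrite mulr0.
    have -> : tau 0 = 0 by have := additive_mapMn 0 0 h; rewrite !mulr0n.
    by rewrite mulr0 oppr0 expR0 mulr1.
  by apply/funext => x; rewrite /pintegrand big_nil divr1.
have hB' b' : b' \in b :: B -> [/\ normc b'.2 = 1, 0 <= q b'.1 & q b'.1 != 1].
  move=> /hB[b1 tb]; split=> //; first exact: expR_ge0.
  by rewrite /q -expR0 (inj_eq (@expR_inj R)) oppr_eq0 mulf_eq0 gt_eqF.
have [b1 tb0] := hB b (mem_head _ _).
have b0 : b.2 != 0 by apply/eqP => bz; move: b1; rewrite bz Normc.normc0 => /eqP; rewrite eq_sym oner_eq0.
have {}IH y : cubeC (pintegrand q B y) = (q y)%:C%C * pf tau B y.
  by apply: IH => b' b'B; apply: hB; rewrite in_cons b'B orbT.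
pose f y := cubeC (pintegrand q (b :: B) y) - (q y)%:C%C * pf tau (b :: B) y.
suff : f z = 0 by move=> /eqP; rewrite subr_eq0 => /eqP.
pose c := b.2 * (q b.1)%:C%C.
have frec y : f y = c * f (y - b.1).
  rewrite /f pintegral_rec// IH -(nab_pf B h tb0 b0) /nab -/c.
  have -> : (q y)%:C%C = (q b.1)%:C%C * (q (y - b.1))%:C%C :> C.
    rewrite -rmorphM /q -expRD; congr ((expR _)%:C%C).
    by rewrite additive_mapB//; ring.
  by rewrite /c; ring.
have [K hK] : exists K : R, forall y, normc (cubeC (pintegrand q (b :: B) y)) <= K.
  have [[B1 B10 [h1 _]] [B2 B20 [h2 _]]] := pprod_blip hB'.
  exists ((B1 + B2) + (B1 + B2)) => y.
  have bl : blipC (pintegrand q (b :: B) y).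
    by apply: blipCM; [exact: blipC_expi|exact: pprod_blip].
  rewrite (le_trans (normc_leD _))//; apply: lerD.
    apply: cube_integral_bound; first exact: bl.1.
    move=> x; rewrite /pintegrand ReM (le_trans (ler_normB _ _))// !normrM.
    apply: lerD; first by rewrite (le_trans _ (h1 x))// ler_piMl// cos_max.
    by rewrite (le_trans _ (h2 x))// ler_piMl// sin_max.
  apply: cube_integral_bound; first exact: bl.2.
  move=> x; rewrite /pintegrand ImM (le_trans (ler_normD _ _))// !normrM addrC.
  apply: lerD; first by rewrite (le_trans _ (h1 x))// ler_piMl// sin_max.
  by rewrite (le_trans _ (h2 x))// ler_piMl// cos_max.
have fK y : tau y < 0 -> normc (f y) <= K.
  move=> ty; rewrite /f (_ : pf tau (b :: B) y = 0) ?mulr0 ?subr0//.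
  by apply/eqP; rewrite -[_ == _]negbK; apply/negP => /(pf_ge0 h); rewrite leNgt ty.
have nc : normc c = q b.1.
  by rewrite /c Normc.normcM b1 mul1r /Normc.normc /= expr0n addr0 sqrtr_sqr ger0_norm ?expR_ge0.
have c0 : c != 0.
  apply/eqP => cz; move: nc; rewrite cz Normc.normc0 => /esym/eqP.
  by rewrite gt_eqF// expR_gt0.
have [J hJ] : exists J, forall j, (J <= j)%N -> tau z < `|tau b.1| *+ j.
  by exists (pf_range tau b z) => j; exact: pf_rangeP.
have [tb|tb|tb] := ltgtP 0 (tau b.1); last by rewrite -tb eqxx in tb0.
  apply: (@geometric_zero _ c (fun j => f (z - b.1 *+ j)) K J).
  - by rewrite nc /q -expR0 ltr_expR oppr_lt0 mulr_gt0.
  - move=> j _; elim: j => [|j IHj]; first by rewrite expr0 mul1r mulr0n subr0.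
    by rewrite IHj exprSr -mulrA; congr (_ * _); rewrite frec mulrSr opprD addrA.
  - move=> j Jj; apply: fK; rewrite additive_mapB// additive_mapMn// subr_lt0.
    by rewrite (lt_le_trans (hJ j Jj))// gtr0_norm.
apply: (@geometric_zero _ c^-1 (fun j => f (z + b.1 *+ j)) K J).
- by rewrite Normc.normcV nc /q -expRN opprK -expR0 ltr_expR nmulr_llt0.
- move=> j _; elim: j => [|j IHj]; first by rewrite expr0 mul1r mulr0n addr0.
  rewrite IHj exprSr -mulrA; congr (_ * _); rewrite (frec (z + b.1 *+ j.+1)).
  by rewrite mulKf// mulrSr addrA addrK.
- move=> j Jj; apply: fK; rewrite h additive_mapMn// -ltrBrDr sub0r.
  by rewrite (lt_le_trans (hJ j Jj))// ltr0_norm// mulNrn.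
Qed.


(** For each eps the integral is pf times a factor tending to 1. *)
Lemma partition_integral_limit (tau : M -> R) (I : R -> C) B z : additive_map tau ->
  (forall b, b \in B -> normc b.2 = 1 /\ tau b.1 != 0) ->
  (forall eps, 0 < eps ->
     I eps = cubeC (pintegrand (fun z => expR (- (eps * tau z))) B z)) ->
  Complex (lim (Re (I eps) @[eps --> (0 : R)^'+])) (lim (Im (I eps) @[eps --> (0 : R)^'+]))
  = pf tau B z.
Proof.
move=> h hB hI.
have key (f : R -> R) (c : R) : (forall eps, 0 < eps -> f eps = expR (- (eps * tau z)) * c) ->
    lim (f eps @[eps --> (0 : R)^'+]) = c.
  move=> hf; apply: cvg_lim => //.
  have : (fun eps : R => expR (- (eps * tau z)) * c) @ (0 : R)^'+ --> c.
    have ce : continuous (fun eps : R => expR (- (eps * tau z)) * c).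
      move=> x; apply: cvgM; last exact: cvg_cst.
      apply: continuous_comp; last exact: continuous_expR.
      by apply: cvgN; apply: cvgM; [exact: cvg_id|exact: cvg_cst].
    have := @ce 0; rewrite /continuous_at mul0r oppr0 expR0 mul1r.
    exact: cvg_at_right_filter.
  apply: cvg_trans; apply: near_eq_cvg; near=> eps.
  by rewrite hf.
have e eps : 0 < eps -> I eps = (expR (- (eps * tau z)))%:C%C * pf tau B z.
  by move=> e0; rewrite hI// pintegral_pf.
rewrite (key _ (Re (pf tau B z))); last by move=> eps e0; rewrite e// ReM /= mul0r subr0.
rewrite (key _ (Im (pf tau B z))); last by move=> eps e0; rewrite e// ImM /= mul0r addr0.
by case: (pf tau B z).
Unshelve. all: by end_near. Qed.

End ComplexCubeIntegral.

Section LatticeCoordinates.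
Context {R : realType} {n : nat} (L : 'M[R]_n).
Hypothesis L_unit : L \in unitmx.
Notation M := 'rV[int]_n.

(** The basis of Lambda^* dual to the rows of L, in terms of which Lambda^* is
    identified with the integral row vectors by emb. *)
Definition dual_basis : 'M[R]_n := (invmx L)^T.

Lemma dual_basis_unit : dual_basis \in unitmx.
Proof. by rewrite unitmx_tr unitmx_inv. Qed.

Lemma pairing_emb (z : M) (x : 'rV[R]_n) :
  pairing (emb dual_basis z) (x *m L) = phase z x.
Proof.
rewrite /pairing /emb /dual_basis trmx_mul trmx_inv mulmxA mulmxKV ?unitmx_tr//.
by rewrite mxE; apply: eq_bigr => i _; rewrite !mxE.
Qed.

Lemma dual_latticeP (mu : 'rV[R]_n) :
  dual_lattice L mu <-> exists z : M, mu = emb dual_basis z.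
Proof.
split=> [h|[z ->] _ [w _ <-]]; last first.
  rewrite pairing_emb /phase; apply: rpred_sum => i _.
  by rewrite mxE; apply: rpredM; exact: intr_int.
have hi i : (mu *m L^T) 0 i \is a Num.int.
  have := h ((delta_mx 0 i : 'rV[R]_n) *m L); rewrite /pairing.
  have -> : (mu *m ((delta_mx 0 i : 'rV[R]_n) *m L)^T) 0 0 = (mu *m L^T) 0 i.
    by rewrite trmx_mul mulmxA trmx_delta -colE !mxE.
  apply; exists (delta_mx 0 i) => //; congr (_ *m _).
  by apply/matrixP => a b; rewrite !mxE; case: (_ && _).
exists (\row_i Num.floor ((mu *m L^T) 0 i)).
rewrite /emb /dual_basis trmx_inv; apply: (can_inj (mulmxK (_ : L^T \in unitmx))).
  by rewrite unitmx_tr.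
rewrite mulmxKV ?unitmx_tr//; apply/rowP => i; rewrite !mxE.
by have /floorK := hi i; rewrite mxE => ->.
Qed.

Lemma dual_lattice_emb (z : M) : dual_lattice L (emb dual_basis z).
Proof. by apply/dual_latticeP; exists z. Qed.

Lemma tpow_emb (z : M) (x : 'rV[R]_n) :
  tpow (torus_exp L (x *m L)) (emb dual_basis z) = expi (phase z x).
Proof. by rewrite tpow_exp ?pairing_emb//; exact: dual_lattice_emb. Qed.

Definition lift_weights (B : seq (M * R[i])) : seq ('rV[R]_n * R[i]) :=
  [seq (emb dual_basis b.1, b.2) | b <- B].

(** In the coordinates of the dual basis, the integral over the torus is the
    integral over the cube computed above. *)
Lemma partition_function_pf (B : seq (M * R[i])) (t : 'rV[R]_n) (z : M) :
  (forall b, b \in B -> Normc.normc b.2 = 1 /\ pairing (emb dual_basis b.1) t != 0) ->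
  partition_function L (lift_weights B) t (emb dual_basis z) =
  pf (fun x => pairing (emb dual_basis x) t) B z.
Proof.
move=> hB; apply: partition_integral_limit => // [x y|eps e0].
  by rewrite embD /pairing mulmxDl mxE.
rewrite /partition_integral /haar_integralC /haar_integral /cubeC.
have e x : tpow (torus_exp L (x *m L)) (emb dual_basis z) /
   \prod_(b <- lift_weights B) (1 - b.2 * tpow (torus_exp L (x *m L)) (- b.1) *
      ((expR (- (eps * pairing b.1 t)))%:C)%C) =
   pintegrand (fun y => expR (- (eps * pairing (emb dual_basis y) t))) B z x.
  rewrite /pintegrand tpow_emb; congr (_ / _); rewrite big_map.
  by apply: eq_bigr => b _; rewrite /pden /= -embN tpow_emb.
by congr Complex; congr cube_integral; apply/funext => x; rewrite e.
Qed.

End LatticeCoordinates.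

(** * Character sums on the finite subgroups of the torus *)

Lemma expi0 (R : realType) : expi (0 : R) = 1.
Proof. exact: (@expi_int R 0). Qed.

Lemma expi_eq1 (R : realType) (x : R) : expi x = 1 -> x \is a Num.int.
Proof.
move=> h; pose y := x - (Num.floor x)%:~R.
have hy : expi y = 1.
  have := expiD y (Num.floor x)%:~R; rewrite subrK h expi_int mulr1.
  by move=> <-.
have y0 : 0 <= y by rewrite subr_ge0 floor_le_tmp.
have y1 : y < 1 by rewrite ltrBlDl -[1 in X in _ < X]/(1%:~R) -intrD floorD1_gt.
suff : y = 0 by move=> /eqP; rewrite subr_eq0 => /eqP ->; exact: intr_int.
apply/eqP; rewrite -[_ == _]negbK; apply/negP => yn0.
have {}y0 : 0 < y by rewrite lt_neqAle eq_sym yn0.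
have sy : 0 < sin (pi * y).
  apply: sin_gt0_pi; rewrite mulr_gt0 ?pi_gt0//=.
  by rewrite -[ltRHS]mulr1 ltr_pM2l ?pi_gt0.
have [cy _] : cos (2 * pi * y) = 1 /\ sin (2 * pi * y) = 0 by case: hy.
have : cos (pi * y + pi * y) = 1 - 2 * sin (pi * y) ^+ 2.
  by rewrite cosD -!expr2 cos2sin2; ring.
rewrite -mulrDl -mulr2n -[pi *+ 2]mulr_natl cy => h1.
have : 0 < 2 * sin (pi * y) ^+ 2 by rewrite mulr_gt0// exprn_gt0.
by lra.
Qed.

Lemma sub_add_cancel (V : zmodType) (a b c d : V) : a - b = a + c - (b + d) - c + d.
Proof. by rewrite opprD addrACA -!addrA [- d + _]addrCA addNr addr0 subrr addr0. Qed.

Lemma nat_residue_eq (l a b : nat) (v : int) :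
  (a < l)%N -> (b < l)%N -> l%:Z * v - a%:Z + b%:Z = 0 -> a = b.
Proof.
move=> al bl h; case: (ltrgtP v 0) => [v0|v0|v0]; last by rewrite v0 in h; lia.
  have : l%:Z * v <= - l%:Z by nia.
  lia.
have : l%:Z <= l%:Z * v by nia.
lia.
Qed.

Section TorusSums.
Context {R : realType} {n : nat} (L X : 'M[R]_n).
Hypotheses (L_unit : L \in unitmx) (LX : lattice L `<=` lattice X).
Notation M := 'rV[int]_n.
Notation C := R[i].
Local Notation D := (dual_basis L).
Local Notation emb := (emb (dual_basis L)).

Definition chi (t : torus L) (z : M) : C := tpow t (emb z).

Lemma chiD t x y : chi t (x + y) = chi t x * chi t y.
Proof. by rewrite /chi /tpow embD -expiD /pairing mulmxDl mxE. Qed.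

Lemma chi0 t : chi t 0 = 1.
Proof. by rewrite /chi /tpow emb0 /pairing mul0mx mxE expi0. Qed.

Lemma chi_neq0 t x : chi t x != 0.
Proof.
apply/eqP => h; have := chiD t x (- x); rewrite subrr chi0 h mul0r.
by move=> /eqP; rewrite oner_eq0.
Qed.

Lemma chiN t x : chi t (- x) = (chi t x)^-1.
Proof.
by apply: (mulfI (chi_neq0 t x)); rewrite -chiD subrr chi0 mulfV// chi_neq0.
Qed.

Lemma chiMn t x k : chi t (x *+ k) = chi t x ^+ k.
Proof. by elim: k => [|k IH]; rewrite ?mulr0n ?chi0 ?expr0// mulrSr chiD IH exprSr. Qed.

Lemma chiMz t x (k : int) : chi t (x *~ k) = chi t x ^ k.
Proof.
case: k => k; first by rewrite -pmulrn chiMn.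
by rewrite NegzE mulrNz -pmulrn chiN chiMn exprnN.
Qed.

Lemma chi_exp (y : 'rV[R]_n) z : chi (torus_exp L y) z = expi (pairing (emb z) y).
Proof. by rewrite /chi tpow_exp//; exact: dual_lattice_emb. Qed.

Lemma chi_repr t z : chi t z = expi (pairing (emb z) (repr t)).
Proof. by []. Qed.

Lemma pairingDr (mu x y : 'rV[R]_n) : pairing mu (x + y) = pairing mu x + pairing mu y.
Proof. by rewrite /pairing linearD mulmxDr mxE. Qed.

Lemma pairingZr (mu x : 'rV[R]_n) c : pairing mu (c *: x) = c * pairing mu x.
Proof. by rewrite /pairing linearZ -scalemxAr mxE. Qed.

Lemma pairingZl (mu x : 'rV[R]_n) c : pairing (c *: mu) x = c * pairing mu x.
Proof. by rewrite /pairing -scalemxAl mxE. Qed.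

(** The integral matrix expressing the basis of Lambda in that of Xi has an
    integral inverse up to its determinant. *)
Lemma lattice_index : exists2 N : nat, (0 < N)%N &
  forall x, lattice X x -> lattice L (N%:R *: x).
Proof.
have hrow i : exists w : M, row i L = map_mx intr w *m X.
  have /LX[w _ <-] : lattice L (row i L); last by exists w.
  exists (delta_mx 0 i) => //; rewrite rowE; congr (_ *m _).
  by apply/matrixP => a b; rewrite !mxE; case: (_ && _).
have [w hw] := choice hrow; pose A : 'M[int]_n := \matrix_i w i.
have LA : L = map_mx intr A *m X.
  apply/row_matrixP => i; rewrite hw row_mul; congr (_ *m _).
  by rewrite -map_row rowK.
have dA : \det A != 0.
  have : \det L != 0 by rewrite -unitfE -unitmxE.
  rewrite LA det_mulmx mulf_eq0 negb_or => /andP[+ _].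
  by rewrite det_map_mx intr_eq0.
exists `|\det A|%N; first by rewrite absz_gt0.
move=> _ [v _ <-].
exists ((v *m \adj A) *~ sgz (\det A)) => //.
have -> : X = invmx (map_mx intr A) *m L.
  rewrite LA mulKmx// unitmxE unitfE det_map_mx intr_eq0//.
pose IA : 'M[R]_n := map_mx intr A.
have dR : (\det A)%:~R != 0 :> R by rewrite intr_eq0.
have UA : IA \in unitmx by rewrite unitmxE unitfE det_map_mx.
have -> : map_mx intr ((v *m \adj A) *~ sgz (\det A)) =
    (`|\det A|%N%:R : R) *: (map_mx intr v *m invmx IA).
  rewrite /invmx UA det_map_mx -scalemxAr scalerA -map_mx_adj -map_mxM.
  have -> : (`|\det A|%N%:R : R) = (sgz (\det A))%:~R * (\det A)%:~R.
    by rewrite -intrM -abszEsg.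
  rewrite mulfK//; apply/matrixP => i j.
  by rewrite -scaler_int intz !mxE rmorphM.
by rewrite -scalemxAl mulmxA scalemxAl.
Qed.

Lemma torus_exp_eq (x y : 'rV[R]_n) :
  (torus_exp L x == torus_exp L y) = `[< lattice L (x - y) >].
Proof. by rewrite /torus_exp eqmodE. Qed.

Lemma torus_exp_repr t : torus_exp L (repr t) = t.
Proof. exact: reprK. Qed.

Lemma torus_points_finite l : (0 < l)%N -> finite_set (torus_points (L := L) X l).
Proof.
move=> l0; have [N N0 hN] := lattice_index.
pose F (f : {ffun 'I_n -> 'I_(l * N).+1}) :=
  torus_exp L (l%:R^-1 *: (map_mx intr (\row_i (f i : nat)%:Z) *m X)).
apply: (@sub_finite_set _ _ (F @` [set: {ffun 'I_n -> 'I_(l * N).+1}])); last first.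
  by apply: finite_image; exact: finite_finset.
move=> _ [_ [w _ <-] <-].
have lN : (l * N)%:Z != 0 by rewrite -lt0n muln_gt0 l0.
have bnd i : (absz (modz (w ord0 i) (l * N)%N) < (l * N).+1)%N.
  rewrite ltnS; apply: ltnW; rewrite -ltz_nat gez0_abs ?modz_ge0//.
  by rewrite ltz_mod.
exists [ffun i => Ordinal (bnd i)] => //; apply/eqP; rewrite /F torus_exp_eq.
apply/asboolP; rewrite -scalerBr -mulmxBl -map_mxB.
set d := _ - w.
pose e : M := - \row_i divz (w 0 i) (l * N)%N.
have -> : map_mx (intr : int -> R) d = (l%:R * N%:R) *: map_mx intr e.
  apply/rowP => i; rewrite !mxE ffunE /= gez0_abs ?modz_ge0// /modz.
  rewrite addrC addrA addNr add0r !rmorphN rmorphM /= mulrN mulrC.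
  by rewrite -natrM.
rewrite -scalemxAl scalerA mulKf ?pnatr_eq0 -?lt0n//.
by apply: hN; exists e.
Qed.

Definition tpts l : seq (torus L) :=
  undup (xget [::] [set s : seq (torus L) | torus_points X l = [set` s]]).

Lemma tpts_uniq l : uniq (tpts l).
Proof. exact: undup_uniq. Qed.

Lemma mem_tpts l t : (0 < l)%N -> (t \in tpts l) <-> torus_points X l t.
Proof.
move=> l0; rewrite /tpts mem_undup; case: xgetP => [s _ /= ->//|h].
by have /finite_seqP[s hs] := torus_points_finite l0; case: (h s).
Qed.

Definition tsum l (F : torus L -> C) (z : M) : C := \sum_(t <- tpts l) chi t z * F t.

Definition xw (b : M * C) t := b.2 * chi t (- b.1).

Lemma nab_tsum l F b z : nab b (tsum l F) z = tsum l (fun t => (1 - xw b t) * F t) z.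
Proof.
rewrite /nab /tsum mulr_sumr -sumrB; apply: eq_bigr => t _.
by rewrite chiD /xw; ring.
Qed.

Lemma nabs_tsum l F s z :
  nabs s (tsum l F) z = tsum l (fun t => \prod_(b <- s) (1 - xw b t) * F t) z.
Proof.
elim: s z => [|b s IH] z /=.
  by apply: eq_bigr => t _; rewrite big_nil mul1r.
have /funext -> := IH; rewrite nab_tsum; apply: eq_bigr => t _.
by rewrite big_cons mulrA.
Qed.

Definition vden (B : seq (M * C)) t := \prod_(b <- B) (1 - xw b t).

Definition vsum (B : seq (M * C)) l : M -> C := tsum l (fun t => (vden B t)^-1).

Lemma verlinde_sumE B z l : (0 < l)%N ->
  verlinde_sum L X (lift_weights L B) (emb z) l = vsum B l z.
Proof.
move=> l0; have denE t : verlinde_denominator (lift_weights L B) t = vden B t.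
  rewrite /verlinde_denominator big_map; apply: eq_bigr => b _.
  by rewrite /xw /chi embN.
rewrite /verlinde_sum /vsum /tsum.
rewrite (fsbigE [seq t <- tpts l | vden B t != 0]) ?filter_uniq ?tpts_uniq//.
- rewrite [LHS]big_mkcond [RHS](bigID (fun t => vden B t != 0))/= [X in _ = _ + X]big1.
    rewrite addr0 -[RHS]big_filter [LHS]big_seq [RHS]big_seq; apply: eq_bigr => t.
    rewrite mem_filter => /andP[h /(mem_tpts _ l0) tl].
    by rewrite mem_set ?denE//=; rewrite denE.
  by move=> t; rewrite negbK => /eqP ->; rewrite invr0 mulr0.
- by move=> t /=; rewrite mem_filter => /andP[h /(mem_tpts _ l0)]; rewrite denE.
- move=> t [/(mem_tpts _ l0) tl h] /negP[].
  by rewrite mem_filter -denE h tl.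
Qed.

(** If every factor is inverted, with 0^-1 = 0, then d^2 d^-1 = d. *)
Lemma vsum_rel B P l z :
  nabs [seq b <- B | P b] (nabs [seq b <- B | P b] (vsum B l)) z =
  nabs [seq b <- B | P b] (vsum [seq b <- B | ~~ P b] l) z.
Proof.
rewrite -nabs_cat !nabs_tsum; apply: eq_bigr => t _; congr (_ * _).
have -> : vden B t = vden [seq b <- B | P b] t * vden [seq b <- B | ~~ P b] t.
  by rewrite /vden (bigID P)/= !big_filter.
rewrite big_cat /= -/(vden _ t) invfM [LHS]mulrA; congr (_ * _).
set d := vden _ t; have [->|d0] := eqVneq d 0; first by rewrite !mul0r.
by rewrite mulfK.
Qed.

(** Xi^* in the coordinates of Lambda^*. *)
Definition xilat (z : M) := dual_lattice X (emb z).

Lemma tsum_translate l (x : 'rV[R]_n) z F : (0 < l)%N -> lattice X x ->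
  (forall t, F (torus_exp L (repr t + l%:R^-1 *: x)) = F t) ->
  tsum l F z = expi (pairing (emb z) (l%:R^-1 *: x)) * tsum l F z.
Proof.
move=> l0 hx hF; pose g (t : torus L) := torus_exp L (repr t + l%:R^-1 *: x).
have gi : injective g.
  move=> t1 t2 /eqP; rewrite torus_exp_eq => /asboolP.
  rewrite opprD addrACA subrr addr0 => h.
  by apply/eqP; rewrite -(torus_exp_repr t1) -(torus_exp_repr t2) torus_exp_eq; apply/asboolP.
have gt t : t \in tpts l -> g t \in tpts l.
  move=> /(mem_tpts _ l0)[_ [w _ <-] <-]; apply/(mem_tpts _ l0).
  case: (hx) => v _ vx; rewrite /g -vx; exists (map_mx intr (w + v) *m X); first by exists (w + v).
  apply/eqP; rewrite torus_exp_eq; apply/asboolP.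
  rewrite map_mxD mulmxDl scalerDr addrAC opprD addrA addrC addrA.
  set y := l%:R^-1 *: (map_mx intr w *m X).
  rewrite [X in lattice L X](_ : _ = y - repr (torus_exp L y)); last by rewrite addrC addKr.
  by apply/asboolP; rewrite -torus_exp_eq torus_exp_repr.
have pg : perm_eq (map g (tpts l)) (tpts l).
  have us : uniq (map g (tpts l)) by rewrite map_inj_uniq ?tpts_uniq.
  have sub : {subset map g (tpts l) <= tpts l} by move=> _ /mapP[t tl ->]; exact: gt.
  apply: uniq_perm => //; first exact: tpts_uniq.
  by have [] := uniq_min_size us sub; rewrite ?size_map.
rewrite {1}/tsum -(perm_big _ pg) big_map /tsum mulr_sumr; apply: eq_bigr => t _.
by rewrite hF chi_exp pairingDr expiD -chi_repr; ring.
Qed.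

(** A weight trivial on T_l is l times an element of Xi^*. *)
Lemma xilat_div l z : (0 < l)%N ->
  (forall x, lattice X x -> expi (pairing (emb z) (l%:R^-1 *: x)) = 1) ->
  exists2 y, xilat y & z = y *+ l.
Proof.
move=> l0 h; have lR : l%:R != 0 :> R by rewrite pnatr_eq0 -lt0n.
have hX : dual_lattice X (l%:R^-1 *: emb z).
  by move=> x /h /expi_eq1; rewrite pairingZr pairingZl.
have /(dual_latticeP L_unit)[y hy] : dual_lattice L (l%:R^-1 *: emb z).
  by move=> x /LX; exact: hX.
exists y; first by rewrite /xilat -hy.
apply: (emb_inj (dual_basis_unit L_unit)); rewrite embMn -hy.
by rewrite -scaler_nat scalerA mulfV// scale1r.
Qed.

Lemma xilat_chi l y t : (0 < l)%N -> xilat y -> t \in tpts l -> chi t (y *+ l) = 1.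
Proof.
move=> l0 hy /(mem_tpts _ l0)[x Xx <-]; rewrite chi_exp embMn -scaler_nat.
rewrite pairingZl pairingZr mulrA mulfV ?pnatr_eq0 -?lt0n// mul1r.
by have /intrP[k ->] := hy _ Xx; exact: expi_int.
Qed.

(** Orthogonality of characters on the finite group T_l. *)
Lemma tsum1 l z : (0 < l)%N -> tsum l (fun=> 1) z =
  if `[< exists2 y, xilat y & z = y *+ l >] then (size (tpts l))%:R else 0.
Proof.
move=> l0; case: asboolP => [[y hy ->]|nz].
  rewrite /tsum big_seq (eq_bigr (fun=> 1)); first by rewrite -big_seq big_const_seq count_predT iter_addr_0.
  by move=> t tl; rewrite mulr1; exact: xilat_chi.
apply/eqP; rewrite -[_ == _]negbK; apply/negP => t0; apply: nz.
apply: xilat_div => // x Xx.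
have := @tsum_translate l x z (fun=> 1) l0 Xx (fun _ => erefl).
by move=> /esym/eqP; rewrite -[X in _ == X]mul1r => /eqP/(mulIf t0).
Qed.

(** T_l is an extension of l^-1 Xi / Xi, which has l^n elements, by T_1. *)
Lemma size_tpts : exists c : nat, forall l, (0 < l)%N -> size (tpts l) = (c * l ^ n)%N.
Proof.
exists (size (tpts 1)) => l l0.
have X1 t : t \in tpts 1 -> exists w : M, t = torus_exp L (map_mx intr w *m X).
  by move=> /(mem_tpts _ (ltn0Sn 0))[_ [w _ <-] <-]; exists w; rewrite invr1 scale1r.
pose w1 t : M := xget 0 [set w | t = torus_exp L (map_mx intr w *m X)].
have w1P t : t \in tpts 1 -> t = torus_exp L (map_mx intr (w1 t) *m X).
  by move=> /X1[w hw]; rewrite /w1; case: xgetP => [v _ //|/(_ w)].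
pose g (p : torus L * {ffun 'I_n -> 'I_l}) := torus_exp L
  (l%:R^-1 *: (map_mx intr (w1 p.1) *m X + map_mx intr (\row_i (p.2 i : nat)%:Z) *m L)).
have lR : l%:R != 0 :> R by rewrite pnatr_eq0 -lt0n.
pose S := [seq (t, f) | t <- tpts 1, f <- enum {ffun 'I_n -> 'I_l}].
have sS : size S = (size (tpts 1) * l ^ n)%N.
  by rewrite size_allpairs -cardE card_ffun !card_ord.
rewrite -sS -(size_map g); apply/perm_size/uniq_perm; first exact: tpts_uniq.
  have uS : uniq S.
    apply: allpairs_uniq; [exact: tpts_uniq|exact: enum_uniq|].
    by move=> [? ?] [? ?] _ _ [-> ->].
  rewrite map_inj_in_uniq//.
  move=> [t f] [t' f'] /allpairsP[[t1 f1] [/= t1S _ [-> ->]]] /allpairsP[[t2 f2] [/= t2S _ [-> ->]]].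
  move=> /eqP; rewrite /g /= torus_exp_eq -scalerBr => /asboolP[v _ hv].
  have hd : map_mx intr (w1 t1) *m X - map_mx intr (w1 t2) *m X =
     map_mx intr (v *~ l - \row_i (f1 i : nat)%:Z + \row_i (f2 i : nat)%:Z) *m L.
    have := congr1 (fun x => l%:R *: x) hv; rewrite scalerA mulfV// scale1r.
    rewrite -scaler_int intz map_mxD map_mxB map_mxZ !mulmxDl mulNmx -scalemxAl pmulrn => ->.
    exact: sub_add_cancel.
  have tE : t1 = t2.
    rewrite (w1P _ t1S) (w1P _ t2S); apply/eqP; rewrite torus_exp_eq hd.
    by apply/asboolP; eexists.
  rewrite tE in hd *; congr (_, _).
  move: hd; rewrite subrr => /esym/eqP; rewrite -[0](mul0mx _ L) => /eqP.
  move=> /(can_inj (mulmxK L_unit)) hm; apply/ffunP => i; apply: val_inj => /=.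
  have := congr1 (fun u : 'rV[R]_n => u 0 i) hm; rewrite !mxE => /eqP.
  rewrite -(rmorph0 intr) eqr_int => /eqP.
  rewrite -scaler_int intz !mxE => h.
  have h1 := ltn_ord (f1 i); have h2 := ltn_ord (f2 i).
  exact: (nat_residue_eq h1 h2 h).
move=> t; apply/idP/mapP => [/(mem_tpts _ l0)[_ [w _ <-] <-]|].
  pose t1 := torus_exp L (map_mx intr w *m X).
  have t1S : t1 \in tpts 1.
    by apply/(mem_tpts _ (ltn0Sn 0)); exists (map_mx intr w *m X); [exists w|rewrite invr1 scale1r].
  have /eqP := w1P _ t1S; rewrite {1}/t1 torus_exp_eq => /asboolP[v _ hv].
  have bnd i : (absz (modz (v ord0 i) l) < l)%N.
    by rewrite -ltz_nat gez0_abs ?modz_ge0 ?ltz_mod// -?lt0n// eqz_nat -lt0n.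
  exists (t1, [ffun i => Ordinal (bnd i)]).
    by apply/allpairsP; exists (t1, [ffun i => Ordinal (bnd i)]); rewrite mem_enum.
  apply/eqP; rewrite /g /= torus_exp_eq; apply/asboolP.
  exists (\row_i divz (v ord0 i) l) => //.
  rewrite -scalerBr opprD addrA -hv -mulmxBl.
  apply: (scalerI lR); rewrite scalerA mulfV// scale1r scalemxAl; congr (_ *m _); apply/rowP => i.
  rewrite !mxE ffunE /= gez0_abs ?modz_ge0 ?eqz_nat -?lt0n//.
  by rewrite {2}(divz_eq (v ord0 i) l) rmorphD rmorphM /= addrK mulrC.
move=> [[t1 f] _ ->]; apply/(mem_tpts _ l0).
have /LX[u _ hu] : lattice L (map_mx intr (\row_i (f i : nat)%:Z) *m L) by eexists.
rewrite /g /= -hu -mulmxDl -map_mxD; eexists; last reflexivity.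
by eexists.
Qed.

End TorusSums.

(** * Fourier coefficients of the factors *)

Section FourierCoefficients.
Context {K : numFieldType}.

(** The poles (1 - x)^-(j+1), with value 0 at x = 1, and the indicator of x = 1
    complementing them. *)
Definition phi (o : option nat) (x : K) : K :=
  if o is Some j then ((1 - x)^-1) ^+ j.+1 else (x == 1)%:R.

(** The binomial coefficient k over i, as a polynomial in k. *)
Definition bpoly (k : int) i : K := (\prod_(j < i) (k%:~R - j%:R)) / (i`!)%:R.

Lemma bpoly_nat (k i : nat) : bpoly k%:Z i = 'C(k, i)%:R.
Proof.
elim: i => [|i IH]; first by rewrite /bpoly big_ord0 bin0 fact0 divr1.
have i1 : i.+1%:R != 0 :> K by rewrite pnatr_eq0.
apply: (mulfI i1); rewrite -[RHS]natrM mul_bin_left natrM -IH.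
have -> : i.+1%:R * bpoly k%:Z i.+1 = (k%:R - i%:R) * bpoly k%:Z i.
  rewrite /bpoly big_ord_recr /= factS natrM invfM.
  have f0 : (i`!)%:R != 0 :> K by rewrite pnatr_eq0 -lt0n fact_gt0.
  by rewrite -pmulrn; field; rewrite f0 nat1r.
have [ik|ki] := leqP i k; first by rewrite natrB.
by rewrite IH bin_small// !mulr0.
Qed.

Lemma sum_bin k i : (\sum_(j < k) 'C(j, i) = 'C(k, i.+1))%N.
Proof.
elim: k => [|k IH]; first by rewrite big_ord0.
by rewrite big_ord_recr /= IH binS.
Qed.

(** Coefficients polynomial in both the index and the order are stored in the
    binomial basis for the index, where summation is a shift. *)
Definition fcoef (q : seq {poly K}) (k M : int) : K :=
  \sum_(i < size q) bpoly k i * (q`_i).[M%:~R].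

Definition fourier o q := forall M x, (0 < M)%N -> x ^+ M = 1 ->
  M%:R * phi o x = \sum_(k < M) fcoef q k%:Z M%:Z * x ^+ k.

Lemma sum_partial_sums (a : nat -> K) x M :
  (1 - x) * \sum_(k < M) (\sum_(i < k.+1) a i) * x ^+ k =
  \sum_(k < M) a k * x ^+ k - (\sum_(k < M) a k) * x ^+ M.
Proof.
elim: M => [|M IH]; first by rewrite !big_ord0; ring.
by rewrite big_ord_recr /= mulrDr IH !(big_ord_recr M) /= exprS; ring.
Qed.

Lemma sum_roots (x : K) M : x ^+ M = 1 -> x != 1 -> \sum_(k < M) x ^+ k = 0.
Proof.
move=> xM x1; have /mulfI : x - 1 != 0 by rewrite subr_eq0.
by apply; rewrite -subrX1 xM subrr mulr0.
Qed.

Lemma fourier_ind : fourier None [:: 1].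
Proof.
move=> M x M0 xM.
have -> : \sum_(k < M) fcoef [:: 1] k M * x ^+ k = \sum_(k < M) x ^+ k.
  apply: eq_bigr => k _; rewrite /fcoef big_ord1 /= hornerC bpoly_nat bin0.
  by rewrite !mul1r.
rewrite /=; have [->|x1] := eqVneq x 1; last by rewrite mulr0 sum_roots.
by rewrite mulr1 (eq_bigr (fun=> 1)) ?sumr_const ?card_ord// => k _; rewrite expr1n.
Qed.

(** On the M-th roots of unity, M / (1 - x) is the sum of the
    ((M - 1) / 2 - k) x^k, whose value at 1 is indeed 0. *)
Lemma fourier_pole1 : fourier (Some 0%N) [:: (2^-1)%:P * ('X - 1); - 1].
Proof.
move=> M x M0 xM.
have cE (k : nat) : fcoef [:: (2^-1)%:P * ('X - 1); - 1] k M = 2^-1 * (M%:R - 1) - k%:R.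
  rewrite /fcoef big_ord_recl big_ord1 /= !bpoly_nat bin0 bin1 !hornerE.
  by rewrite -pmulrn; ring.
under eq_bigr => k _ do rewrite cE.
rewrite /= expr1; have two0 : 2 != 0 :> K by rewrite pnatr_eq0.
have [->|x1] := eqVneq x 1.
  under eq_bigr => k _ do rewrite expr1n mulr1.
  rewrite subrr invr0 mulr0 sumrB sumr_const card_ord -natr_sum.
  have -> : (\sum_(i < M) i)%N = 'C(M, 2) by rewrite -bin2_sum big_mkord.
  rewrite -bpoly_nat /bpoly big_ord_recl big_ord1 /= -[_ *+ M]mulr_natr.
  by rewrite /bump /= -pmulrn (_ : 2`!%:R = 2)//; field.
have x10 : 1 - x != 0 by rewrite subr_eq0 eq_sym.
apply: (mulfI x10); rewrite mulrCA mulfV// mulr1.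
pose a k : K := if k is 0%N then 2^-1 * (M%:R - 1) else - 1.
have aE k : \sum_(i < k.+1) a i = 2^-1 * (M%:R - 1) - k%:R.
  elim: k => [|k IH]; first by rewrite big_ord1 /=; ring.
  by rewrite big_ord_recr IH /= -natr1; ring.
under [in RHS]eq_bigr => k _ do rewrite -aE.
rewrite sum_partial_sums xM mulr1.
move: M0 xM @a aE; clear cE; case: M => // M _ xM a aE; rewrite aE big_ord_recl /= expr0.
rewrite -(natr1 M).
have -> : \sum_(i < M) a (bump 0 i) * x ^+ bump 0 i = 1.
  under eq_bigr => i _ do rewrite mulN1r /bump /= add1n.
  have := sum_roots xM x1; rewrite big_ord_recl /= expr0 sumrN => /eqP.
  rewrite addrC addr_eq0 => /eqP h; rewrite -[RHS]opprK -h.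
  by congr (- _); apply: eq_bigr.
by field.
Qed.

(** The sum of the binomial coefficients (k + 1 over i + 1) over k < M, divided
    by M, as a polynomial in M. *)
Definition bc i : {poly K} :=
  ((i.+2)`!%:R^-1)%:P * (('X + 1) * \prod_(j < i) ('X - (j.+1%:R)%:P)).

Lemma bcE i (M : nat) : M%:R * (bc i).[M%:R] = 'C(M.+1, i.+2)%:R.
Proof.
rewrite -bpoly_nat /bpoly !big_ord_recl /bc !hornerE horner_prod /=.
under eq_bigr => j _ do rewrite !hornerE.
rewrite [in RHS](eq_bigr (fun j : 'I_i => M%:R - j.+1%:R)); last first.
  by move=> j _; rewrite /bump /= !add1n -pmulrn -!natr1; ring.
by rewrite /bump /= -pmulrn -natr1; ring.
Qed.

Definition next_coefs (q : seq {poly K}) : seq {poly K} :=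
  mkseq (fun i => q`_i + if i is i'.+1 then q`_i'
                         else - \sum_(j < size q) q`_j * bc j) (size q).+1.

Lemma next_coefsE q (k : nat) M : fcoef (next_coefs q) k M =
  \sum_(i < k.+1) fcoef q i M - \sum_(j < size q) (q`_j).[M%:~R] * (bc j).[M%:~R].
Proof.
rewrite {1}/fcoef size_mkseq.
under eq_bigr => i _ do rewrite nth_mkseq// hornerD mulrDr.
rewrite big_split /= big_ord_recr /= [q`_(size q)]nth_default// hornerC mulr0 addr0.
rewrite [X in _ + X]big_ord_recl /= hornerN bpoly_nat bin0 mul1r.
rewrite addrCA addrC; congr (_ - _); last first.
  by rewrite horner_sum; apply: eq_bigr => j _; rewrite hornerM.
rewrite -big_split /= exchange_big /=; apply: eq_bigr => i _.
rewrite -mulr_suml -mulrDl; congr (_ * _); rewrite !bpoly_nat /bump /= add1n.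
under eq_bigr => j _ do rewrite bpoly_nat.
by rewrite -natr_sum sum_bin binS natrD addrC.
Qed.

(** Dividing by 1 - x takes partial sums of the coefficients; the constant
    subtracted makes the value at x = 1 vanish. *)
Lemma fourier_next j q : fourier (Some j) q -> fourier (Some j.+1) (next_coefs q).
Proof.
move=> hq M x M0 xM.
have MK : M%:R != 0 :> K by rewrite pnatr_eq0 -lt0n.
pose a k := fcoef q k%:Z M; pose c := \sum_(j < size q) (q`_j).[M%:R] * (bc j).[M%:R].
have a0 : \sum_(k < M) a k = 0.
  have := hq M 1 M0 (expr1n _ _); rewrite /= subrr invr0 expr0n /= mulr0 => h.
  by rewrite [RHS]h; apply: eq_bigr => k _; rewrite expr1n mulr1.
have cE : \sum_(k < M) \sum_(i < k.+1) a i = M%:R * c.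
  rewrite /c mulr_sumr.
  have aE k : \sum_(i < k.+1) a i = \sum_(i < size q) 'C(k.+1, i.+1)%:R * (q`_i).[M%:R].
    rewrite /a /fcoef exchange_big /=; apply: eq_bigr => i _; rewrite -mulr_suml.
    by rewrite -sum_bin natr_sum; congr (_ * _); apply: eq_bigr => k' _; rewrite bpoly_nat.
  under eq_bigr => k _ do rewrite aE.
  rewrite exchange_big /=; apply: eq_bigr => i _; rewrite -mulr_suml mulrCA bcE mulrC.
  by rewrite -sum_bin big_ord_recl /= add0n natr_sum.
under eq_bigr => k _ do rewrite next_coefsE mulrBl.
rewrite sumrB -mulr_sumr -/c.
have [->|x1] := eqVneq x 1.
  under eq_bigr => k _ do rewrite expr1n mulr1.
  rewrite cE /= subrr invr0 expr0n /= mulr0.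
  rewrite (eq_bigr (fun=> 1)) ?sumr_const ?card_ord => [|k _]; last by rewrite expr1n.
  by rewrite mulrC subrr.
rewrite sum_roots// mulr0 subr0.
have x10 : 1 - x != 0 by rewrite subr_eq0 eq_sym.
apply: (mulfI x10); rewrite (sum_partial_sums a) a0 mul0r subr0 -hq//=.
by rewrite [_ ^+ j.+2]exprS; field.
Qed.

Lemma fourier_ex o : exists q, fourier o q.
Proof.
case: o => [j|]; last by exists [:: 1]; exact: fourier_ind.
elim: j => [|j [q IH]]; first by eexists; exact: fourier_pole1.
by exists (next_coefs q); exact: fourier_next.
Qed.

Lemma qpfun_sum (G : zmodType) (I : Type) (r : seq I) (F : I -> G -> K) :
  (forall i, qpfun (F i)) -> qpfun (fun x => \sum_(i <- r) F i x).
Proof.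
move=> h; elim: r => [|i r IH].
  by apply: qpfun_ext (qpfun_cst 0) => x; rewrite big_nil.
by apply: qpfun_ext (qpfunD (h i) IH) => x; rewrite big_cons.
Qed.

Lemma qpfun_prod (G : zmodType) (I : Type) (r : seq I) (F : I -> G -> K) :
  (forall i, qpfun (F i)) -> qpfun (fun x => \prod_(i <- r) F i x).
Proof.
move=> h; elim: r => [|i r IH].
  by apply: qpfun_ext (qpfun_cst 1) => x; rewrite big_nil.
by apply: qpfun_ext (qpfunM (h i) IH) => x; rewrite big_cons.
Qed.

Lemma qpfun_horner (G : zmodType) (d : zlin G) (p : {poly K}) :
  qpfun (fun x => p.[(d x)%:~R]).
Proof.
elim/poly_ind: p => [|p c IH].
  by apply: qpfun_ext (qpfun_cst 0) => x; rewrite hornerC.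
apply: qpfun_ext (qpfunD (qpfunM IH (qpfun_zlin d)) (qpfun_cst c)) => x.
by rewrite !hornerE.
Qed.

Lemma qpfun_fcoef (G : zmodType) (c d : zlin G) q :
  qpfun (fun x => fcoef q (c x) (d x)).
Proof.
apply: qpfun_sum => i; apply: qpfunM; last exact: qpfun_horner.
apply: qpfunM; last exact: qpfun_cst.
by apply: qpfun_prod => j; apply: qpfunD (qpfun_zlin c) (qpfun_cst _).
Qed.

End FourierCoefficients.

(** * Functions piecewise quasi-polynomial on large cones *)

Section LocallyPwq.
Context {n : nat} {K : comNzRingType}.
Notation M := 'rV[int]_n.

Definition inbox (B : nat) (z : M) : Prop := forall i, (absz (z ord0 i) <= B)%N.

Definition boxseq (B : nat) : seq M :=
  undup [seq \row_i ((f i : nat)%:Z - B%:Z) | f : {ffun 'I_n -> 'I_(B + B).+1}].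

Lemma mem_boxseq B z : inbox B z -> z \in boxseq B.
Proof.
move=> zB; rewrite mem_undup.
have h i : (absz (z ord0 i + B%:Z)%R < (B + B).+1)%N by have := zB i; lia.
apply/mapP; exists [ffun i => Ordinal (h i)]; first by rewrite mem_enum.
apply/rowP => i; rewrite !mxE ffunE /= gez0_abs ?addrK//.
by have := zB i; lia.
Qed.

Lemma inbox_ex z : exists B, inbox B z.
Proof.
exists (\max_i absz (z ord0 i))%N => i.
exact: (@leq_bigmax_cond _ xpredT (fun i => absz (z ord0 i))).
Qed.

Lemma inboxW B B' z : (B <= B')%N -> inbox B z -> inbox B' z.
Proof. by move=> h zB i; exact: leq_trans (zB i) h. Qed.

Lemma inboxD B B' z z' : inbox B z -> inbox B' z' -> inbox (B + B') (z + z').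
Proof. move=> zB z'B i; have -> : (z + z') ord0 i = (z ord0 i + z' ord0 i : int) by rewrite mxE.
by have := zB i; have := z'B i; lia. Qed.

Lemma inboxMn B z k : inbox B z -> inbox (B * k) (z *+ k).
Proof.
move=> zB; elim: k => [|k IH]; first by rewrite mulr0n => i; rewrite mxE.
by rewrite mulrS mulnS; exact: inboxD.
Qed.

Lemma inbox_div B z l : (0 < l)%N -> inbox (B * l) (z *+ l) -> inbox B z.
Proof.
move=> l0 h i; have := h i; rewrite -scaler_nat mxE abszM natz /= mulnC.
by rewrite leq_pmul2r.
Qed.

(** The number of walls of F may grow with the cone; inside one cone it is
    finite. *)
Definition lpwq (f : M -> nat -> K) := forall B : nat,
  exists2 F : (M * int)%type -> K, pwq F &
    forall z l, (0 < l)%N -> inbox (B * l) z -> f z l = F (z, l%:Z).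

Lemma lpwq_ext f g : (forall z l, (0 < l)%N -> f z l = g z l) -> lpwq f -> lpwq g.
Proof. by move=> fg hf B; have [F pF hF] := hf B; exists F => // z l l0 zB; rewrite -fg// hF. Qed.

Lemma lpwq_pwq (F : (M * int)%type -> K) : pwq F -> lpwq (fun z l => F (z, l%:Z)).
Proof. by move=> pF B; exists F. Qed.

Lemma lpwqD f g : lpwq f -> lpwq g -> lpwq (fun z l => f z l + g z l).
Proof.
move=> hf hg B; have [F pF hF] := hf B; have [G pG hG] := hg B.
by exists (fun x => F x + G x); [exact: pwq_add|move=> z l l0 zB; rewrite hF ?hG].
Qed.

Lemma lpwqM f g : lpwq f -> lpwq g -> lpwq (fun z l => f z l * g z l).
Proof.
move=> hf hg B; have [F pF hF] := hf B; have [G pG hG] := hg B.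
by exists (fun x => F x * G x); [exact: pwqM|move=> z l l0 zB; rewrite hF ?hG].
Qed.

Lemma lpwq_cst c : lpwq (fun _ _ => c).
Proof. by apply: (@lpwq_pwq (fun=> c)); exact: pwq_cst. Qed.

Lemma lpwqN f : lpwq f -> lpwq (fun z l => - f z l).
Proof.
move=> hf; apply: lpwq_ext (lpwqM (lpwq_cst (- 1)) hf) => z l _.
by rewrite mulN1r.
Qed.

Lemma zlin_snd_subproof (G : zmodType) (x y : (G * int)%type) : (x + y).2 = x.2 + y.2.
Proof. by []. Qed.
Definition zlin_snd (G : zmodType) : zlin (G * int)%type := Zlin (@zlin_snd_subproof G).

Lemma lpwq_X k : lpwq (fun _ l => l%:R ^+ k).
Proof.
apply: (@lpwq_ext (fun z l => (zlin_snd M (z, l%:Z))%:~R ^+ k)) => //.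
apply: (@lpwq_pwq (fun x => (zlin_snd M x)%:~R ^+ k)); apply: pwq_qp.
elim: k => [|k IH]; first exact: qpfun_cst.
by apply: qpfun_ext (qpfunM (qpfun_zlin (zlin_snd M)) IH) => x; rewrite exprS.
Qed.

Lemma lpwq_sum (I : Type) (r : seq I) (F : I -> M -> nat -> K) :
  (forall i, lpwq (F i)) -> lpwq (fun z l => \sum_(i <- r) F i z l).
Proof.
move=> h; elim: r => [|i r IH].
  by apply: lpwq_ext (lpwq_cst 0) => z l _; rewrite big_nil.
by apply: lpwq_ext (lpwqD (h i) IH) => z l _; rewrite big_cons.
Qed.

(** The function may thus be computed by a different formula in each cone. *)
Lemma lpwq_local f : (forall B : nat, exists2 g, lpwq g &
    forall z l, (0 < l)%N -> inbox (B * l) z -> f z l = g z l) -> lpwq f.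
Proof.
move=> h B; have [g gp fg] := h B; have [F pF hF] := gp B.
by exists F => // z l l0 zB; rewrite fg// hF.
Qed.

(** Summation over a range bounded linearly in l stays within a larger cone. *)
Lemma lpwq_sum_ray f (P : ((M * int) * int)%type -> K) (b : M) (c : nat) :
  lpwq f -> qpfun P ->
  lpwq (fun z l => \sum_(k < (c * l)%N) P ((z, l%:Z), k%:Z) * f (z + b *+ k) l).
Proof.
move=> hf qP B; have [Bb hb] := inbox_ex b.
have [F pF hF] := hf (B + Bb * c)%N.
pose h (x : (M * int) * int) : M * int := (x.1.1 + b *~ x.2, x.1.2).
have hD x y : h (x + y) = h x + h y.
  by case: x y => [[x1 x2] x3] [[y1 y2] y3]; rewrite /h !pairDE /= mulrzDr addrACA.
have pG : pwq (fun x => P x * F (h x)) by apply: pwq_mul_qp => //; exact: pwq_comp.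
pose e := zlin_scale c%:Z (zlin_snd M).
pose h' (x : M * int) : (M * int) * int := (x, c%:Z * x.2).
have h'D x y : h' (x + y) = h' x + h' y by rewrite /h' pairDE /= mulrDr.
exists (fun x => isum 0 (e x + 1) (fun k => P (x, k) * F (h (x, k))) - P (h' x) * F (h (h' x))).
  apply: pwq_add; first exact: (pwq_isum e pG).
  by apply: pwqN; apply: (pwq_comp h'D pG).
move=> z l l0 zB.
have -> : e (z, l%:Z) + 1 = 0 + (c * l).+1%:Z by rewrite add0r /= -PoszM -PoszD addn1.
rewrite isumE big_ord_recr /= add0r /h' /= -PoszM addrK.
apply: eq_bigr => k _; rewrite add0r; congr (_ * _); rewrite hF /h /= -?pmulrn//.
rewrite mulnDl; apply: inboxD => //; apply: inboxW (inboxMn k hb).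
by rewrite -mulnA leq_mul2l ltnW ?orbT.
Qed.

Lemma lpwq_eq0 (h : (M * int)%type -> M) : (forall x y, h (x + y) = h x + h y) ->
  lpwq (fun z l => (h (z, l%:Z) == 0)%:R).
Proof.
move=> hD; apply: (@lpwq_pwq (fun x => (h x == 0)%:R)).
have cD i x y : h (x + y) 0 i = h x 0 i + h y 0 i by rewrite hD mxE.
pose c i := Zlin (cD i).
have p1 (i : 'I_n) : pwq (fun x => ((h x 0 i == 0)%:R : K)).
  apply: pwq_ext (pwq_if (c i) (pwq_if (zlin_scale (-1) (c i)) (pwq_cst _ 1))) => x /=.
  by rewrite mulN1r oppr_ge0; case: ltrgtP.
apply: (@pwq_ext _ _ (fun x => \prod_i ((h x 0 i == 0)%:R : K))) => [x|].
  have [h0|h0] := eqVneq (h x) 0.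
    by rewrite big1// => i _; rewrite h0 mxE eqxx.
  have [i hi] : exists i, h x 0 i != 0.
    apply/existsP; apply: contraNT h0; rewrite negb_exists => /forallP h0.
    by apply/eqP/rowP => i; rewrite mxE; apply/eqP; have := h0 i; rewrite negbK.
  by rewrite (bigD1 i)//= (negPf hi) mul0r.
elim: (index_enum _) => [|i r IH].
  by apply: pwq_ext (pwq_cst _ 1) => x; rewrite big_nil.
by apply: pwq_ext (pwqM (p1 i) IH) => x; rewrite big_cons.
Qed.

End LocallyPwq.

(** * Torus sums are locally piecewise quasi-polynomial *)

Section TorusSumsPwq.
Context {R : realType} {n : nat} (L X : 'M[R]_n).
Hypotheses (L_unit : L \in unitmx) (LX : lattice L `<=` lattice X).
Notation M := 'rV[int]_n.
Notation C := R[i].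
Local Notation D := (dual_basis L).
Local Notation emb := (emb (dual_basis L)).
Local Notation chi := (@chi R n L).
Local Notation tpts := (@tpts R n L X).
Local Notation xw := (@xw R n L).
Local Notation xilat := (xilat L X).
Implicit Types (I : seq ((M * C) * option nat)) (b : M * C) (t : torus L).

Definition factors I t : C := \prod_(p <- I) phi p.2 (xw p.1 t).

Definition fsum I l : M -> C := tsum X l (factors I).

Lemma common_root (B : seq (M * C)) :
  (forall b, b \in B -> exists2 m, (0 < m)%N & b.2 ^+ m = 1) ->
  exists2 m, (0 < m)%N & forall b, b \in B -> b.2 ^+ m = 1.
Proof.
elim: B => [|b B IH] hB; first by exists 1%N.
have [|m m_gt0 hm] := IH; first by move=> b' b'B; apply: hB; rewrite in_cons b'B orbT.
have [m' m'0 hm'] := hB b (mem_head _ _); exists (m * m')%N; first by rewrite muln_gt0 m_gt0.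
move=> b'; rewrite in_cons => /orP[/eqP ->|b'B]; first by rewrite mulnC exprM hm' expr1n.
by rewrite exprM hm ?expr1n.
Qed.

(** T_l is killed by l N if N Xi is inside Lambda. *)
Lemma xw_torsion (B : seq (M * C)) :
  (forall b, b \in B -> exists2 m, (0 < m)%N & b.2 ^+ m = 1) ->
  exists2 m, (0 < m)%N & forall b l t, b \in B -> (0 < l)%N -> t \in tpts l ->
    b.2 ^+ m = 1 /\ xw b t ^+ (m * l) = 1.
Proof.
move=> /common_root[m0 m00 hm0].
have [N N0 hN] := lattice_index L_unit LX.
exists (m0 * N)%N; first by rewrite muln_gt0 m00.
move=> b l t bB l0 /(mem_tpts L_unit LX _ l0)[x Xx <-].
have hb : b.2 ^+ (m0 * N) = 1 by rewrite exprM hm0// expr1n.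
split=> //; rewrite exprMn exprM hb expr1n mul1r -chiMn chi_exp//.
rewrite embMn -scaler_nat pairingZl pairingZr mulrA natrM mulfK ?pnatr_eq0 -?lt0n//.
rewrite natrM -mulrA -pairingZr.
have /intrP[k ->] := dual_lattice_emb L_unit (- b.1) (hN _ Xx).
by rewrite (_ : m0%:R * k%:~R = (m0%:Z * k)%:~R) ?expi_int// rmorphM.
Qed.

Variables (B : seq (M * C)) (m : nat).
Hypothesis m_gt0 : (0 < m)%N.
Hypothesis B_torsion : forall b l t, b \in B -> (0 < l)%N -> t \in tpts l ->
    b.2 ^+ m = 1 /\ xw b t ^+ (m * l) = 1.

Lemma fsum_cons (p : (M * C) * option nat) I q l z : p.1 \in B -> (0 < l)%N ->
  fourier p.2 q ->
  (m * l)%:R * fsum (p :: I) l z =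
  \sum_(k < (m * l)%N) fcoef q k%:Z (m * l)%N%:Z * p.1.2 ^+ k * fsum I l (z - p.1.1 *+ k).
Proof.
move=> pB l0 hq; have ml0 : (0 < m * l)%N by rewrite muln_gt0 m_gt0.
under eq_bigr => k _ do rewrite /fsum /tsum mulr_sumr.
rewrite exchange_big /= mulr_sumr [LHS]big_seq [RHS]big_seq; apply: eq_bigr => t tl.
have [_ xt] := B_torsion pB l0 tl.
rewrite [X in _ * (_ * X)]/factors big_cons -/(factors I t).
have -> : (m * l)%:R * (chi t z * (phi p.2 (xw p.1 t) * factors I t)) =
  (m * l)%:R * phi p.2 (xw p.1 t) * (chi t z * factors I t) by ring.
rewrite (hq _ _ ml0 xt) mulr_suml; apply: eq_bigr => k _.
by rewrite chiD -mulNrn chiMn exprMn; ring.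
Qed.

Lemma fsum_nil l z : (0 < l)%N -> fsum [::] l z =
  if `[< exists2 y, xilat y & z = y *+ l >] then (size (tpts l))%:R else 0.
Proof.
move=> l0; rewrite -(tsum1 L_unit LX)//; apply: eq_bigr => t _.
by rewrite /factors big_nil.
Qed.

(** By the Fourier expansion of the factors, the sum is a combination of
    translates along the weights of the sum of the characters alone. *)
Lemma fsum_supp I l z : (forall p, p \in I -> p.1 \in B) -> (0 < l)%N ->
  fsum I l z != 0 ->
  exists2 y, xilat y & emb (z - y *+ l) \in wspan D (map fst I).
Proof.
move=> IB l0; elim: I z IB => [|p I IH] z IB.
  rewrite fsum_nil//; case: asboolP => [[y hy ->] _|]; last by rewrite eqxx.
  by exists y; rewrite // subrr emb0 mem0v.
have [q hq] := fourier_ex (K := C) p.2.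
have pB : p.1 \in B by apply: IB; rewrite mem_head.
have ml0 : (m * l)%:R != 0 :> C by rewrite pnatr_eq0 -lt0n muln_gt0 m_gt0.
rewrite -(mulrI_eq0 _ (mulfI ml0)) (fsum_cons _ _ pB l0 hq).
move=> /(@sum_neq0 _ _ (fun k => fcoef q k (m * l)%N * p.1.2 ^+ k * fsum I l (z - p.1.1 *+ k)))[k _].
rewrite mulf_eq0 negb_or => /andP[_ /IH[|y hy h]].
  by move=> p' p'I; apply: IB; rewrite in_cons p'I orbT.
exists y => //; rewrite -[z](subrK (p.1.1 *+ k)) addrAC embD embMn.
apply: rpredD; last by apply: rpredMn; apply: wspan_mem; rewrite mem_head.
apply: (subvP _ _ h); apply: wspan_sub => a aI; apply: wspan_mem.
by rewrite /= in_cons aI orbT.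
Qed.

(** In a given cone, only finitely many y in Xi^* are concerned. *)
Lemma lpwq_xilat : lpwq (fun z l => (`[< exists2 y, xilat y & z = y *+ l >])%:R : C).
Proof.
apply: lpwq_local => K.
pose S := [seq y <- boxseq K | `[< xilat y >]].
exists (fun z l => \sum_(y <- S) ((z - y *+ l == 0)%:R : C)).
  apply: lpwq_sum => y.
  pose h (x : M * int) := x.1 - y *~ x.2.
  apply: (@lpwq_eq0 _ _ h) => -[a1 a2] [b1 b2].
  by rewrite /h /= mulrzDr opprD addrACA.
move=> z l l0 zK; case: asboolP => [[y hy zy]|nz].
  rewrite zy; have yS : y \in S.
    rewrite mem_filter; apply/andP; split; first exact/asboolP.
    by apply: mem_boxseq; apply: (inbox_div l0); rewrite -zy.
  rewrite (bigD1_seq y)//= ?filter_uniq ?undup_uniq// subrr eqxx big1 ?addr0// => y' yy'.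
  rewrite -mulrnBl; apply/eqP; rewrite pnatr_eq0 eqb0.
  apply: contra yy' => /eqP/rowP h; apply/eqP/rowP => i; have := h i.
  rewrite -scaler_nat natz !mxE => /eqP; rewrite mulf_eq0 eqz_nat gtn_eqF//= subr_eq0.
  by move=> /eqP.
rewrite big1_seq// => y /andP[_]; rewrite mem_filter => /andP[/asboolP hy _].
by apply/eqP; rewrite pnatr_eq0 eqb0 subr_eq0; apply: contra_notN nz => /eqP ->; exists y.
Qed.

(** Each factor costs a division by l, which the n factors l of |T_l| pay for
    when there are at most n factors. *)
Lemma fsum_lpwq I : (forall p, p \in I -> p.1 \in B) ->
  exists2 U, lpwq U & forall z l, (0 < l)%N ->
    l%:R ^+ size I * fsum I l z = l%:R ^+ n * U z l.
Proof.
elim: I => [|p I IH] IB.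
  have [c hc] := size_tpts L_unit LX.
  exists (fun z l => c%:R * (`[< exists2 y, xilat y & z = y *+ l >])%:R).
    exact: lpwqM (lpwq_cst _) lpwq_xilat.
  move=> z l l0; rewrite expr0 mul1r fsum_nil// hc// natrM natrX.
  by case: asboolP => _; rewrite ?mulr0 ?mulr1 1?mulrC.
have [|U pU hU] := IH; first by move=> p' p'I; apply: IB; rewrite in_cons p'I orbT.
have [q hq] := fourier_ex (K := C) p.2.
have pB : p.1 \in B by apply: IB; rewrite mem_head.
pose ck := zlin_snd (M * int)%type.
have dD (x y : (M * int) * int) : (x + y).1.2 = x.1.2 + y.1.2 by [].
pose d := zlin_scale m%:Z (Zlin dD).
pose P (x : (M * int) * int) := m%:R^-1 * (fcoef q (ck x) (d x) * p.1.2 ^ (ck x)).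
exists (fun z l => \sum_(k < (m * l)%N) P ((z, l%:Z), k%:Z) * U (z - p.1.1 *+ k) l).
  apply: lpwq_ext (@lpwq_sum_ray _ _ U P (- p.1.1) m pU _) => [z l l0|].
    by apply: eq_bigr => k _; rewrite mulNrn.
  apply: qpfunM; first exact: qpfun_cst.
  apply: qpfunM; first exact: qpfun_fcoef.
  have [c hc] := size_tpts L_unit LX.
  have [t0 t0l] : exists t, t \in tpts 1.
    exists (torus_exp L 0); apply/(mem_tpts L_unit LX _ (ltn0Sn 0)).
    by exists 0; [exact: lattice0|rewrite scaler0].
  have [pm _] := B_torsion pB (ltn0Sn 0) t0l.
  exact: (qpfun_exp ck m_gt0 pm).
move=> z l l0; have mK : m%:R != 0 :> C by rewrite pnatr_eq0 -lt0n.
apply: (mulfI mK); rewrite /= exprS -!mulrA [fsum _ _ _ in LHS]lock mulrCA -lock.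
have := fsum_cons I z pB l0 hq; rewrite natrM => h.
have -> : l%:R * (m%:R * (l%:R ^+ size I * fsum (p :: I) l z)) =
  l%:R ^+ size I * (m%:R * l%:R * fsum (p :: I) l z) by ring.
rewrite h !mulr_sumr; apply: eq_bigr => k _.
have -> : P (z, l%:Z, k%:Z) = m%:R^-1 * (fcoef q k (m * l)%N * p.1.2 ^+ k) by [].
by rewrite [LHS]mulrCA hU//; field.
Qed.

Lemma fsum_lpwq_small I : (forall p, p \in I -> p.1 \in B) -> (size I <= n)%N ->
  lpwq (fun z l => fsum I l z).
Proof.
move=> IB In; have [U pU hU] := fsum_lpwq IB.
apply: lpwq_ext (lpwqM (@lpwq_X _ _ (n - size I)) pU) => z l l0.
have lK : l%:R ^+ size I != 0 :> C by rewrite expf_neq0// pnatr_eq0 -lt0n.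
by apply: (mulfI lK); rewrite hU// mulrA -exprD subnKC.
Qed.

Lemma vsum_lpwq (B' : seq (M * C)) : {subset B' <= B} ->
  lpwq (fun z l => l%:R ^+ size B' * vsum L X B' l z).
Proof.
move=> B'B; pose I := [seq (b, Some 0%N) | b <- B'].
have [|U pU hU] := @fsum_lpwq I.
  by move=> p /mapP[b bB' ->]; exact: B'B.
apply: lpwq_ext (lpwqM (@lpwq_X _ _ n) pU) => z l l0; rewrite -hU// size_map.
congr (_ * _); apply: eq_bigr => t _; congr (_ * _).
by rewrite /factors big_map /vden -prodfV; apply: eq_bigr => b _; rewrite /= expr1.
Qed.

End TorusSumsPwq.

(** * Partial fractions on the torus *)

Section PartialFractions.
Context {R : realType} {n : nat} (L : 'M[R]_n).
Notation M := 'rV[int]_n.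
Notation C := R[i].
Notation factor := ((M * C) * option nat)%type.
Local Notation chi := (@chi R n L).
Local Notation xw := (@xw R n L).
Local Notation factors := (@factors R n L).
Implicit Types (J : seq factor) (b : M * C) (t : torus L) (f g : torus L -> C).

Variables (B : seq (M * C)) (m : nat).
Hypothesis m_gt0 : (0 < m)%N.
Hypothesis B_torsion : forall b, b \in B -> b.2 ^+ m = 1.

Definition weight_mx J : 'M[int]_(size J, n) := \matrix_(i < size J) (nth 0 [seq p.1.1 | p <- J] i).

Definition indep J := row_free (map_mx (intr : int -> rat) (weight_mx J)).

Definition in_B J := forall p, p \in J -> p.1 \in B.

Lemma indep_size J : indep J -> (size J <= n)%N.
Proof. by rewrite /indep /row_free => /eqP <-; exact: rank_leq_col. Qed.

(** Combinations, with Laurent polynomials as coefficients, of products of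
    factors with independent weights. *)
Inductive pfrac : (torus L -> C) -> Prop :=
| pfrac_base J : in_B J -> indep J -> pfrac (factors J)
| pfrac_add f g : pfrac f -> pfrac g -> pfrac (fun t => f t + g t)
| pfrac_chi c y f : pfrac f -> pfrac (fun t => c * chi t y * f t).

Lemma pfrac_ext f g : (forall t, f t = g t) -> pfrac f -> pfrac g.
Proof. by move=> /funext ->. Qed.

Lemma pfracZ c f : pfrac f -> pfrac (fun t => c * f t).
Proof. by move=> /(pfrac_chi c 0); apply: pfrac_ext => t; rewrite chi0 mulr1. Qed.

Lemma pfrac0 : pfrac (fun=> 0).
Proof.
have h : pfrac (factors [::]).
  apply: pfrac_base => //; rewrite /indep /row_free.
  by rewrite -leqn0 rank_leq_row.
by apply: pfrac_ext (pfracZ 0 h) => t; rewrite mul0r.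
Qed.

Lemma pfrac_sum (I : Type) (r : seq I) (F : I -> torus L -> C) :
  (forall i, pfrac (F i)) -> pfrac (fun t => \sum_(i <- r) F i t).
Proof.
move=> h; elim: r => [|i r IH].
  by apply: pfrac_ext pfrac0 => t; rewrite big_nil.
by apply: pfrac_ext (pfrac_add (h i) IH) => t; rewrite big_cons.
Qed.

Lemma B_unit b : b \in B -> b.2 != 0.
Proof.
move=> /B_torsion; apply: contra_eq_neq => ->.
by rewrite expr0n gtn_eqF//= eq_sym oner_eq0.
Qed.

Lemma xw_neq0 b t : b \in B -> xw b t != 0.
Proof. by move=> bB; rewrite mulf_neq0 ?chi_neq0// B_unit. Qed.

Lemma pfrac_xwz b (c : int) f : pfrac f -> pfrac (fun t => xw b t ^ c * f t).
Proof.
move=> /(pfrac_chi (b.2 ^ c) (- b.1 *~ c)); apply: pfrac_ext => t.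
by rewrite chiMz expfzMl.
Qed.

Lemma pfrac_xw b k f : pfrac f -> pfrac (fun t => xw b t ^+ k * f t).
Proof. exact: (@pfrac_xwz b k%:Z). Qed.

Lemma factors_perm J J' t : perm_eq J J' -> factors J t = factors J' t.
Proof. exact: perm_big. Qed.

Lemma factors_cons p J t : factors (p :: J) t = phi p.2 (xw p.1 t) * factors J t.
Proof. exact: big_cons. Qed.

(** The order of the pole of a factor; the indicator has none. *)
Definition pole (o : option nat) : nat := if o is Some j then j.+1 else 0.

(** The measure for the induction: a factor which is an indicator counts less than
    one with a pole. *)
Definition msr J : nat := (size J + count (fun p => p.2 != None) J)%N.

Lemma msr_perm J J' : perm_eq J J' -> msr J = msr J'.
Proof. by move=> h; rewrite /msr (perm_size h) (permP h). Qed.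

Lemma phi_succ j (x : C) : (1 - x) * phi (Some j.+1) x = phi (Some j) x.
Proof.
have [->|x1] := eqVneq x 1; first by rewrite /= subrr mul0r invr0 expr0n.
have x10 : 1 - x != 0 by rewrite subr_eq0 eq_sym.
by rewrite /= [X in _ * X]exprS mulrA mulfV// mul1r.
Qed.

Lemma phi_zero (x : C) : (1 - x) * phi (Some 0%N) x = 1 - phi None x.
Proof.
rewrite /= expr1; have [->|x1] := eqVneq x 1; first by rewrite !subrr mul0r.
by rewrite subr0 mulfV// subr_eq0 eq_sym.
Qed.

Lemma phi_none (x : C) : (1 - x) * phi None x = 0.
Proof.
by rewrite /=; have [->|_] := eqVneq x 1; rewrite ?subrr ?mul0r ?mulr0.
Qed.

Section Step.
Variable N : nat.
Hypothesis IHN : forall J, in_B J -> (msr J < N)%N -> pfrac (factors J).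

Notation rel_list := (seq (factor * int)).
Implicit Types Z : rel_list.

Definition rel_prod Z t : C := \prod_(z <- Z) xw z.1.1 t ^ z.2.

Definition poles Z : nat := \sum_(z <- Z | z.2 != 0) pole z.1.2.

(** If the other members of a relation are indicators, the remaining variable is
    a root of unity of bounded order on their support, and any function of it is
    a polynomial there. *)
Lemma pfrac_interpolate Z b o (e : nat) : (0 < e)%N -> in_B ((b, o) :: map fst Z) ->
  (forall t, rel_prod Z t = xw b t ^+ e) -> poles Z = 0%N ->
  (msr ((b, o) :: map fst Z) <= N)%N ->
  pfrac (factors ((b, o) :: map fst Z)).
Proof.
move=> e0 hB hrel pZ hN; have [q hq] := fourier_ex (K := C) o.
have eK : e%:R != 0 :> C by rewrite pnatr_eq0 -lt0n.
have h : pfrac (factors (map fst Z)).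
  apply: IHN => [p pZ'|]; first by apply: hB; rewrite in_cons pZ' orbT.
  apply: leq_trans hN; by rewrite /msr /= addSn ltnS leq_add2l leq_addl.
apply: (@pfrac_ext (fun t => \sum_(k < e) (e%:R^-1 * fcoef q k%:Z e) *
    (xw b t ^+ k * factors (map fst Z) t))).
  move=> t; rewrite factors_cons /=.
  have [->|nz] := eqVneq (factors (map fst Z) t) 0.
    by rewrite mulr0 big1// => k _; rewrite !mulr0.
  have xe : xw b t ^+ e = 1.
    rewrite -hrel /rel_prod big1_seq// => z /andP[_ zZ].
    have [->|z2] := eqVneq z.2 0; first by rewrite expr0z.
    move: pZ => /eqP; rewrite /poles sum_nat_seq_eq0 => /allP /(_ z zZ).
    rewrite z2 /=; case zo : z.1.2 => [j|]// _.
    suff -> : xw z.1.1 t = 1 by rewrite exp1rz.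
    apply/eqP; apply: contraNT nz => xz; apply/eqP.
    rewrite (factors_perm t (perm_to_rem (map_f fst zZ))) factors_cons zo /=.
    by rewrite (negPf xz) mul0r.
  apply: (mulfI eK); rewrite mulrA (hq _ _ e0 xe) mulr_suml mulr_sumr.
  by apply: eq_bigr => k _; field.
by apply: pfrac_sum => k; apply: pfracZ; exact: pfrac_xw.
Qed.

Lemma rel_prod_perm Z Z' t : perm_eq Z Z' -> rel_prod Z t = rel_prod Z' t.
Proof. exact: perm_big. Qed.

(** The functions g such that g F is a combination of partial fractions form a
    module over Laurent polynomials. *)
Lemma pfrac_telescope Z F : in_B (map fst Z) ->
  (forall z, z \in Z -> z.2 != 0 -> pfrac (fun t => (1 - xw z.1.1 t) * F t)) ->
  pfrac (fun t => (1 - rel_prod Z t) * F t).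
Proof.
elim: Z => [|z Z IH] hB hF.
  by apply: pfrac_ext pfrac0 => t; rewrite /rel_prod big_nil subrr mul0r.
have {}IH : pfrac (fun t => (1 - rel_prod Z t) * F t).
  apply: IH => [p pZ|z' z'Z]; last by apply: hF; rewrite in_cons z'Z orbT.
  by apply: hB; rewrite /= in_cons pZ orbT.
have zB : z.1.1 \in B by apply: hB; rewrite mem_head.
apply: (@pfrac_ext (fun t => xw z.1.1 t ^ z.2 * ((1 - rel_prod Z t) * F t) +
    (1 - xw z.1.1 t ^ z.2) * F t)).
  by move=> t; rewrite /rel_prod big_cons; ring.
apply: pfrac_add; first exact: pfrac_xwz.
have [->|z20] := eqVneq z.2 0.
  by apply: pfrac_ext pfrac0 => t; rewrite expr0z subrr mul0r.
have hz := hF z (mem_head _ _) z20.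
have hn (k : nat) : pfrac (fun t => (1 - xw z.1.1 t ^+ k) * F t).
  apply: pfrac_ext (pfrac_sum (index_enum 'I_k) (fun i => pfrac_xw z.1.1 i hz)) => t.
  rewrite -mulr_suml mulrA; congr (_ * _).
  by rewrite -[1 - xw _ _ in LHS]opprB mulrN mulrC -subrX1 opprB.
case: z.2 => k; first exact: hn.
apply: pfrac_ext (pfracZ (- 1) (pfrac_xwz z.1.1 (Negz k) (hn k.+1))) => t.
have x0 := xw_neq0 t zB.
have : xw z.1.1 t ^+ k.+1 != 0 by rewrite expf_neq0.
rewrite NegzE -exprnN; move: (_ ^+ k.+1) => y y0; by field.
Qed.

Lemma in_B_cons p J : in_B (p :: J) <-> p.1 \in B /\ in_B J.
Proof.
split=> [h|[pB h] p']; last by rewrite in_cons => /orP[/eqP ->|/h].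
by split=> [|p' p'J]; apply: h; rewrite ?mem_head// in_cons p'J orbT.
Qed.

Lemma in_B_perm J J' : perm_eq J J' -> in_B J -> in_B J'.
Proof. by move=> h hJ p; rewrite -(perm_mem h); exact: hJ. Qed.

Lemma one_sub_expr (x : C) e : (1 - x ^+ e) =
  (1 - x) * (e%:R - (1 - x) * \sum_(j < e) \sum_(i < j) x ^+ i).
Proof.
have g j : 1 - x ^+ j = (1 - x) * \sum_(i < j) x ^+ i.
  by rewrite -[LHS]opprB subrX1 -mulNr opprB.
rewrite g; congr (_ * _); apply/eqP; rewrite eq_sym subr_eq -subr_eq; apply/eqP.
rewrite mulr_sumr -[e in e%:R]card_ord -sumr_const -sumrB.
by apply: eq_bigr => j _; rewrite -g; ring.
Qed.

(** By the relation, (1 - x) F with x the variable of the first factor is,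
    modulo (1 - x)^2 F, a combination of the (1 - x_i) F with x_i the other
    variables. The order of the pole in x thus increases, but those in the other
    variables decrease. *)
Lemma pfrac_relation s k Z b (e : nat) : (0 < e)%N -> in_B ((b, Some k) :: map fst Z) ->
  (forall t, rel_prod Z t = xw b t ^+ e) -> (poles Z <= s)%N ->
  (msr ((b, Some k) :: map fst Z) <= N)%N ->
  pfrac (factors ((b, Some k) :: map fst Z)).
Proof.
move=> e0; elim: s k Z => [|s IHs] k Z hB hrel pZ hN.
  by apply: (pfrac_interpolate e0) => //; apply/eqP; rewrite -leqn0.
have eK : e%:R != 0 :> C by rewrite pnatr_eq0 -lt0n.
have [bB ZB] := (in_B_cons _ _).1 hB; rewrite /= in bB.
have msrE k' : msr ((b, Some k') :: map fst Z) = msr ((b, Some k) :: map fst Z) by [].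
have key k' : pfrac (fun t => (1 - xw b t) * factors ((b, Some k') :: map fst Z) t) ->
    pfrac (factors ((b, Some k') :: map fst Z)).
  move=> hG; set F1 := factors ((b, Some k'.+1) :: map fst Z).
  have T : pfrac (fun t => (1 - rel_prod Z t) * F1 t).
    apply: pfrac_telescope => // z zZ z2.
    have pm : perm_eq ((b, Some k'.+1) :: map fst Z)
        (z.1 :: (b, Some k'.+1) :: map fst (rem z Z)).
      apply: (@perm_trans _ ((b, Some k'.+1) :: z.1 :: map fst (rem z Z))).
        by rewrite perm_cons; exact: (perm_map fst (perm_to_rem zZ)).
      by apply/permP => a /=; rewrite addnCA.
    have F1E t : F1 t = phi z.1.2 (xw z.1.1 t) *
        factors ((b, Some k'.+1) :: map fst (rem z Z)) t.
      by rewrite /F1 (factors_perm t pm); exact: factors_cons.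
    have B1 : in_B (z.1 :: (b, Some k'.+1) :: map fst (rem z Z)).
      by apply: in_B_perm pm _; apply/in_B_cons.
    have [zB B2] := (in_B_cons _ _).1 B1; have [_ B3] := (in_B_cons _ _).1 B2.
    have msr1 : msr (z.1 :: (b, Some k'.+1) :: map fst (rem z Z)) = msr ((b, Some k) :: map fst Z).
      by rewrite -(msr_perm pm).
    case: z zZ z2 pm F1E B1 zB B2 B3 msr1 => -[b1 o1] c /= zZ z2 pm F1E B1 zB B2 B3 msr1.
    move: zZ pm F1E B1 B2 B3 msr1; case: o1 => [[|j]|] zZ pm F1E B1 B2 B3 msr1.
    - apply: (@pfrac_ext (fun t => factors ((b, Some k'.+1) :: map fst (rem (b1, Some 0%N, c) Z)) t
        + - 1 * factors ((b1, None) :: (b, Some k'.+1) :: map fst (rem (b1, Some 0%N, c) Z)) t)).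
        by move=> t; rewrite F1E mulrA phi_zero [in LHS](factors_cons (b1, None)); ring.
      apply: pfrac_add; last apply: pfracZ; apply: IHN.
      + exact: B2.
      + by apply: leq_trans hN; rewrite -msr1 /msr /=; lia.
      + exact/in_B_cons.
      + by apply: leq_trans hN; rewrite -msr1 /msr /=; lia.
    - pose Z' := ((b1, Some j), c) :: rem (b1, Some j.+1, c) Z.
      have pm' : perm_eq ((b, Some k'.+1) :: map fst Z')
         ((b1, Some j) :: (b, Some k'.+1) :: map fst (rem (b1, Some j.+1, c) Z)).
        by apply/permP => a /=; rewrite addnCA.
      apply: (@pfrac_ext (factors ((b, Some k'.+1) :: map fst Z'))).
        by move=> t; rewrite F1E mulrA phi_succ (factors_perm t pm'); exact: factors_cons.
      apply: IHs.
      + apply/in_B_cons; split; first exact: bB.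
        by apply/in_B_cons; split; [exact: zB|exact: B3].
      + by move=> t; rewrite -hrel (rel_prod_perm t (perm_to_rem zZ)) /rel_prod !big_cons.
      + have := pZ; rewrite /poles (perm_big _ (perm_to_rem zZ)) /= !big_cons /= z2 /=.
        by rewrite addSn ltnS.
      + by apply: leq_trans hN; rewrite -msr1 (msr_perm pm').
    - by apply: pfrac_ext pfrac0 => t; rewrite F1E mulrA phi_none mul0r.
  pose F := factors ((b, Some k') :: map fst Z).
  apply: (@pfrac_ext (fun t => e%:R^-1 * ((1 - rel_prod Z t) * F1 t +
      \sum_(j < e) \sum_(i < j) xw b t ^+ i * ((1 - xw b t) * F t)))).
    move=> t; rewrite hrel one_sub_expr.
    set S := \sum_(j < e) _; rewrite (_ : \sum_(j < e) _ = S * ((1 - xw b t) * F t)); last first.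
      by rewrite /S mulr_suml; apply: eq_bigr => j _; rewrite mulr_suml.
    rewrite -/(F t); have -> : F t = (1 - xw b t) * F1 t.
      by rewrite /F /F1 !factors_cons /= mulrA phi_succ.
    by field.
  apply: pfracZ; apply: pfrac_add => //; apply: pfrac_sum => j; apply: pfrac_sum => i.
  exact: pfrac_xw.
elim: k hB hN msrE => [|k IHk] hB hN msrE; apply: key.
  apply: (@pfrac_ext (fun t => factors (map fst Z) t + - 1 * factors ((b, None) :: map fst Z) t)).
    by move=> t; rewrite !factors_cons [RHS]mulrA [X in _ = X * _](phi_zero (xw b t)) mulrBl mul1r mulN1r.
  apply: pfrac_add; last apply: pfracZ; apply: IHN.
  - exact: ZB.
  - by apply: leq_trans hN; rewrite /msr /=; lia.
  - exact/in_B_cons.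
  - by apply: leq_trans hN; rewrite /msr /=; lia.
apply: (@pfrac_ext (factors ((b, Some k) :: map fst Z))).
  by move=> t; rewrite !factors_cons /= mulrA (phi_succ k (xw b t)).
by apply: IHk; [apply/in_B_cons|exact: hN|move=> k'].
Qed.

End Step.

(** An integral relation between the weights, multiplied by m to get rid of the
    roots of unity. *)
Lemma relation_ex J : in_B J -> ~~ indep J -> exists Z : seq (factor * int),
  [/\ map fst Z = J, exists2 z, z \in Z & z.2 != 0 & forall t, rel_prod Z t = 1].
Proof.
move=> JB /int_relation[c c0 hc].
pose c' i : int := if insub i is Some j then c 0 j else 0.
pose Z := [seq (nth (0, 0, None) J i, c' i *+ m) | i <- iota 0 (size J)].
have [i0 ci0] : exists i, c 0 i != 0.
  apply/existsP; apply: contraNT c0; rewrite negb_exists => /forallP c0.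
  by apply/eqP/rowP => i; rewrite mxE; apply/eqP; have := c0 i; rewrite negbK.
have c'E (i : 'I_(size J)) : c' i = c 0 i by rewrite /c' valK.
exists Z; split.
- rewrite /Z -map_comp; apply: (@eq_from_nth _ (0, 0, None)); rewrite size_map size_iota// => i iJ.
  by rewrite (nth_map 0%N) ?size_iota// nth_iota.
- exists (nth (0, 0, None) J i0, c' i0 *+ m).
    by apply/mapP; exists (i0 : nat); rewrite // mem_iota ltn_ord.
  by rewrite /= c'E -mulr_natr mulf_neq0// pnatr_eq0 -lt0n.
- move=> t; rewrite /rel_prod big_map -{1}[size J]subn0 -/(index_iota 0 (size J)) big_mkord.
  have uB (i : 'I_(size J)) : (nth (0, 0, None) J i).1 \in B by apply: JB; rewrite mem_nth.
  rewrite (eq_bigr (fun i : 'I_(size J) => chi t (- (nth 0 [seq p.1.1 | p <- J] i *~ (c 0 i *+ m))))).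
    rewrite -(big_morph (chi t) (chiD t) (chi0 t)) sumrN.
    rewrite (_ : \sum_(i < size J) _ = (c *m weight_mx J) *+ m); first by rewrite hc mul0rn oppr0 chi0.
    rewrite mulmx_sum_row -sumrMnl; apply: eq_bigr => i _.
    by rewrite rowK -scaler_int intz -scalerMnl.
  move=> i _; rewrite c'E (nth_map (0, 0, None)) ?ltn_ord//= expfzMl.
  rewrite -[c 0 i *+ m]mulr_natl natz -exprz_exp -exprnP B_torsion// exp1rz mul1r.
  by rewrite -chiMz mulNrz.
Qed.

Lemma rel_prodE z Z t : rel_prod (z :: Z) t = xw z.1.1 t ^ z.2 * rel_prod Z t.
Proof. exact: big_cons. Qed.

(** A dependent family of factors is rewritten, by means of a relation between
    its weights, in terms of families with fewer factors or with fewer poles. *)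
Lemma pfrac_factors J : in_B J -> pfrac (factors J).
Proof.
move: {2}(msr J).+1 (ltnSn (msr J)) => N; elim: N J => // N IHN J hN JB.
rewrite ltnS in hN.
have [Ji|Jn] := boolP (indep J); first exact: pfrac_base.
have [Z [ZJ [z0 z0Z z02] hZ]] := relation_ex JB Jn.
(* the distinguished factor is a pole if possible *)
have [z [zZ z2 hz]] : exists z, [/\ z \in Z, z.2 != 0 &
    (exists k, z.1.2 = Some k) \/ poles Z = 0%N].
  have [/hasP[z zZ /andP[z2 zo]]|/hasPn nZ] :=
      boolP (has (fun z : factor * int => (z.2 != 0) && (z.1.2 != None)) Z).
    by exists z; split=> //; left; case: z.1.2 zo => [k|]//; exists k.
  exists z0; split=> //; right; apply/eqP; rewrite /poles sum_nat_seq_eq0.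
  apply/allP => z zZ; apply/implyP => z2; have := nZ z zZ.
  by rewrite z2 negbK => /eqP ->.
pose sg : int := - sgz z.2.
pose Z' := [seq (y.1, sg * y.2) | y <- rem z Z].
pose e := absz z.2.
have e0 : (0 < e)%N by rewrite absz_gt0.
have ZJ' : map fst Z' = map fst (rem z Z) by rewrite /Z' -map_comp.
have pm : perm_eq J (z.1 :: map fst Z').
  by rewrite -ZJ ZJ'; exact: (perm_map fst (perm_to_rem zZ)).
have JB' := in_B_perm pm JB; have [zB Z'B] := (in_B_cons _ _).1 JB'.
have hN' : (msr (z.1 :: map fst Z') <= N)%N by rewrite -(msr_perm pm).
have hrel t : rel_prod Z' t = xw z.1.1 t ^+ e.
  have -> : rel_prod Z' t = rel_prod (rem z Z) t ^ sg.
    rewrite /rel_prod /Z' big_map; elim: (rem z Z) => [|y r IH]; first by rewrite !big_nil exp1rz.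
    by rewrite !big_cons IH [RHS]expfzMl exprz_exp [y.2 * sg]mulrC.
  have := hZ t; rewrite (rel_prod_perm t (perm_to_rem zZ)) rel_prodE => h.
  have x0 : xw z.1.1 t ^ z.2 != 0 by rewrite expfz_neq0// xw_neq0.
  have -> : rel_prod (rem z Z) t = xw z.1.1 t ^ (- z.2).
    by apply: (mulfI x0); rewrite h -expfzDr ?xw_neq0// subrr expr0z.
  rewrite exprz_exp /sg mulrNN mulrC -abszEsg //.
have poleE : poles Z' = poles (rem z Z).
  rewrite /poles /Z' big_map; apply: eq_bigl => y /=.
  by rewrite mulf_eq0 oppr_eq0 sgz_eq0 (negPf z2).
apply: (@pfrac_ext (factors (z.1 :: map fst Z'))).
  by move=> t; exact/esym/factors_perm.
move: JB' hN' hrel hz; case: (z.1) => b o /= JB' hN' hrel hz.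
case: hz => [[k ok]|p0].
  rewrite ok in JB' hN' *.
  by apply: (pfrac_relation (N := N) _ e0 JB' hrel (leqnn _) hN') => J' J'B hJ'; exact: IHN.
apply: (pfrac_interpolate (N := N) _ e0 JB' hrel _ hN').
  by move=> J' J'B hJ'; exact: IHN.
rewrite poleE; move/eqP: p0; rewrite /poles (perm_big _ (perm_to_rem zZ)) big_cons z2 /=.
by rewrite addn_eq0 => /andP[_ /eqP].
Qed.

End PartialFractions.

(** * Lattice points in cells of rational affine subspaces *)

Section Norms.
Context {R : realType} {n : nat}.
Implicit Types (x u : 'rV[R]_n).

Lemma coord_norm x i : `|x 0 i| <= `|x|.
Proof. by rewrite [leRHS]/Num.norm /= mx_normrE; apply/bigmax_geP; right; exists (0, i). Qed.

Lemma norm_coord x K : 0 <= K -> (forall i, `|x 0 i| <= K) -> `|x| <= K.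
Proof.
move=> K0 h; rewrite [leLHS]/Num.norm /= mx_normrE; apply/bigmax_leP; split=> //.
by move=> [i j] _ /=; rewrite ord1.
Qed.

Lemma pairing_norm u : exists2 K, 0 <= K & forall x, `|pairing x u| <= K * `|x|.
Proof.
exists (\sum_i `|u 0 i|) => [|x]; first exact: sumr_ge0.
rewrite /pairing mxE mulr_suml; apply: le_trans (ler_norm_sum _ _ _) _.
apply: ler_sum => i _; rewrite mxE normrM mulrC.
by rewrite ler_wpM2l// coord_norm.
Qed.

Lemma mulmx_norm (A : 'M[R]_n) : exists2 K, 0 <= K & forall x, `|x *m A| <= K * `|x|.
Proof.
exists (\sum_i \sum_j `|A j i|) => [|x]; first by apply: sumr_ge0 => i _; apply: sumr_ge0.
apply: norm_coord => [|i].
  by rewrite mulr_ge0//; apply: sumr_ge0 => i _; apply: sumr_ge0.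
rewrite mxE; apply: le_trans (ler_norm_sum _ _ _) _.
apply: (@le_trans _ _ ((\sum_j `|A j i|) * `|x|)).
  rewrite mulr_suml; apply: ler_sum => j _.
  by rewrite normrM mulrC ler_wpM2l// coord_norm.
rewrite ler_wpM2r// [leRHS](bigD1 i)//= lerDl.
by apply: sumr_ge0 => k _; apply: sumr_ge0.
Qed.

Lemma pairingDl (x y u : 'rV[R]_n) : pairing (x + y) u = pairing x u + pairing y u.
Proof. by rewrite /pairing mulmxDl mxE. Qed.

Lemma pairingNl (x u : 'rV[R]_n) : pairing (- x) u = - pairing x u.
Proof. by rewrite /pairing mulNmx mxE. Qed.

Lemma pairingBl (x y u : 'rV[R]_n) : pairing (x - y) u = pairing x u - pairing y u.
Proof. by rewrite pairingDl pairingNl. Qed.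

Lemma pairing0l (u : 'rV[R]_n) : pairing 0 u = 0.
Proof. by rewrite /pairing mul0mx mxE. Qed.

End Norms.

Lemma sub_add_sub (V : zmodType) (a b c d : V) : a - b + c - d = (a - d) + (c - b).
Proof. by rewrite -addrA addrACA [RHS]addrACA [- b - d]addrC. Qed.

Section Cells.
Context {R : realType} {n : nat} (D : 'M[R]_n).
Hypothesis D_unit : D \in unitmx.
Notation M := 'rV[int]_n.
Notation E := 'rV[R]_n.
Local Notation emb := (emb D).
Implicit Types (r : {vspace E}) (c : E) (z w : M).

Lemma emb_norm_box : exists2 K : nat, (0 < K)%N & forall (B : nat) z,
  `|emb z| <= B%:R -> inbox (K * B) z.
Proof.
have [K K0 hK] := mulmx_norm (invmx D).
exists (Num.truncn K).+1 => // B z zB i.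
have : `|(z ord0 i)%:~R : R| <= (Num.truncn K).+1%:R * B%:R.
  have := coord_norm (map_mx intr z : E) i; rewrite mxE => /le_trans; apply.
  rewrite -[map_mx _ z](mulmxK D_unit) -/(emb z); apply: le_trans (hK _) _.
  by apply: ler_pM => //; rewrite ltW// truncnS_gt.
by rewrite -intr_norm -abszE -natrM -pmulrn ler_nat.
Qed.

Fixpoint comb (ws : seq M) (j : nat -> int) : M :=
  if ws is w :: ws' then w *~ j 0%N + comb ws' (fun i => j i.+1) else 0.

Lemma emb_mem_span ws w : w \in ws -> emb w \in span D ws.
Proof. by move=> h; apply/memv_span/map_f. Qed.

Lemma comb_span ws j : emb (comb ws j) \in span D ws.
Proof.
elim: ws j => [|w ws IH] j /=; first by rewrite emb0 mem0v.
rewrite embD embMz; apply: rpredD; first by apply: rpredMz; apply: emb_mem_span; exact: mem_head.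
have := IH (fun i => j i.+1); apply/subvP/sub_span => y /mapP[a aw ->].
by apply: map_f; rewrite in_cons aw orbT.
Qed.

Lemma span_round ws : exists2 K, 0 <= K & forall x, x \in span D ws ->
  exists j, `|x - emb (comb ws j)| <= K.
Proof.
elim: ws => [|w ws [K K0 IH]].
  exists 0 => // x; rewrite /span span_nil memv0 => /eqP ->; exists (fun=> 0).
  by rewrite emb0 subr0 normr0.
exists (`|emb w| + K) => [|x]; first by rewrite addr_ge0.
rewrite /span /= span_cons => /memv_addP[_ /vlineP[t ->] [y /IH[j hj] ->]].
exists (fun i => if i is i'.+1 then j i' else Num.floor t) => /=.
rewrite embD embMz opprD addrACA; apply: le_trans (ler_normD _ _) _.
apply: lerD => //; rewrite -scaler_int -scalerBl normrZ ler_piMl//.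
rewrite ger0_norm ?subr_ge0 ?floor_le_tmp//.
by rewrite lerBlDl ltW// -[1 in X in _ < X]/(1%:~R) -intrD floorD1_gt.
Qed.

Lemma comb_norm ws (k : nat) : exists2 K, 0 <= K & forall j,
  (forall i, (i < size ws)%N -> 0 <= j i <= k%:Z) -> `|emb (comb ws j)| <= K.
Proof.
elim: ws => [|w ws [K K0 IH]]; first by exists 0 => // j _; rewrite emb0 normr0.
exists (`|emb w| * k%:R + K) => [|j hj /=]; first by rewrite addr_ge0 ?mulr_ge0.
rewrite embD embMz; apply: le_trans (ler_normD _ _) _; apply: lerD; last first.
  by apply: IH => i iw; exact: (hj i.+1).
rewrite -scaler_int normrZ mulrC ler_wpM2l//.
have /andP[j0 jk] := hj 0%N (ltn0Sn _); case: (j 0%N) j0 jk => // j0 _ jk.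
by rewrite normr_nat ler_nat.
Qed.

Lemma killed_box (K : comNzRingType) (k : nat) (ws : seq M) (h : M -> K) (x : M) :
  (forall w, w \in ws -> killed w k h) ->
  (forall j, (forall i, (i < size ws)%N -> 0 <= j i <= k%:Z) -> h (x + comb ws j) = 0) ->
  forall j, h (x + comb ws j) = 0.
Proof.
elim: ws x => [|w ws IH] x hk h0 j; first exact: h0.
rewrite /= addrCA addrC; apply: (@killed_ray_box _ _ w k h) => [|i ik].
  by apply: hk; exact: mem_head.
rewrite addrAC; apply: IH => [w' w'ws|j' hj']; first by apply: hk; rewrite in_cons w'ws orbT.
rewrite -addrA pmulrn.
have := h0 (fun t => if t is t'.+1 then j' t' else i%:Z) => /=; apply.
by move=> [_|t tw]; [rewrite /= lez_nat ltnW|exact: hj'].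
Qed.

Definition cell r c (e : R) (x : E) := x - c \in r /\ `|x - c| <= e.

Definition zscale (l : nat) z : E := l%:R^-1 *: emb z.

Lemma zscaleE l z : zscale l z = l%:R^-1 *: emb z.
Proof. by []. Qed.

Lemma zscale_cell r c e l z : (0 < l)%N ->
  cell r c e (zscale l z) <-> emb z - l%:R *: c \in r /\ `|emb z - l%:R *: c| <= e * l%:R.
Proof.
move=> l0; have lR : l%:R != 0 :> R by rewrite pnatr_eq0 -lt0n.
have -> : emb z - l%:R *: c = l%:R *: (zscale l z - c).
  by rewrite /zscale scalerBr scalerA mulfV// scale1r.
rewrite /cell normrZ normr_nat [_ * `|_|]mulrC ler_pM2r ?ltr0n// rpredZeq (negPf lR) /=.
by [].
Qed.

(** Far from the origin, the cone over a cell contains translates of arbitrarily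
    large boxes, from which a solution of difference equations along vectors
    spanning r propagates. *)
Lemma slice_unique (K : comNzRingType) (k : nat) (ws : seq M) r c e (f : M -> nat -> K) :
  (r <= span D ws)%VS -> (forall w, w \in ws -> emb w \in r) -> 0 < e ->
  (forall w l, w \in ws -> (0 < l)%N -> killed w k (f ^~ l)) ->
  (exists l0, forall l z, (l0 <= l)%N -> cell r c e (zscale l z) -> f z l = 0) ->
  exists l0, forall l z, (l0 <= l)%N -> emb z - l%:R *: c \in r -> f z l = 0.
Proof.
move=> rw wr e0 hk [l0 h0].
have [K1 K10 h1] := span_round ws; have [K2 K20 h2] := comb_norm ws k.
exists (maxn l0 (Num.truncn ((K1 + K2) / e)).+1) => l z.
rewrite geq_max => /andP[ll0 ll1] zr.
have l_gt0 : (0 < l)%N by exact: leq_ltn_trans ll1.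
have [j hj] := h1 _ (subvP rw _ zr).
rewrite -[z](subrK (comb ws j)).
apply: (@killed_box _ k ws (f ^~ l)) => [w wws|j' hj']; first exact: hk.
apply: h0 => //; apply/zscale_cell => //; split.
  have s1 : forall i, emb (comb ws i) \in r.
    move=> i; have := comb_span ws i; apply/subvP; apply/span_subvP => _ /mapP[w /wr + ->].
    by [].
  by rewrite embD embB sub_add_sub rpredD// rpredB.
rewrite embD embB addrAC [emb z - _ - _]addrAC.
apply: le_trans (ler_normD _ _) _; apply: (@le_trans _ _ (K1 + K2)).
  apply: lerD; last exact: h2.
  exact: hj.
rewrite -ler_pdivrMl// mulrC; apply: ltW; apply: lt_le_trans (truncnS_gt _) _.
by rewrite ler_nat.
Qed.

(** Rounding the coordinates of m c, for m large, gives a lattice point close to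
    it relatively to m. *)
Lemma rational_cell ws c z0 l0 e : 0 < e -> emb z0 - l0%:R *: c \in span D ws ->
  (0 < l0)%N -> exists m w, (0 < m)%N /\ cell (span D ws) c e (zscale m w).
Proof.
move=> e0 z0r l0_gt0; have [K1 K10 h1] := span_round ws.
pose m := (Num.truncn (K1 / e)).+1.
have /h1[j hj] : m%:R *: (l0%:R *: c - emb z0) \in span D ws.
  by rewrite rpredZ// -opprB rpredN.
have lm0 : (0 < l0 * m)%N by rewrite muln_gt0 l0_gt0.
exists (l0 * m)%N, (z0 *+ m + comb ws j); split=> //; apply/zscale_cell => //.
have E1 : emb (z0 *+ m + comb ws j) - (l0 * m)%:R *: c =
    - (m%:R *: (l0%:R *: c - emb z0) - emb (comb ws j)).
  rewrite embD embMn -scaler_nat scalerBr scalerA [(_ * m)%N]mulnC natrM.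
  by rewrite !opprB addrA [in RHS](addrC (emb (comb ws j))).
rewrite E1; split.
  by rewrite rpredN rpredB ?comb_span// rpredZ// -opprB rpredN.
rewrite normrN; apply: le_trans hj _; rewrite -ler_pdivrMl// mulrC.
apply: ltW; apply: lt_le_trans (truncnS_gt _) _.
by rewrite ler_nat leq_pmull.
Qed.

(** The direction dominates the starting point: dividing by the level, the ray
    converges to a point well inside the cell. *)
Lemma cell_ray r c e l z m w : 0 < e -> (0 < l)%N -> (0 < m)%N ->
  emb z - l%:R *: c \in r -> cell r c (e / 2) (zscale m w) ->
  exists J : nat, forall j, (J <= j)%N -> cell r c e (zscale (l + m * j) (z + w *+ j)).
Proof.
move=> e0 l_gt0 m0 zr /(zscale_cell _ _ _ _ m0)[wr hw].
pose d := `|emb z - l%:R *: c|; have e20 : 0 < e / 2 by rewrite divr_gt0.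
exists (Num.truncn (d / (e / 2))).+1 => j jd.
have lj0 : (0 < l + m * j)%N by rewrite addn_gt0 l_gt0.
apply/zscale_cell => //.
have E1 : emb (z + w *+ j) - (l + m * j)%:R *: c =
   (emb z - l%:R *: c) + (emb w - m%:R *: c) *+ j.
  rewrite embD embMn natrD natrM scalerDl opprD addrACA mulrnBl; congr (_ + (_ - _)).
  by rewrite mulrC -scalerA scaler_nat.
rewrite E1; split; first by rewrite rpredD// rpredMn.
apply: le_trans (ler_normD _ _) _; rewrite normrMn -/d.
have jd' : d <= e / 2 * j%:R.
  rewrite -ler_pdivrMl// mulrC; apply: ltW; apply: lt_le_trans (truncnS_gt _) _.
  by rewrite ler_nat.
have : `|emb w - m%:R *: c| *+ j <= e / 2 * m%:R * j%:R.
  by rewrite -[leLHS]mulr_natr ler_wpM2r.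
rewrite natrD natrM; move: (_ *+ j) => a ha.
have jm : j%:R <= m%:R * j%:R :> R by rewrite -natrM ler_nat leq_pmull.
have l0' : 0 <= l%:R :> R by [].
by nra.
Qed.

(** Any lattice point over the affine subspace starts a ray which enters the
    cone over the cell for good. *)
Lemma qp_slice_unique (K : comNzRingType) ws c e l0 (H : (M * int)%type -> K) :
  qpfun H -> 0 < e ->
  (forall l z, (l0 <= l)%N -> cell (span D ws) c e (zscale l z) -> H (z, l%:Z) = 0) ->
  forall l z, (0 < l)%N -> emb z - l%:R *: c \in span D ws -> H (z, l%:Z) = 0.
Proof.
move=> qH e0 h l z l_gt0 zr.
have e20 : 0 < e / 2 by rewrite divr_gt0.
have [m [w [m0 hw]]] := rational_cell e20 zr l_gt0.
have [J hJ] := cell_ray e0 l_gt0 m0 zr hw.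
apply: (@qpfun_ray _ _ H (w, m%:Z) _ (maxn l0 J) qH) => j.
rewrite geq_max => /andP[jl0 jd].
have -> : (z, l%:Z) + (w, m%:Z) *+ j = (z + w *+ j, (l + m * j)%N%:Z).
  by rewrite pmulrn pairMzE pairDE -!pmulrn PoszD PoszM -mulr_natr natz.
apply: h (hJ _ jd).
by apply: leq_trans jl0 _; rewrite (leq_trans _ (leq_addl _ _))// leq_pmull.
Qed.

Section CellQp.
Context {K : comNzRingType} (r : {vspace E}).

(** The subcell is to avoid the walls of f; the shift kappa makes the notion
    stable under translations. *)
Definition cellqp (f : M -> nat -> K) := forall c e kappa, 0 < e ->
  exists c' e' G l0, [/\ 0 < e', forall x, cell r c' e' x -> cell r c e x, qpfun G &
    forall l z, (0 < l)%N -> (l0 <= l)%N -> cell r c' e' (zscale l z) ->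
      f (z + kappa) l = G (z, l%:Z)].

Lemma cellqp_ext f g : (forall z l, (0 < l)%N -> f z l = g z l) -> cellqp f -> cellqp g.
Proof.
move=> fg hf c e k e0; have [c' [e' [G [l0 [h1 h2 h3 h4]]]]] := hf c e k e0.
by exists c', e', G, l0; split=> // l z l_gt0 ll0 hz; rewrite -fg// h4.
Qed.

Lemma cellqpD f g : cellqp f -> cellqp g -> cellqp (fun z l => f z l + g z l).
Proof.
move=> hf hg c e k e0; have [c1 [e1 [G1 [l1 [e10 s1 q1 h1]]]]] := hf c e k e0.
have [c2 [e2 [G2 [l2 [e20 s2 q2 h2]]]]] := hg c1 e1 k e10.
exists c2, e2, (fun x => G1 x + G2 x), (maxn l1 l2); split=> //.
- by move=> x /s2 /s1.
- exact: qpfunD.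
- move=> l z l0; rewrite geq_max => /andP[ll1 ll2] hz.
  by rewrite h1 ?h2//; exact: s2.
Qed.

Lemma cellqp_mul_qp (P : (M * int)%type -> K) f : qpfun P -> cellqp f ->
  cellqp (fun z l => P (z, l%:Z) * f z l).
Proof.
move=> qP hf c e k e0; have [c1 [e1 [G1 [l1 [e10 s1 q1 h1]]]]] := hf c e k e0.
exists c1, e1, (fun x => P (x + (k, 0)) * G1 x), l1; split=> //.
  by apply: qpfunM => //; exact: qpfun_shift.
by move=> l z l0 ll1 hz; rewrite h1// pairDE addr0.
Qed.

Lemma cellqp_shift f w : cellqp f -> cellqp (fun z l => f (z + w) l).
Proof.
move=> hf c e k e0; have [c1 [e1 [G1 [l1 [e10 s1 q1 h1]]]]] := hf c e (k + w) e0.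
by exists c1, e1, G1, l1; split=> // l z l0 ll1 hz; rewrite -addrA h1.
Qed.

Lemma zlin_real (a : zlin (M * int)%type) : exists (u : E) (d : R), forall z (l : nat),
  (a (z, l%:Z))%:~R = pairing (emb z) u + l%:R * d.
Proof.
pose v : 'rV[R]_n := \row_i (a (delta_mx 0 i, 0))%:~R.
exists (v *m (invmx D)^T), (a (0, 1))%:~R => z l.
have -> : pairing (emb z) (v *m (invmx D)^T) = \sum_i (z 0 i)%:~R * v 0 i.
  rewrite /pairing /emb trmx_mul trmxK mulmxA mulmxK// mxE.
  by apply: eq_bigr => i _; rewrite !mxE.
have -> : (z, l%:Z) = \sum_i (delta_mx 0 i, 0) *~ z 0 i + (0, 1) *~ l%:Z.
  rewrite pairMzE mul0rz -[in RHS]mulrzl mulr1 intz.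
  have -> : \sum_i (delta_mx 0 i, 0) *~ z 0 i = (z, 0) :> M * int.
    rewrite [in RHS](row_sum_delta z).
    elim/big_rec2: _ => // i y1 y2 _ ->.
    by rewrite pairMzE pairDE mul0rz addr0 -scaler_int intz.
  by rewrite pairDE addr0 add0r.
rewrite zvalD zvalMz rmorphD /= rmorphM /=; congr (_ + _).
rewrite (big_morph a (zvalD a) (zval0 a)) rmorph_sum /=; apply: eq_bigr => i _.
by rewrite zvalMz rmorphM mxE.
Qed.

Lemma subcell c c' e : cell r c (e / 2) c' -> 0 < e ->
  forall e', e' <= e / 2 -> forall x, cell r c' e' x -> cell r c e x.
Proof.
move=> [c1 c2] e0 e' ee' x [x1 x2]; split.
  by rewrite -[x](subrK c') -addrA rpredD.
rewrite -[x](subrK c') -addrA; apply: le_trans (ler_normD _ _) _.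
by rewrite [e](splitr e) lerD//; apply: le_trans ee'.
Qed.

(** A wall either contains the cone over the cell, where its sign is then decided
    by the shift, or misses a subcell, where it has a constant sign for l large. *)
Lemma cellqp_pwq F : pwq F -> cellqp (fun z l => F (z, l%:Z)).
Proof.
elim=> [f qf|a f _ IH|f g _ IH1 _ IH2].
- move=> c e k e0; exists c, e, (fun x => f (x + (k, 0))), 0%N; split=> //.
    exact: qpfun_shift.
  by move=> l z _ _ _; rewrite pairDE addr0.
- move=> c0 e0 k e00; have [c [e [G [l1 [e_gt0 s1 q1 h1]]]]] := IH c0 e0 k e00.
  have [u [d hud]] := zlin_real a; have [Ku Ku0 hKu] := pairing_norm u.
  pose v x := pairing x u + d.
  have aE z l : (0 < l)%N -> (a (z, l%:Z))%:~R = l%:R * v (zscale l z).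
    move=> l0; rewrite hud /v /zscale pairingZl mulrDr mulrA mulfV ?mul1r//.
    by rewrite pnatr_eq0 -lt0n.
  have aS z l : a (z + k, l%:Z) = a (z, l%:Z) + a (k, 0).
    by rewrite -zvalD pairDE addr0.
  have [[c' [hc' vc']]|nv] := pselect (exists c', cell r c (e / 2) c' /\ v c' != 0).
  + pose e' := Num.min (e / 2) (`|v c'| / (2 * (Ku + 1))).
    have e'0 : 0 < e' by rewrite lt_min !divr_gt0 ?mulr_gt0 ?normr_gt0 ?ltr_wpDl.
    have s2 : forall x, cell r c' e' x -> cell r c e x.
      by apply: (subcell hc' e_gt0); rewrite ge_min lexx.
    have vx x : cell r c' e' x -> `|v x - v c'| <= `|v c'| / 2.
      move=> [_ x2]; rewrite /v opprD addrACA subrr addr0 -pairingBl.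
      apply: le_trans (hKu _) _; apply: (@le_trans _ _ ((Ku + 1) * e')).
        by apply: ler_pM => //; rewrite lerDl.
      apply: (@le_trans _ _ ((Ku + 1) * (`|v c'| / (2 * (Ku + 1))))).
        by rewrite ler_wpM2l ?addr_ge0// ge_min lexx orbT.
      have K10 : Ku + 1 != 0 by rewrite gt_eqF// ltr_wpDl.
      by rewrite le_eqVlt; apply/orP; left; apply/eqP; rewrite -/(v c'); field.
    pose l2 := (Num.truncn (`|(a (k, 0))%:~R : R| / (`|v c'| / 2))).+1.
    exists c', e', (if 0 < v c' then G else fun=> 0), (maxn l1 l2); split=> //.
    * by move=> x /s2 /s1.
    * by case: ifP => // _; exact: qpfun_cst.
    * move=> l z l0; rewrite geq_max => /andP[ll1 ll2] hz.
      have v20 : 0 < `|v c'| / 2 by rewrite divr_gt0 ?normr_gt0.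
      have hk : `|(a (k, 0))%:~R : R| < l%:R * (`|v c'| / 2).
        rewrite -ltr_pdivrMr//; apply: lt_le_trans (truncnS_gt _) _.
        by rewrite ler_nat.
      have hx := vx _ hz; have ae := aE z l l0.
      have lR : 0 < l%:R :> R by rewrite ltr0n.
      have -> : (0 <= a (z + k, l%:Z)) = (0 < v c').
        rewrite -(ler0z R) aS rmorphD /= ae.
        move: hx hk; rewrite ler_norml ltr_norml => /andP[x1 x2] /andP[k1 k2].
        have [vp|vn|v0] := ltgtP 0 (v c'); last by rewrite -v0 eqxx in vc'.
          by rewrite gtr0_norm// in x1 k1; apply/idP; nra.
        by rewrite ltr0_norm// in x2 k2; apply/negbTE; rewrite -ltNge; nra.
      by case: ifP => // _; rewrite h1//; exact: s2.
  + exists c, (e / 2), (if 0 <= a (k, 0) then G else fun=> 0), l1.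
    have s2 : forall x, cell r c (e / 2) x -> cell r c e x.
      by move=> x [x1 x2]; split=> //; apply: le_trans x2 _; rewrite ler_pdivrMr// ler_pMr// ler1n.
    split; first by rewrite divr_gt0.
    * by move=> x /s2 /s1.
    * by case: ifP => // _; exact: qpfun_cst.
    * move=> l z l0 ll1 hz.
      have a0 : a (z, l%:Z) = 0.
        apply/eqP; rewrite -(intr_eq0 R) aE// mulf_eq0; apply/orP; right.
        by apply: contra_notT nv => vz; exists (zscale l z).
      rewrite aS a0 add0r; case: ifP => // _; rewrite h1//; exact: s2.
- exact: cellqpD.
Qed.

Lemma cell_norm c e x : cell r c e x -> `|x| <= `|c| + e.
Proof. by move=> [_ h]; rewrite -[x](subrKC c); apply: le_trans (ler_normD _ _) _; rewrite lerD2l. Qed.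

Lemma zscale_inbox (B : R) : exists K : nat, forall l z, (0 < l)%N -> `|zscale l z| <= B ->
  inbox (K * l) z.
Proof.
have [N N0 hN] := emb_norm_box; exists (N * (Num.truncn B).+1)%N => l z l0 hz.
rewrite -mulnA; apply: hN.
have -> : emb z = l%:R *: zscale l z.
  by rewrite /zscale scalerA mulfV ?scale1r// pnatr_eq0 -lt0n.
rewrite normrZ normr_nat mulnC natrM ler_wpM2l//.
by apply: le_trans hz _; rewrite ltW// truncnS_gt.
Qed.

Lemma cellqp_lpwq f : lpwq f -> cellqp f.
Proof.
move=> hf c e k e0.
have [B hB] := zscale_inbox (`|c| + e); have [Bk hk] := inbox_ex k.
have [F pF hF] := hf (B + Bk)%N.
have [c' [e' [G [l0 [h1 h2 h3 h4]]]]] := cellqp_pwq pF c k e0.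
exists c', e', G, l0; split=> // l z l_gt0 ll0 hz; rewrite hF ?h4//.
rewrite mulnDl; apply: inboxD; last by apply: inboxW hk; rewrite leq_pmulr.
by apply: hB => //; apply: cell_norm; apply: h2; exact: hz.
Qed.

End CellQp.

End Cells.

(** * Convolutions of locally piecewise quasi-polynomial functions *)

Section FixedPolarization.
Context {R : realType} {n : nat} (D : 'M[R]_n).
Hypothesis D_unit : D \in unitmx.
Notation M := 'rV[int]_n.
Notation C := R[i].
Local Notation emb := (emb D).

Variable t : 'rV[R]_n.
Notation tau := (fun x : M => pairing (emb x) t).

Lemma tau_additive : additive_map tau.
Proof. by move=> x y; rewrite embD pairingDl. Qed.

Lemma one_step (F f : M -> C) b (N : nat) z : (forall z, F z = b.2 * F (z - b.1) + f z) ->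
  F z = \sum_(k < N) b.2 ^+ k * f (z - b.1 *+ k) + b.2 ^+ N * F (z - b.1 *+ N).
Proof.
move=> h; elim: N => [|N IH]; first by rewrite big_ord0 add0r expr0 mul1r mulr0n subr0.
rewrite {1}IH big_ord_recr /= -[RHS]addrA; congr (_ + _).
by rewrite [F (z - b.1 *+ N)]h exprS mulrSr opprD addrA; ring.
Qed.

Lemma one_step_neg (F f : M -> C) b (N : nat) z : b.2 != 0 ->
  (forall z, F z = b.2 * F (z - b.1) + f z) ->
  F z = f z - \sum_(k < N) b.2 ^- k * f (z + b.1 *+ k) + b.2 ^- N * (b.2 * F (z + b.1 *+ N - b.1)).
Proof.
move=> b0 h; elim: N => [|N IH].
  by rewrite big_ord0 subr0 expr0 invr1 mul1r mulr0n addr0 addrC -h.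
rewrite {1}IH big_ord_recr /= mulrSr addrA addrK.
have -> : b.2 * F (z + b.1 *+ N - b.1) = F (z + b.1 *+ N) - f (z + b.1 *+ N).
  by rewrite [F (z + b.1 *+ N)]h addrK.
have bN : b.2 ^+ N != 0 by rewrite expf_neq0.
rewrite exprS; move: (\sum_(k < N) _) (b.2 ^+ N) bN => S u u0; by field; rewrite u0 b0.
Qed.

Lemma cvf_tau_ge (h : M -> C) B (c : R) :
  (forall y, h y != 0 -> c <= tau y) ->
  forall z, cvf h (fun=> pf tau B) z != 0 -> c <= tau z.
Proof.
move=> hc z; apply: contraNT; rewrite -ltNge => zc.
rewrite /cvf fsbig1// => y _; apply/eqP; apply: contraTT zc.
rewrite mulf_eq0 negb_or => /andP[/hc hy /(pf_ge0 tau_additive)].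
by rewrite (additive_mapB _ _ tau_additive) subr_ge0 -leNgt; exact: le_trans.
Qed.

Lemma tau_box (K : nat) : exists2 c, 0 <= c & forall z (l : nat), inbox (K * l) z ->
  `|tau z| <= c * l%:R.
Proof.
have [K1 K10 h1] := pairing_norm t; have [K2 K20 h2] := mulmx_norm D.
exists (K1 * (K2 * K%:R)) => [|z l hz]; first by rewrite !mulr_ge0.
apply: le_trans (h1 _) _; rewrite -mulrA ler_wpM2l//.
apply: le_trans (h2 _) _; rewrite -mulrA ler_wpM2l// -natrM.
apply: norm_coord => // i; rewrite mxE -intr_norm -abszE -pmulrn ler_nat.
exact: hz.
Qed.

(** The weights of B are added one at a time; within a given cone, the
    convolution with a geometric series is a sum over a range bounded linearly
    in the level, as the support of h and that of pf face each other. *)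
Lemma conv_lpwq (h : M -> nat -> C) B (c : R) (m : nat) : (0 < m)%N ->
  (forall b, b \in B -> tau b.1 != 0) -> (forall b, b \in B -> b.2 ^+ m = 1) ->
  (forall l y, (0 < l)%N -> h y l != 0 -> - (c * l%:R) <= tau y) ->
  lpwq h -> lpwq (fun z l => cvf (h ^~ l) (fun=> pf tau B) z).
Proof.
move=> m0 hB hu hc hp; elim: B hB hu => [|b B IH] hB hu.
  apply: lpwq_ext hp => z l _; rewrite /cvf (@fsumTE _ _ [:: z])//.
    by rewrite big_seq1 /= subrr eqxx mulr1.
  move=> y; have [->|yz] := eqVneq y z; first by rewrite mem_head.
  by rewrite mulf_eq0 /= subr_eq0 [z == y]eq_sym (negPf yz) eqxx orbT.
have b0 : b.2 != 0.
  have := hu b (mem_head _ _); apply: contra_eq_neq => ->.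
  by rewrite expr0n gtn_eqF//= eq_sym oner_eq0.
have tb := hB b (mem_head _ _).
have {}IH : lpwq (fun z l => cvf (h ^~ l) (fun=> pf tau B) z).
  by apply: IH => b' b'B; [apply: hB|apply: hu]; rewrite in_cons b'B orbT.
pose F l := cvf (h ^~ l) (fun=> pf tau (b :: B)).
pose f l := cvf (h ^~ l) (fun=> pf tau B).
have Ff l z : (0 < l)%N -> F l z = b.2 * F l (z - b.1) + f l z.
  move=> l0.
  have sup : supported_on (fun y => - (c * l%:R) <= tau y) (h ^~ l).
    by move=> y; exact: hc.
  have lf : locally_finite (fun y => - (c * l%:R) <= tau y) (fun=> pf tau (b :: B)).
    move=> x; have [S hS] := pf_finite (tau x + c * l%:R) tau_additive hB.
    exists [seq x - s | s <- S] => y yc nz; apply/mapP; exists (x - y); last by rewrite subKr.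
    apply: hS nz; rewrite (additive_mapB _ _ tau_additive) lerD2l.
    by rewrite lerNl.
  have [_ nE] := nab_cvf b sup lf.
  have := congr1 (@^~ z) nE.
  rewrite (_ : (fun y : M => nab b (pf tau (b :: B))) = fun=> pf tau B); last first.
    by apply/funext => y; rewrite nab_pf//; exact: tau_additive.
  by rewrite /nab -/(F l) -/(f l) => <-; rewrite addrCA subrr addr0.
apply: lpwq_local => K; have [ct ct0 hct] := tau_box K.
have hFge l z : (0 < l)%N -> F l z != 0 -> - (c * l%:R) <= tau z.
  by move=> l0; apply: cvf_tau_ge => y; exact: hc.
pose c' := (Num.truncn ((ct + `|c| + 1 + `|tau b.1|) / `|tau b.1|)).+1.
have c'P : ct + `|c| + 1 + `|tau b.1| < `|tau b.1| * c'%:R.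
  by rewrite mulrC -ltr_pdivrMr ?normr_gt0// truncnS_gt.
have big l z : (0 < l)%N -> inbox (K * l) z ->
    tau z - `|tau b.1| *+ (c' * l) + `|tau b.1| < - (c * l%:R).
  move=> l0 /hct; rewrite ler_norml => /andP[_ zc].
  have l1 : 1 <= l%:R :> R by rewrite ler1n.
  rewrite -[_ *+ (c' * l)]mulr_natr natrM mulrA.
  have cc : - `|c| <= c <= `|c| by rewrite -ler_norml.
  have tb0 := normr_ge0 (tau b.1).
  move: c'P zc cc tb0; move: (`|tau b.1|) (`|c|) (tau z) => T cn tz c'P zc /andP[cc1 cc2] T0.
  by nra.
have [tbp|tbn|tb0] := ltgtP 0 (tau b.1); last by rewrite -tb0 eqxx in tb.
- pose ck := zlin_snd (M * int)%type.
  exists (fun z l => \sum_(k < (c' * l)%N) b.2 ^ (ck ((z, l%:Z), k%:Z)) * f l (z - b.1 *+ k)).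
    apply: lpwq_ext (@lpwq_sum_ray _ _ _ (fun x => b.2 ^ (ck x)) (- b.1) c' IH _) => [z l l0|].
      by apply: eq_bigr => k _; rewrite mulNrn.
    by apply: qpfun_exp m0 _; apply: hu; exact: mem_head.
  move=> z l l0 zK; rewrite -/(F l z) (one_step (c' * l) z (fun z => Ff l z l0)).
  have -> : F l (z - b.1 *+ (c' * l)) = 0.
    apply/eqP; apply/negPn/negP => /(hFge l _ l0); apply/negP; rewrite -ltNge.
    rewrite (additive_mapB _ _ tau_additive) (additive_mapMn _ _ tau_additive).
    by apply: le_lt_trans (big l z l0 zK); rewrite gtr0_norm// lerDl ltW.
  by rewrite mulr0 addr0.
- pose ck := zlin_scale (- 1) (zlin_snd (M * int)%type).
  exists (fun z l => f l z - \sum_(k < (c' * l)%N) b.2 ^ (ck ((z, l%:Z), k%:Z)) * f l (z + b.1 *+ k)).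
    apply: lpwqD => //; apply: lpwqN.
    apply: (@lpwq_sum_ray _ _ _ (fun x => b.2 ^ (ck x)) b.1 c' IH).
    by apply: qpfun_exp m0 _; apply: hu; exact: mem_head.
  move=> z l l0 zK; rewrite -/(F l z) (one_step_neg (c' * l) z b0 (fun z => Ff l z l0)).
  have -> : F l (z + b.1 *+ (c' * l) - b.1) = 0.
    apply/eqP; apply/negPn/negP => /(hFge l _ l0); apply/negP; rewrite -ltNge.
    rewrite (additive_mapB _ _ tau_additive) tau_additive (additive_mapMn _ _ tau_additive).
    by have := big l z l0 zK; rewrite ltr0_norm// mulNrn opprK.
  rewrite !mulr0 addr0; congr (_ - _); apply: eq_bigr => k _; congr (_ * _).
  by rewrite /= mulN1r exprnN.
Qed.

End FixedPolarization.

Lemma transversal_ex (T : eqType) (e : rel T) (S : seq T) : reflexive e -> symmetric e ->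
  transitive e -> exists S', [/\ {subset S' <= S}, uniq S',
    forall x, x \in S -> exists2 y, y \in S' & e x y &
    forall x y, x \in S' -> y \in S' -> e x y -> x = y].
Proof.
move=> er es et; elim: S => [|x S [S' [h1 h2 h3 h4]]]; first by exists [::].
have [/hasP[y yS' xy]|/hasPn nx] := boolP (has (e x) S').
  exists S'; split=> // [z /h1 zS|z]; first by rewrite in_cons zS orbT.
  by rewrite in_cons => /orP[/eqP ->|/h3//]; exists y.
exists (x :: S'); split=> /=.
- by move=> z; rewrite !in_cons => /orP[->//|/h1 ->]; rewrite orbT.
- by rewrite h2 andbT; apply/negP => /nx; rewrite er.
- move=> z; rewrite in_cons => /orP[/eqP ->|/h3[y yS' zy]].
    by exists x; rewrite ?mem_head.
  by exists y; rewrite // in_cons yS' orbT.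
- move=> y z; rewrite !in_cons => /orP[/eqP ->|yS'] /orP[/eqP ->|zS']//.
  + by move=> xz; have := nx _ zS'; rewrite xz.
  + by rewrite es => xy; have := nx _ yS'; rewrite xy.
  + exact: h4.
Qed.

Lemma sub_chain (V : zmodType) (a b c d : V) : d - c = a - c + (b - a) + (d - b).
Proof. by rewrite [_ + (b - a)]addrC [b - a + _]addrA subrK [RHS]addrC addrA subrK. Qed.

Lemma common_eps (R : realType) (T : eqType) (S : seq T) (P : T -> R -> Prop) :
  (forall x e e', P x e -> 0 < e' -> e' <= e -> P x e') ->
  (forall x, x \in S -> exists2 e, 0 < e & P x e) ->
  exists2 e, 0 < e & forall x, x \in S -> P x e.
Proof.
move=> mono; elim: S => [|x S IH] h; first by exists 1.
have [y yS|e1 e10 h1] := IH; first by apply: h; rewrite in_cons yS orbT.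
have [e2 e20 h2] := h x (mem_head _ _).
exists (Num.min e1 e2) => [|y]; first by rewrite lt_min e10.
rewrite in_cons => /orP[/eqP ->|/h1 Py].
  by apply: mono h2 _ _; rewrite ?lt_min ?e10// ge_min lexx orbT.
by apply: mono Py _ _; rewrite ?lt_min ?e10// ge_min lexx.
Qed.

Lemma affine_subspace_eq (R : realType) (n : nat) (u v : 'rV[R]_n) (s : {vspace 'rV[R]_n}) :
  u - v \in s -> affine_subspace u s = affine_subspace v s.
Proof.
move=> h; apply/seteqP; split=> x; rewrite /affine_subspace /= => hx.
  by rewrite -[x](subrK u) -addrA rpredD.
by rewrite -[x](subrK v) -addrA rpredD// -opprB rpredN.
Qed.

(** * The recursive decomposition of Verlinde sums *)

Section VerlindeDecomposition.
Context {R : realType} {n : nat} (L X : 'M[R]_n).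
Hypotheses (L_unit : L \in unitmx) (LX : lattice L `<=` lattice X).
Notation M := 'rV[int]_n.
Notation C := R[i].
Notation E := 'rV[R]_n.
Local Notation D := (dual_basis L).
Local Notation emb := (emb (dual_basis L)).
Local Notation xilat := (xilat L X).
Local Notation zscale := (zscale (dual_basis L)).
Variable A : seq (M * C).
Hypothesis A_root : forall a, a \in A -> exists2 m, (0 < m)%N & a.2 ^+ m = 1.
Variable tau : set E -> E.
Implicit Types (r s : {vspace E}).

Local Notation Fl := (flats D A).
Local Notation wts_ := (wts D A).
Local Notation wtsd := (wts_diff D A).

Let D_unit : D \in unitmx := dual_basis_unit L_unit.

(** The last condition is what makes the sums over all strata locally finite. *)
Definition polarization : Prop :=
  [/\ forall s y v, s \in Fl -> xilat y -> v \in s ->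
        pairing v (tau (affine_subspace (emb y) s)) = 0,
      forall s y a, s \in Fl -> xilat y -> a \in A -> emb a.1 \notin s ->
        pairing (emb a.1) (tau (affine_subspace (emb y) s)) != 0 &
      forall s (K : R), s \in Fl -> exists2 S : seq M, (forall y, y \in S -> xilat y) &
        forall y x, xilat y -> `|x| <= K ->
          0 <= pairing (x - emb y) (tau (affine_subspace (emb y) s)) ->
          exists2 y', y' \in S & emb (y - y') \in s].

Hypothesis tauP : polarization.

(** The polarization at y is that of the stratum through y / l, which it depends
    on only. *)
Definition dir l s y : M -> R :=
  fun x => pairing (emb x) (tau (affine_subspace (zscale l y) s)).

(** The union of the cones over the strata parallel to s, at the level l. *)
Definition Ysupp l s y := exists2 w, xilat w & emb (y - w *+ l) \in s.

Definition germ l s : M -> C := gpart D A (fun r => vsum L X (wts_ r) l) (dir l) s.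

Definition germ_term l r s : M -> C :=
  cvf (germ l s) (pker (dir l) s (wtsd r s)).

Lemma zscale_sub l y w : (0 < l)%N -> zscale l y - emb w = l%:R^-1 *: emb (y - w *+ l).
Proof.
move=> l0; have lR : l%:R != 0 :> R by rewrite pnatr_eq0 -lt0n.
by rewrite zscaleE embB embMn -[emb w *+ l]scaler_nat scalerBr scalerA mulVf// scale1r.
Qed.

Lemma scaled_affine l y w s : (0 < l)%N -> emb (y - w *+ l) \in s ->
  affine_subspace (zscale l y) s = affine_subspace (emb w) s.
Proof. by move=> l0 h; apply: affine_subspace_eq; rewrite zscale_sub// rpredZ. Qed.

Lemma A_neq0 a : a \in A -> a.2 != 0.
Proof.
move=> /A_root[m m0]; apply: contra_eq_neq => ->.
by rewrite expr0n gtn_eqF//= eq_sym oner_eq0.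
Qed.

Lemma wts_sub r : {subset wts_ r <= A}.
Proof. by move=> a; rewrite mem_filter => /andP[]. Qed.

Section FixedLevel.
Variable l : nat.
Hypothesis l_gt0 : (0 < l)%N.
Let lR : l%:R != 0 :> R. Proof. by rewrite pnatr_eq0 -lt0n. Qed.

Lemma Ysupp_add r s x z : (s <= r)%VS -> Ysupp l s x -> emb z \in r -> Ysupp l r (x + z).
Proof.
move=> sr [w hw h] zr; exists w => //; rewrite addrAC embD rpredD//.
exact: (subvP sr).
Qed.

Lemma vsum_supp r : r \in Fl -> supported_on (Ysupp l r) (vsum L X (wts_ r) l).
Proof.
move=> rA z nz; have [m m0 hm] := xw_torsion L_unit LX A_root.
have [||w hw h] := @fsum_supp _ _ L X L_unit LX A m m0 hm [seq (b, Some 0%N) | b <- wts_ r] l z _ l_gt0 _.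
- by move=> p /mapP[b /wts_sub ? ->].
- apply: contraNN nz => /eqP <-; apply/eqP; apply: eq_bigr => t _; congr (_ * _).
  by rewrite /factors big_map /vden -prodfV; apply: eq_bigr => b _; rewrite /= expr1.
exists w => //; rewrite -map_comp map_id_in in h; last by [].
by rewrite (flats_span rA).
Qed.

Lemma dir_additive s y : additive_map (dir l s y).
Proof. exact: tau_additive. Qed.

Lemma dir_translate s y z : emb z \in s -> dir l s (y + z) = dir l s y.
Proof.
move=> zs; rewrite /dir (_ : affine_subspace (zscale l (y + z)) s = affine_subspace (zscale l y) s)//.
by apply: affine_subspace_eq; rewrite !zscaleE embD scalerDr addrAC subrr add0r rpredZ.
Qed.

Lemma dir_polarizing s y a : s \in Fl -> Ysupp l s y -> a \in A -> emb a.1 \notin s ->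
  dir l s y a.1 != 0.
Proof.
by move=> sA [w hw h] aA as0; rewrite /dir (scaled_affine l_gt0 h); have [_ + _] := tauP; apply.
Qed.

Lemma dir_sub s y w x : s \in Fl -> xilat w -> emb (y - w *+ l) \in s ->
  dir l s y (x - y) = l%:R * pairing (zscale l x - emb w) (tau (affine_subspace (emb w) s)).
Proof.
move=> sA hw h; rewrite /dir (scaled_affine l_gt0 h).
have [ann _ _] := tauP.
have -> : emb (x - y) = l%:R *: (zscale l x - emb w) - emb (y - w *+ l).
  rewrite scalerBr zscaleE scalerA mulfV// scale1r !embB embMn scaler_nat.
  by rewrite opprB addrA subrK.
have h0 := ann s w _ sA hw h.
by rewrite [LHS]pairingBl h0 subr0 pairingZl.
Qed.

Lemma pker_locally_finite r s : s \in Fl ->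
  locally_finite (Ysupp l s) (pker (dir l) s (wtsd r s)).
Proof.
move=> sA x; have [ann pol lf] := tauP.
have [S SX hS] := lf s `|zscale l x| sA.
suff [S1 h1] : exists S1 : seq M, forall w y, w \in S -> emb (y - w *+ l) \in s ->
    pker (dir l) s (wtsd r s) y (x - y) != 0 -> y \in S1.
  exists S1 => y [w hw hy] nz.
  have := pf_ge0 (dir_additive s y) nz.
  rewrite (dir_sub x sA hw hy) pmulr_rge0 ?ltr0n// => /(hS w _ hw (lexx _))[w' w'S hw'].
  apply: (h1 w') => //; rewrite -[y](subrK (w *+ l)) -addrA -mulrnBl embD rpredD//.
  by rewrite embMn rpredMn.
elim: S SX {hS} => [|w S IH] SX; first by exists [::].
have [w' w'S|S1 h1] := IH; first by apply: SX; rewrite in_cons w'S orbT.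
have hw : xilat w by apply: SX; exact: mem_head.
pose t := tau (affine_subspace (emb w) s).
have tpol : forall b, b \in wtsd r s -> (fun z : M => pairing (emb z) t) b.1 != 0.
  by move=> b /wts_diff_sub[bA _ bs]; exact: pol.
have [S2 h2] := pf_finite (l%:R * pairing (zscale l x - emb w) t) (tau_additive D t) tpol.
exists ([seq x - u | u <- S2] ++ S1) => w1 y.
rewrite in_cons mem_cat => /orP[/eqP ->|w1S] hy nz; last by rewrite (h1 w1 y)// orbT.
apply/orP; left; apply/mapP; exists (x - y); last by rewrite subKr.
apply: h2; last by move: nz; rewrite /pker /dir (scaled_affine l_gt0 hy).
by have := dir_sub x sA hw hy; rewrite /dir (scaled_affine l_gt0 hy) => ->.
Qed.

Lemma vsum_rel_flats r s : (s <= r)%VS -> s \in Fl -> r \in Fl ->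
  nabs (wtsd r s) (nabs (wtsd r s) (vsum L X (wts_ r) l)) =
  nabs (wtsd r s) (vsum L X (wts_ s) l).
Proof.
move=> sr sA rA; apply/funext => z; rewrite vsum_rel; congr (nabs _ (vsum L X _ l) z).
rewrite /wts -filter_predI; apply: eq_filter => a /=; rewrite negbK.
by case: (boolP (_ \in s)) => //= /(subvP sr) ->.
Qed.

Lemma germ_supp s : s \in Fl -> supported_on (Ysupp l s) (germ l s).
Proof. by move=> sA; exact: (gpart_supp Ysupp_add vsum_supp sA). Qed.

Lemma germ_dm_system r v : r \in Fl -> emb v \in r ->
  dm_system D v (wts_ r ++ wts_ r) (germ l r).
Proof.
move=> rA vr s vs; rewrite filter_cat nabs_cat.
apply: (gpart_dm A_neq0 Ysupp_add vsum_supp vsum_rel_flats dir_additive dir_translate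
   dir_polarizing pker_locally_finite rA).
by apply: contra vs => /subvP; apply.
Qed.

Lemma germ_term_ge0 r s y x : s \in Fl ->
  germ l s y * pker (dir l) s (wtsd r s) y (x - y) != 0 ->
  exists w, [/\ xilat w, emb (y - w *+ l) \in s, emb (x - y) \in r &
    0 <= pairing (zscale l x - emb w) (tau (affine_subspace (emb w) s))].
Proof.
move=> sA; rewrite mulf_eq0 negb_or => /andP[/(germ_supp sA)[w hw hy] nz].
exists w; split=> //; first exact: pker_supp nz.
have := pf_ge0 (dir_additive s y) nz.
by rewrite (dir_sub x sA hw hy) pmulr_rge0 ?ltr0n.
Qed.

End FixedLevel.

(** Near a point c not on the wrong side of any smaller stratum, the lower
    strata do not contribute. *)
Definition near_vanishing r (c : E) := forall s y, s \in Fl -> (s <= r)%VS -> s != r ->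
  xilat y -> emb y - c \in r ->
  pairing (c - emb y) (tau (affine_subspace (emb y) s)) < 0.

(** By local finiteness, only finitely many strata are close to the boundary of
    the condition. *)
Lemma near_vanishing_open r c : r \in Fl -> near_vanishing r c ->
  exists2 e, 0 < e & forall x, cell r c e x -> near_vanishing r x.
Proof.
move=> rA nv; have [ann pol lf] := tauP.
have [e e0 he] : exists2 e, 0 < e & forall s, s \in Fl -> (s <= r)%VS && (s != r) ->
    forall x y, cell r c e x -> xilat y -> emb y - x \in r ->
    pairing (x - emb y) (tau (affine_subspace (emb y) s)) < 0.
  apply: (@common_eps R _ Fl (fun s e => (s <= r)%VS && (s != r) ->
    forall x y, cell r c e x -> xilat y -> emb y - x \in r ->
    pairing (x - emb y) (tau (affine_subspace (emb y) s)) < 0)).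
    move=> s e e' h e'0 e'e hs x y [c1 c2]; apply: h => //; split=> //.
    exact: le_trans c2 e'e.
  move=> s sA; have [/andP[sr srn]|_] := boolP ((s <= r)%VS && (s != r)); last by exists 1.
  have [S SX hS] := lf s (`|c| + 1) sA.
  have [e e0 he] : exists2 e, 0 < e & forall y, y \in S -> emb y - c \in r ->
      forall x, `|x - c| <= e -> pairing (x - emb y) (tau (affine_subspace (emb y) s)) < 0.
    apply: (@common_eps R _ S (fun y e => emb y - c \in r -> forall x, `|x - c| <= e ->
      pairing (x - emb y) (tau (affine_subspace (emb y) s)) < 0)).
      by move=> y e e' h e'0 e'e yr x xc; apply: h => //; exact: le_trans xc e'e.
    move=> y yS; have [yr|_] := boolP (emb y - c \in r); last by exists 1.
    have := nv s y sA sr srn (SX _ yS) yr; set t := tau _; set v := pairing _ _ => v0.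
    have [K K0 hK] := pairing_norm t.
    exists (- v / (2 * (K + 1))) => [|_ x xc].
      by rewrite divr_gt0 ?oppr_gt0// mulr_gt0// ltr_wpDl.
    have -> : x - emb y = (x - c) + (c - emb y) by rewrite addrA subrK.
    rewrite pairingDl -/v -ltrBrDr sub0r; apply: le_lt_trans (ler_norm _) _.
    apply: le_lt_trans (hK _) _; apply: (@le_lt_trans _ _ ((K + 1) * (- v / (2 * (K + 1))))).
      by apply: ler_pM => //; rewrite lerDl.
    have K10 : K + 1 != 0 by rewrite gt_eqF// ltr_wpDl.
    have -> : (K + 1) * (- v / (2 * (K + 1))) = - v / 2 by field.
    by rewrite ltr_pdivrMr// ltr_pMr ?oppr_gt0// ltr1n.
  exists (Num.min e 1) => [|_ x w [xr xc] hw wr]; first by rewrite lt_min e0 ltr01.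
  move: xc; rewrite le_min => /andP[xc1 xc2].
  have xK : `|x| <= `|c| + 1.
    by rewrite -[x](subrKC c); apply: le_trans (ler_normD _ _) _; rewrite lerD2l.
  rewrite ltNge; apply/negP => h0; have [w' w'S hw'] := hS w _ hw xK h0.
  have w'r : emb w' - c \in r.
    have -> : emb w' - c = (emb w - x) + (x - c) - emb (w - w').
      by rewrite embB opprB [emb w - x + _]addrC; exact: sub_chain.
    by apply: rpredB; [exact: rpredD|exact: (subvP sr _ hw')].
  have := he w' w'S w'r _ xc1; rewrite ltNge => /negP; apply.
  have <- : affine_subspace (emb w) s = affine_subspace (emb w') s.
    by apply: affine_subspace_eq; rewrite -embB.
  have -> : x - emb w' = (x - emb w) + emb (w - w') by rewrite embB addrA subrK.
  by rewrite pairingDl (ann s w _ sA hw hw') addr0.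
exists e => // x hx s y sA sr srn hy yr; apply: (he s sA) => //.
by rewrite sr srn.
Qed.

(** A contribution from a smaller stratum at a point near c would put this point
    on the positive side of the stratum. *)
Lemma germ_near r c : r \in Fl -> near_vanishing r c ->
  exists2 e, 0 < e & forall l z, (0 < l)%N -> cell r c e (zscale l z) ->
    germ l r z = vsum L X (wts_ r) l z.
Proof.
move=> rA /(near_vanishing_open rA)[e e0 he]; exists e => // l z l0 /he nv.
rewrite /germ gpartE big1_seq ?subr0// => s /andP[/andP[sr srn] sA].
apply: fsbig1 => y _; apply/eqP/negPn/negP => /(germ_term_ge0 l0 sA)[w [hw hy yr h0]].
suff : pairing (zscale l z - emb w) (tau (affine_subspace (emb w) s)) < 0 by rewrite ltNge h0.
apply: nv => //; rewrite -opprB rpredN zscale_sub//.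
have -> : emb (z - w *+ l) = emb (z - y) + emb (y - w *+ l) by rewrite -embD addrA subrK.
by apply: rpredZ; apply: rpredD => //; exact: (subvP sr _ hy).
Qed.

End VerlindeDecomposition.

(** * Quasi-polynomiality of the terms of the decomposition *)

Lemma lpwq_sum_in (n : nat) (K : comNzRingType) (I : eqType) (r : seq I)
    (F : I -> 'rV[int]_n -> nat -> K) :
  (forall i, i \in r -> lpwq (F i)) -> lpwq (fun z l => \sum_(i <- r) F i z l).
Proof.
elim: r => [|i r IH] h.
  by apply: lpwq_ext (lpwq_cst 0) => z l _; rewrite big_nil.
have hr : lpwq (fun z l => \sum_(j <- r) F j z l).
  by apply: IH => j jr; apply: h; rewrite in_cons jr orbT.
by apply: lpwq_ext (lpwqD (h i (mem_head _ _)) hr) => z l _; rewrite big_cons.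
Qed.

Lemma common_nat (T : eqType) (S : seq T) (P : T -> nat -> Prop) :
  (forall x k k', (k <= k')%N -> P x k -> P x k') ->
  (forall x, x \in S -> exists k, P x k) -> exists k, forall x, x \in S -> P x k.
Proof.
move=> mono; elim: S => [|x S IH] h; first by exists 0%N.
have [y yS|k1 h1] := IH; first by apply: h; rewrite in_cons yS orbT.
have [k2 h2] := h x (mem_head _ _).
exists (maxn k1 k2) => y; rewrite in_cons => /orP[/eqP ->|/h1].
  by apply: mono h2; rewrite leq_maxr.
by apply: mono; rewrite leq_maxl.
Qed.

(** Homogeneous linear forms do not change sign along a ray from the origin. *)
Lemma pwq_ray (G : zmodType) (K : comNzRingType) (F : G -> K) x : pwq F ->
  exists2 Q : int -> K, qpfun Q & forall j : nat, (0 < j)%N -> F (x *+ j) = Q j.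
Proof.
elim=> [f qf|c f _ [Q qQ hQ]|f g _ [Q1 q1 h1] _ [Q2 q2 h2]].
- exists (fun j => f (x *~ j)) => [|j _]; last by rewrite pmulrn.
  by apply: qpfun_comp qf => i j; rewrite mulrzDr.
- exists (fun j => if 0 <= c x then Q j else 0).
    by case: (0 <= c x) => //; exact: qpfun_cst.
  by move=> j j0; rewrite zvalMn pmulrn_lge0// hQ.
- exists (fun j => Q1 j + Q2 j); first exact: qpfunD.
  by move=> j j0; rewrite h1 ?h2.
Qed.

Section VerlindeGerms.
Context {R : realType} {n : nat} (L X : 'M[R]_n).
Hypotheses (L_unit : L \in unitmx) (LX : lattice L `<=` lattice X).
Notation M := 'rV[int]_n.
Notation C := R[i].
Notation E := 'rV[R]_n.
Local Notation D := (dual_basis L).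
Local Notation emb := (emb (dual_basis L)).
Local Notation xilat := (xilat L X).
Local Notation zscale := (zscale (dual_basis L)).
Variable A : seq (M * C).
Hypothesis A_root : forall a, a \in A -> exists2 m, (0 < m)%N & a.2 ^+ m = 1.
Implicit Types (r s : {vspace E}).

Local Notation Fl := (flats D A).
Local Notation wts_ := (wts D A).
Local Notation wtsd := (wts_diff D A).

Let D_unit : D \in unitmx := dual_basis_unit L_unit.

Lemma tsum_cellqp r (B : seq (M * C)) (m : nat) (F : torus L -> C) : (0 < m)%N ->
  (forall b l t, b \in B -> (0 < l)%N -> t \in tpts L X l ->
    b.2 ^+ m = 1 /\ xw b t ^+ (m * l) = 1) ->
  pfrac B F -> cellqp D r (fun z l => tsum X l F z).
Proof.
move=> m0 hB; elim=> [J JB Ji|f g _ IH1 _ IH2|c y f _ IH].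
- by apply: (cellqp_lpwq D_unit); apply: (fsum_lpwq_small L_unit LX m0 hB JB); exact: indep_size.
- apply: cellqp_ext (cellqpD IH1 IH2) => z l l0.
  by rewrite /tsum -big_split; apply: eq_bigr => t _; rewrite mulrDr.
- apply: cellqp_ext (cellqp_mul_qp (qpfun_cst c) (cellqp_shift y IH)) => z l l0.
  rewrite /tsum mulr_sumr; apply: eq_bigr => t _; rewrite chiD; ring.
Qed.

Lemma vsum_cellqp r (B : seq (M * C)) : {subset B <= A} ->
  cellqp D r (fun z l => vsum L X B l z).
Proof.
move=> BA; have [m m0 hm] := xw_torsion L_unit LX A_root.
have [m' m'0 hm'] := common_root A_root.
pose I := [seq (b, Some 0%N) | b <- B].
have pI : pfrac A (factors (L := L) I).
  by apply: (pfrac_factors L m'0 hm') => p /mapP[b /BA bA ->].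
apply: cellqp_ext (tsum_cellqp r m0 hm pI) => z l l0; apply: eq_bigr => t _.
congr (_ * _); rewrite /factors big_map /vden -prodfV.
by apply: eq_bigr => b _; rewrite /= expr1.
Qed.

Variable tau : set E -> E.
Hypothesis tauP : polarization L X A tau.

Local Notation germ := (germ L X A tau).
Local Notation germ_term := (germ_term L X A tau).
Local Notation dir := (dir L tau).
Local Notation Ysupp := (Ysupp L X).

Lemma germ_killed r v : r \in Fl -> emb v \in r ->
  exists2 N, (0 < N)%N & exists k, forall l, (0 < l)%N -> killed (v *+ N) k (germ l r).
Proof.
move=> rA vr; have [m m0 hm] := common_root A_root.
have hm' : forall b, b \in wts_ r ++ wts_ r -> b.2 ^+ m = 1.
  by move=> b; rewrite mem_cat orbb => /wts_sub/hm.
have [N N0 [k hk]] := dm_system_killed D_unit v m0 hm'.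
exists N => //; exists k => l l0; apply: hk.
exact: (germ_dm_system L_unit LX A_root tauP).
Qed.

(** In a given cone, finitely many strata contribute; on each of them the
    polarization is constant and the term is an ordinary convolution. A
    transversal is needed in order to count each stratum once. *)
Lemma germ_term_lpwq r s K : s \in Fl -> lpwq (fun z l => l%:R ^+ K * germ l s z) ->
  lpwq (fun z l => l%:R ^+ K * germ_term l r s z).
Proof.
move=> sA hg; have [ann pol lf] := tauP; have [m m0 hm] := common_root A_root.
apply: lpwq_local => B.
have [K2 K20 h2] := mulmx_norm D.
have zB z l : (0 < l)%N -> inbox (B * l) z -> `|zscale l z| <= K2 * B%:R.
  move=> l0 hz; have lR : 0 < l%:R :> R by rewrite ltr0n.
  rewrite zscaleE normrZ ger0_norm ?invr_ge0// ler_pdivrMl//.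
  apply: le_trans (h2 _) _; rewrite mulrCA -natrM mulnC ler_wpM2l//.
  apply: norm_coord => // i; rewrite mxE -intr_norm -abszE -pmulrn ler_nat.
  exact: hz.
have [S SX hS] := lf s (K2 * B%:R) sA.
pose e (y y' : M) := emb (y - y') \in s.
have er : reflexive e by move=> y; rewrite /e subrr emb0 mem0v.
have es : symmetric e by move=> y y'; rewrite /e -opprB embN rpredN.
have et : transitive e.
  by move=> y x z; rewrite /e => xy yz; rewrite -[x](subrK y) -addrA embD rpredD.
have [S' [S'S uS' hS' dS']] := transversal_ex S er es et.
pose t w := tau (affine_subspace (emb w) s).
pose h w (y : M) (l : nat) : C := (emb (y - w *+ l) \in s)%:R * (l%:R ^+ K * germ l s y).
exists (fun z l => \sum_(w <- S') cvf ((h w)^~ l) (fun=> pf (fun x => pairing (emb x) (t w)) (wtsd r s)) z).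
  apply: lpwq_sum_in => w wS'; have wX := SX _ (S'S _ wS').
  apply: (@conv_lpwq _ _ _ (t w) _ _ (- pairing (emb w) (t w)) m m0).
  - by move=> b /wts_diff_sub[bA _ bs]; exact: pol.
  - by move=> b /wts_diff_sub[bA _ _]; exact: hm.
  - move=> l y l0; rewrite /h; case: (boolP (_ \in s)) => [ys _|_]; last by rewrite mul0r eqxx.
    have := ann s w _ sA wX ys; rewrite embB embMn pairingBl => /eqP.
    by rewrite subr_eq0 => /eqP ->; rewrite -[emb w *+ l]scaler_nat pairingZl mulNr opprK mulrC.
  - apply: lpwqM => //.
    have [Cm hC] := span_equations D_unit (map fst (wts_ s)).
    have hs y : (emb y \in s) = (y *m Cm == 0) by rewrite -hC -/(wspan D (wts_ s)) -flats_span.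
    pose H (x : M * int) := (x.1 - w *~ x.2) *m Cm.
    have HD x y : H (x + y) = H x + H y.
      by case: x y => [x1 x2] [y1 y2]; rewrite /H pairDE /= -mulmxDl mulrzDr opprD addrACA.
    by apply: lpwq_ext (@lpwq_eq0 n C H HD) => z l l0; rewrite hs.
move=> z l l0 hz; have [S0 hS0] := pker_locally_finite tauP l0 r sA z.
have gs : supported_on (Ysupp l s) (germ l s) by exact: (germ_supp L_unit LX A_root).
rewrite /germ_term (cvf_seq (S := undup S0) gs (undup_uniq _)); last first.
  by move=> y Yy; rewrite mem_undup; exact: hS0.
have sameP w y : emb (y - w *+ l) \in s ->
    pf (fun x => pairing (emb x) (t w)) (wtsd r s) = pker (dir l) s (wtsd r s) y.
  by move=> yw; rewrite /pker /dir (scaled_affine l0 yw).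
rewrite [RHS](eq_bigr (fun w => \sum_(y <- undup S0) h w y l *
    pker (dir l) s (wtsd r s) y (z - y))); last first.
  move=> w _; rewrite (@cvf_seq _ _ (fun y => Ysupp l s y /\ emb (y - w *+ l) \in s) _ _ z (undup S0))//.
  - apply: eq_bigr => y _; rewrite /h; case: (boolP (_ \in s)) => [yw|_]; last by rewrite !mul0r.
    by rewrite (sameP w y yw).
  - move=> y; rewrite /h; case: (boolP (_ \in s)) => [yw|_]; last by rewrite mul0r eqxx.
    by rewrite mul1r mulf_eq0 negb_or => /andP[_ /gs].
  - exact: undup_uniq.
  - by move=> y [Yy yw]; rewrite (sameP w y yw) mem_undup; exact: hS0.
rewrite exchange_big mulr_sumr; apply: eq_bigr => y _.
rewrite -mulr_suml /h -mulr_suml.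
set g := germ l s y; set p := pker _ _ _ _ _.
have [gp0|gp0] := eqVneq (g * p) 0; first by rewrite -mulrA -(mulrA _ g p) gp0 !mulr0.
have [w [wX yw zyr h0]] := germ_term_ge0 L_unit LX A_root tauP l0 sA gp0.
have [w' w'S ww'] := hS w _ wX (zB z l l0 hz) h0.
have [w2 w2S w'w2] := hS' _ w'S.
have yw2 : emb (y - w2 *+ l) \in s.
  rewrite -[y](subrK (w *+ l)) -addrA -mulrnBl embD rpredD// embMn rpredMn//.
  exact: (et _ _ _ ww' w'w2).
rewrite (bigD1_seq w2)//= yw2 big1_seq ?addr0 ?mul1r ?mulrA// => w3 /andP[w32 w3S].
case: (boolP (_ \in s)) => // yw3; case/eqP: w32; apply: dS' => //.
have : emb ((w3 - w2) *+ l) \in s.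
  have -> : (w3 - w2) *+ l = (y - w2 *+ l) - (y - w3 *+ l).
    by rewrite mulrnBl opprB [RHS]addrC addrA subrK.
  by rewrite embB rpredB.
rewrite /e embMn -[emb _ *+ l]scaler_nat rpredZeq pnatr_eq0 gtn_eqF//.
Qed.

Lemma lpwq_pow_le (f : M -> nat -> C) K K' : (K <= K')%N ->
  lpwq (fun z l => l%:R ^+ K * f z l) -> lpwq (fun z l => l%:R ^+ K' * f z l).
Proof.
move=> KK h; apply: lpwq_ext (lpwqM (@lpwq_X _ _ (K' - K)) h) => z l _.
by rewrite mulrA -exprD subnK.
Qed.

(** The power of l makes up for the divisions by l in the Fourier expansions. *)
Lemma germ_lpwq r : r \in Fl -> exists K, lpwq (fun z l => l%:R ^+ K * germ l r z).
Proof.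
move: {2}(\dim r).+1 (ltnSn (\dim r)) => d; elim: d r => // d IH r rd rA.
have [m m0 hm] := xw_torsion L_unit LX A_root.
have [K hK] : exists K, forall s, s \in Fl -> (s <= r)%VS && (s != r) ->
    lpwq (fun z l => l%:R ^+ K * germ l s z).
  apply: (@common_nat _ Fl (fun s K => (s <= r)%VS && (s != r) ->
    lpwq (fun z l => l%:R ^+ K * germ l s z))).
    by move=> s k k' kk h hs; apply: (lpwq_pow_le kk); exact: h.
  move=> s sA; have [/andP[sr srn]|_] := boolP ((s <= r)%VS && (s != r)); last by exists 0%N.
  have [|K hK] := IH s _ sA; last by exists K.
  by apply: leq_trans (vspace_properP sr srn) _; rewrite -ltnS.
pose K' := maxn (size (wts_ r)) K; exists K'.
have hV : lpwq (fun z l => l%:R ^+ K' * vsum L X (wts_ r) l z).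
  apply: (@lpwq_pow_le _ (size (wts_ r))); first by rewrite leq_maxl.
  exact: (vsum_lpwq L_unit LX m0 hm (@wts_sub _ _ _ _ _)).
have hT : lpwq (fun z l => \sum_(s <- [seq s <- Fl | (s <= r)%VS && (s != r)])
    l%:R ^+ K' * germ_term l r s z).
  apply: lpwq_sum_in => s; rewrite mem_filter => /andP[hs sA].
  apply: germ_term_lpwq => //; apply: (@lpwq_pow_le _ K); first by rewrite leq_maxr.
  exact: hK.
apply: lpwq_ext (lpwqD hV (lpwqN hT)) => z l l0.
by rewrite big_filter -mulr_sumr -mulrBr /germ gpartE.
Qed.

(** The difference equations of the germ and those of G, along common multiples
    of the weights. *)
Lemma germ_steps r (G : (M * int)%type -> C) (Bs : seq (M * C)) : r \in Fl -> qpfun G ->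
  {subset Bs <= wts_ r} -> exists ws k, [/\ (wspan D Bs <= span D ws)%VS,
    forall w, w \in ws -> emb w \in r &
    forall w l, w \in ws -> (0 < l)%N -> killed w k (fun z => germ l r z - G (z, l%:Z))].
Proof.
move=> rA [N1 N10 [k1 h1]]; elim: Bs => [|b Bs IH] hB.
  by exists [::], 0%N; split.
have [b' b'B|ws [k [w1 w2 w3]]] := IH; first by apply: hB; rewrite in_cons b'B orbT.
have br : emb b.1 \in r by have := hB b (mem_head _ _); rewrite mem_filter => /andP[].
have [N2 N20 [k2 h2]] := germ_killed rA br.
pose w := b.1 *+ (N2 * N1); have N0 : (0 < N2 * N1)%N by rewrite muln_gt0 N10 N20.
exists (w :: ws), (maxn k (maxn k1 k2)); split.
- rewrite /wspan /span /= !span_cons addvS//.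
  rewrite -memvE; apply/vlineP; exists (N2 * N1)%:R^-1.
  by rewrite /w embMn -[emb b.1 *+ _]scaler_nat scalerA mulVf ?scale1r// pnatr_eq0 -lt0n.
- by move=> w'; rewrite in_cons => /orP[/eqP ->|/w2//]; rewrite /w embMn rpredMn.
- move=> w' l; rewrite in_cons => /orP[/eqP -> l0|w'ws l0]; last first.
    by apply: killedW (w3 w' l w'ws l0); rewrite leq_maxl.
  apply: killedD.
    apply: (@killedW _ _ _ k2); first by rewrite !leq_max leqnn !orbT.
    by rewrite /w mulrnA; apply: killedMn; exact: h2.
  apply: killedN; apply: (@killedW _ _ _ k1); first by rewrite !leq_max leqnn !orbT.
  rewrite /w mulnC mulrnA; apply: killedMn.
  apply: (killed_comp (h := fun z : M => (z, l%:Z)) _ (h1 (b.1, 0))) => z.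
  by rewrite pmulrn pairMzE mul0rz pairDE addr0 -pmulrn.
Qed.

(** Over a small cell near c and for l large, the germ is a Verlinde sum, hence is
    given by some G. The difference equations extend this to the whole cone over
    the stratum for l large; for the remaining levels, compare the germ and G
    along the rays j (z, l), where both are quasi-polynomial in j up to the
    factor l^K. *)
Lemma germ_qp r c : r \in Fl -> near_vanishing L X A tau r c ->
  exists2 G : (M * int)%type -> C, qpfun G &
    forall l z, (0 < l)%N -> emb z - l%:R *: c \in r -> germ l r z = G (z, l%:Z).
Proof.
move=> rA nv; have [e e0 he] := germ_near L_unit LX A_root tauP rA nv.
have wA : {subset wts_ r <= A} by move=> b; exact: wts_sub.
have [c' [e' [G [l0 [e'0 sub qG hG]]]]] := vsum_cellqp r wA c 0 e0.
exists G => //.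
have cc' : c' - c \in r.
  by have [|//] := sub c' _; split; rewrite subrr ?normr0 ?mem0v ?ltW.
have [ws [k [ws1 ws2 ws3]]] := germ_steps rA qG (fun b h => h).
rewrite -(flats_span rA) in ws1.
have [l1 hl1] : exists l1, forall l z, (l1 <= l)%N -> emb z - l%:R *: c' \in r ->
    germ l r z - G (z, l%:Z) = 0.
  apply: (slice_unique (f := fun z l => germ l r z - G (z, l%:Z)) ws1 ws2 e'0 ws3).
  exists (maxn 1 l0) => l z; rewrite geq_max => /andP[l_gt0 ll0] hz.
  rewrite he//; last exact: sub.
  by rewrite -(hG l z)// addr0 subrr.
have [K hK] := germ_lpwq rA.
move=> l z l_gt0 hz; have [B zB] := inbox_ex z.
have [F pF hF] := hK B; have [Q qQ hQ] := pwq_ray (z, l%:Z) pF.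
have jE (j : nat) : (z, l%:Z) *+ j = (z *+ j, (l * j)%N%:Z).
  by rewrite pmulrn pairMzE -!pmulrn -mulr_natr natz PoszM.
have hQ' (j : nat) : (0 < j)%N -> (l * j)%:R ^+ K * germ (l * j) r (z *+ j) = Q j.
  move=> j0; rewrite -hQ// jE -hF ?muln_gt0 ?l_gt0//.
  apply: inboxW (inboxMn j zB); rewrite mulnA leq_mul2r leq_pmulr ?orbT//.
pose H j : C := Q j - (l%:Z * j)%:~R ^+ K * G (z *~ j, l%:Z * j).
have qH : qpfun H.
  apply: qpfunD => //; apply: qpfunN; apply: qpfunM; last first.
    by apply: (qpfun_comp (h := fun j => (z *~ j, l%:Z * j))) qG => i j; rewrite mulrzDr mulrDr.
  have lD (i j : int) : l%:Z * (i + j) = l%:Z * i + l%:Z * j by rewrite mulrDr.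
  elim: K {hK hF hQ' H} => [|K IH]; first exact: qpfun_cst.
  by apply: qpfun_ext (qpfunM (qpfun_zlin (Zlin lD)) IH) => j; rewrite exprS.
have H1 : H 1 = 0.
  apply: (@qpfun_ray _ _ H 1 1 l1 qH) => j j1.
  rewrite -[1 + _]/((1 + 1 *+ j)) natz -PoszD add1n.
  rewrite /H -hQ'// -pmulrn -PoszM -pmulrn -mulrBr.
  rewrite hl1 ?mulr0//; first by rewrite (leq_trans j1)// (leq_trans (leqnSn _))// leq_pmull.
  have -> : emb (z *+ j.+1) - (l * j.+1)%:R *: c' =
      (emb z - l%:R *: c) *+ j.+1 - (l * j.+1)%:R *: (c' - c).
    rewrite embMn mulrnBl scalerBr opprB addrA; congr (_ - _).
    have -> : (l * j.+1)%:R *: c = (l%:R *: c) *+ j.+1 by rewrite mulnC natrM -scalerA scaler_nat.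
    by rewrite subrK.
  by rewrite rpredB ?rpredMn// rpredZ.
have lK : l%:R ^+ K != 0 :> C by rewrite expf_neq0// pnatr_eq0 -lt0n.
apply: (mulfI lK); have := hQ' 1%N (ltn0Sn _); rewrite muln1 mulr1n => ->.
by move/eqP: H1; rewrite /H mulr1 mulr1z subr_eq0 => /eqP ->; rewrite pmulrn.
Qed.

End VerlindeGerms.

(** * Polarizations from an inner product *)

Section InnerProduct.
Context {R : realType} {n : nat}.
Notation E := 'rV[R]_n.
Variables (f : E -> E -> R) (sharp : E -> E).
Hypothesis fC : forall x y, f x y = f y x.
Hypothesis f_pos : forall x, x != 0 -> 0 < f x x.
Hypothesis f_pairing : forall x y, f x y = pairing x (sharp y).
Hypothesis sharp_surj : forall t, exists u, sharp u = t.
Implicit Types (s : {vspace E}).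

Lemma fDl x y z : f (x + y) z = f x z + f y z.
Proof. by rewrite !f_pairing pairingDl. Qed.
Lemma fDr x y z : f x (y + z) = f x y + f x z.
Proof. by rewrite ![f x _]fC fDl. Qed.
Lemma fZl a x z : f (a *: x) z = a * f x z.
Proof. by rewrite !f_pairing pairingZl. Qed.
Lemma fZr a x z : f x (a *: z) = a * f x z.
Proof. by rewrite ![f x _]fC fZl. Qed.
Lemma fNl x z : f (- x) z = - f x z.
Proof. by rewrite !f_pairing pairingNl. Qed.
Lemma fNr x z : f x (- z) = - f x z.
Proof. by rewrite ![f x _]fC fNl. Qed.
Definition fE := (fDl, fDr, fNl, fNr, fZl, fZr).

Lemma f0l x : f 0 x = 0. Proof. by rewrite f_pairing pairing0l. Qed.

Lemma f_ge0 x : 0 <= f x x.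
Proof. by have [ ->|/f_pos/ltW//] := eqVneq x 0; rewrite f0l. Qed.

Definition orth s x := forall w, w \in s -> f x w = 0.

Lemma orthD s x y : orth s x -> orth s y -> orth s (x + y).
Proof. by move=> hx hy w ws; rewrite fDl hx ?hy ?addr0. Qed.

Lemma orthZ s a x : orth s x -> orth s (a *: x).
Proof. by move=> hx w ws; rewrite fZl hx ?mulr0. Qed.

Lemma orth_span (bs : seq E) x : (forall b, b \in bs -> f x b = 0) -> orth <<bs>>%VS x.
Proof.
elim: bs => [|b bs IH] h w; first by rewrite span_nil memv0 => /eqP ->; rewrite fC f0l.
rewrite span_cons => /memv_addP[_ /vlineP[a ->] [v vb ->]].
rewrite fDr fZr h ?mem_head// mulr0 add0r; apply: IH => // b' b'b.
by apply: h; rewrite in_cons b'b orbT.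
Qed.

(** Gram-Schmidt orthogonalization. *)
Lemma proj_ex s x : exists2 p, p \in s & orth s (x - p).
Proof.
rewrite -(span_basis (vbasisP s)); elim: {s}(vbasis s : seq E) x => [|b bs IH] x.
  by exists 0; [rewrite mem0v|move=> w; rewrite span_nil memv0 => /eqP ->; rewrite fC f0l].
have sub y : y \in <<bs>>%VS -> y \in <<b :: bs>>%VS.
  by apply: subvP; rewrite span_cons addvSr.
have [q qs qo] := IH b; have [p ps po] := IH x; set b' := b - q.
have bb' : b = b' + q by rewrite subrK.
have b's : b' \in <<b :: bs>>%VS.
  by apply: rpredB; [apply: memv_span; exact: mem_head|exact: sub].
have key y : f y b' = 0 -> orth <<bs>>%VS y -> orth <<b :: bs>>%VS y.
  move=> yb yo; apply: orth_span => c; rewrite in_cons => /orP[/eqP ->|cb].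
    by rewrite bb' fDr yb yo// addr0.
  by apply: yo; exact: memv_span.
have [b0|b0] := eqVneq b' 0.
  by exists p; [exact: sub|apply: key => //; rewrite b0 fC f0l].
have fb0 : f b' b' != 0 by rewrite gt_eqF// f_pos.
exists (p + (f x b' / f b' b') *: b'); first by rewrite rpredD ?rpredZ// sub.
rewrite opprD addrA; apply: key; last first.
  by apply: orthD => //; rewrite -scaleNr; exact: orthZ.
rewrite fDl fNl fZl divfK// fDl fNl [f p b']fC (qo _ ps) subr0 subrr//.
Qed.

Lemma f_bounded (Q : R) : exists2 K, 0 <= K & forall x, f x x <= Q -> `|x| <= K.
Proof.
have hg i : exists g, forall x : E, x 0 i = f x g.
  have [g hg] := sharp_surj (delta_mx 0 i); exists g => x.
  rewrite f_pairing hg /pairing mxE (bigD1 i)//= !mxE !eqxx mulr1 big1 ?addr0// => j ji.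
  by rewrite !mxE (negPf ji) mulr0.
have [g hg'] := choice hg.
exists (\sum_i (`|Q| + f (g i) (g i))) => [|x xQ].
  by apply: sumr_ge0 => i _; rewrite addr_ge0// f_ge0.
have QQ := ler_norm Q.
have t0 i : 0 <= `|Q| + f (g i) (g i) by rewrite addr_ge0// f_ge0.
apply: norm_coord => [|i]; first by apply: sumr_ge0 => i _.
apply: (@le_trans _ _ (`|Q| + f (g i) (g i))); last first.
  by rewrite (bigD1 i)//= lerDl; apply: sumr_ge0 => j _.
have h1 := f_ge0 (x + g i); have h2 := f_ge0 (x - g i).
move: h1 h2; rewrite !fE [f (g i) x]fC hg' => h1 h2.
have hx := f_ge0 x; have hgg := f_ge0 (g i).
by rewrite ler_norml; apply/andP; split; nra.
Qed.

Lemma f_bound_norm (K : R) : exists Q, forall x, `|x| <= K -> f x x <= Q.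
Proof.
have h i : exists k, 0 <= k /\ forall x, `|f x (delta_mx 0 i)| <= k * `|x|.
  have [k k0 hk] := pairing_norm (sharp (delta_mx 0 i)).
  by exists k; split=> // x; rewrite f_pairing.
have [k hk] := choice h.
exists (\sum_i `|K| * (k i * `|K|)) => x xK.
have xK' : `|x| <= `|K| by apply: le_trans xK (ler_norm _).
have -> : f x x = \sum_i x 0 i * f x (delta_mx 0 i).
  rewrite [X in f _ X = _](row_sum_delta x).
  rewrite (big_morph (f x) (fDr x) (_ : f x 0 = 0)); last by rewrite fC f0l.
  by apply: eq_bigr => i _; rewrite fZr.
apply: ler_sum => i _; apply: le_trans (ler_norm _) _; rewrite normrM.
have [k0 hki] := hk i; apply: ler_pM => //.
  by apply: le_trans xK'; exact: coord_norm.
by apply: le_trans (hki x) _; rewrite ler_wpM2l.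
Qed.

(** The component of each a orthogonal to s is not zero, so that a small multiple
    of it moves o away from the hyperplane orthogonal to a. *)
Lemma perturb s o (as_ : seq E) (eta : R) : orth s o -> 0 < eta ->
  (forall a, a \in as_ -> a \notin s) ->
  exists d, [/\ orth s d, f d d <= eta & forall a, a \in as_ -> f a (o + d) != 0].
Proof.
move=> so; elim: as_ eta => [|a as_ IH] eta eta0 has.
  by exists 0; split=> // [w _|]; rewrite f0l// ltW.
have e4 : 0 < eta / 4 by rewrite divr_gt0.
have [b bas|d [d1 d2 d3]] := IH _ e4; first by apply: has; rewrite in_cons bas orbT.
have [ad|ad] := eqVneq (f a (o + d)) 0; last first.
  exists d; split=> //; first by apply: le_trans d2 _; rewrite ler_pdivrMr// ler_pMr// ler1n.
  by move=> b; rewrite in_cons => /orP[/eqP ->//|/d3].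
have [p ps po] := proj_ex s a; pose v := a - p.
have v0 : v != 0.
  by apply: contraNneq (has a (mem_head _ _)) => /eqP; rewrite subr_eq0 => /eqP ->.
have av : f a v = f v v by rewrite -{1}[a](subrK p) fDl [f p v]fC (po _ ps) addr0.
have vo : orth s v by [].
clearbody v.
have [e e0 he] : exists2 e, 0 < e & forall b, b \in as_ ->
    forall t, 0 < t -> t <= e -> f b (o + d) + t * f b v != 0.
  apply: (@common_eps R _ as_ (fun b e => forall t, 0 < t -> t <= e -> f b (o + d) + t * f b v != 0)).
    by move=> b e e' h _ e'e t t0 te; apply: h => //; exact: le_trans te e'e.
  move=> b bas; have bd := d3 b bas.
  exists (`|f b (o + d)| / (`|f b v| + 1) / 2) => [|t t0 te].
    by rewrite !divr_gt0 ?normr_gt0// ltr_wpDl.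
  apply/eqP => h; have h1 : `|f b (o + d)| = t * `|f b v|.
    by rewrite -[t in RHS]gtr0_norm// -normrM; move/eqP: h; rewrite addr_eq0 => /eqP ->; rewrite normrN.
  have bv1 : 0 < `|f b v| + 1 by rewrite ltr_wpDl.
  have fb0 : 0 < `|f b (o + d)| by rewrite normr_gt0.
  move: te; rewrite -mulrA -invfM ler_pdivlMr ?mulr_gt0//.
  have := normr_ge0 (f b v); move: fb0 h1 bv1; move: (`|f b (o + d)|) (`|f b v|) => F G.
  by nra.
have fv := f_pos v0.
pose t := Num.min e (Num.min 1 (eta / 4 / f v v)).
have t0 : 0 < t by rewrite !lt_min e0 ltr01 !divr_gt0.
have te : t <= e by rewrite ge_min lexx.
have t1 : t <= 1 by rewrite !ge_min lexx orbT.
have tv : t * f v v <= eta / 4 by rewrite -ler_pdivlMr// !ge_min lexx !orbT.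
exists (d + t *: v); split.
- by apply: orthD => //; exact: orthZ.
- have := f_ge0 (d - t *: v); rewrite !fE [f v d]fC => h.
  have : t * (t * f v v) <= eta / 4 by apply: le_trans tv; rewrite ger_pMl// mulr_gt0.
  by nra.
- move=> b; rewrite addrA fDr fZr in_cons => /orP[/eqP ->|bas].
    by rewrite ad add0r av mulf_neq0// gt_eqF.
  exact: he.
Qed.

(** For o the vector from a point to its projection on an affine subspace, o + d
    serves the same purposes as o. *)
Definition close_to (o d : E) := o != 0 -> 4 * f d d <= f o o.

Lemma close_bound o d : close_to o d -> f o o / 2 <= f o o + f o d.
Proof.
have [ ->|o0] := eqVneq o 0; first by rewrite !f0l mul0r addr0.
move=> /(_ o0) h; have := f_ge0 (2^-1 *: o + d); rewrite !fE [f d o]fC.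
by nra.
Qed.

(** The hyperplane orthogonal to o + d through the end point of o is at a distance
    of the order of |o| from the base point, so that vectors a reaching beyond it
    are not much shorter than o. *)
Lemma close_estimate o d a : close_to o d -> 0 <= f a (o + d) - (f o o + f o d) ->
  f o o <= 12 * f a a.
Proof.
have [ ->|o0] := eqVneq o 0; first by rewrite f0l mulr_ge0// f_ge0.
move=> cl; have h1 := close_bound cl; have := cl o0.
have := f_ge0 (4^-1 *: (o + d) - 2 *: a); have := f_ge0 (o - d).
have oo := f_ge0 o.
rewrite !fE [f d o]fC [f o a]fC [f d a]fC; move: (f o o) (f o d) (f d d) (f a o) (f a d) (f a a) h1 oo.
by move=> O OD DD AO AD AA; nra.
Qed.

End InnerProduct.

Section PolarizationFromInnerProduct.
Context {R : realType} {n : nat} (L X : 'M[R]_n).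
Hypotheses (L_unit : L \in unitmx) (LX : lattice L `<=` lattice X).
Notation M := 'rV[int]_n.
Notation C := R[i].
Notation E := 'rV[R]_n.
Local Notation D := (dual_basis L).
Local Notation emb := (emb (dual_basis L)).
Local Notation xilat := (xilat L X).
Variable A : seq (M * C).
Implicit Types (r s : {vspace E}).
Local Notation Fl := (flats D A).
Let D_unit : D \in unitmx := dual_basis_unit L_unit.

Variables (f : E -> E -> R) (sharp : E -> E).
Hypothesis fC : forall x y, f x y = f y x.
Hypothesis f_pos : forall x, x != 0 -> 0 < f x x.
Hypothesis f_pairing : forall x y, f x y = pairing x (sharp y).
Hypothesis sharp_surj : forall t, exists u, sharp u = t.

Lemma xilatD x y : xilat x -> xilat y -> xilat (x + y).
Proof.
by move=> hx hy v hv; rewrite embD pairingDl rpredD// ?hx ?hy.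
Qed.

Lemma xilatMz x (j : int) : xilat x -> xilat (x *~ j).
Proof. by move=> hx v hv; rewrite embMz -scaler_int pairingZl rpredM ?intr_int ?hx. Qed.

Lemma xilat_multiple : exists2 N, (0 < N)%N & forall x, xilat (x *+ N).
Proof.
have [N N0 hN] := lattice_index L_unit LX; exists N => // x v /hN Lv.
rewrite embMn -scaler_nat pairingZl -pairingZr.
exact: (dual_lattice_emb L_unit).
Qed.

(** The quotient of Xi^* by its intersection with a rational subspace is
    discrete. *)
Lemma xilat_classes s (K : R) : s \in Fl -> exists2 S : seq M,
  (forall y, y \in S -> xilat y) &
  forall y p, xilat y -> p - emb y \in s -> `|p| <= K -> exists2 y', y' \in S & emb (y - y') \in s.
Proof.
move=> sA; have [N N0 hN] := xilat_multiple.
pose ws := [seq b.1 *+ N | b <- wts D A s].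
have sw : (s <= span D ws)%VS.
  rewrite [s in (s <= _)%VS](flats_span sA); apply: wspan_sub => a aA.
  have -> : emb a.1 = N%:R^-1 *: emb (a.1 *+ N).
    by rewrite embMn -[emb _ *+ N]scaler_nat scalerA mulVf ?scale1r// pnatr_eq0 -lt0n.
  by rewrite rpredZ//; apply/memv_span/map_f/map_f.
have ws_s : (span D ws <= s)%VS.
  apply/span_subvP => _ /mapP[_ /mapP[a + ->] ->]; rewrite mem_filter => /andP[as_ _].
  by rewrite embMn rpredMn.
have [K1 K10 hK1] := span_round D ws.
have [K2 K20 hK2] := emb_norm_box D_unit.
exists [seq y <- boxseq (K2 * (Num.truncn (K + K1)).+1) | `[< xilat y >]].
  by move=> y; rewrite mem_filter => /andP[/asboolP].
move=> y p hy ps pK; have [j hj] := hK1 _ (subvP sw _ ps).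
have combX ws' j' : (forall w, w \in ws' -> xilat w) -> xilat (comb ws' j').
  elim: ws' j' => [|w ws' IH] j' h /=.
    by move=> v hv; rewrite emb0 pairing0l rpred0.
  apply: xilatD; first by apply: xilatMz; apply: h; exact: mem_head.
  by apply: IH => w' w'ws; apply: h; rewrite in_cons w'ws orbT.
have cX : xilat (comb ws j) by apply: combX => _ /mapP[a _ ->]; exact: hN.
exists (y + comb ws j).
  rewrite mem_filter; apply/andP; split; first by apply/asboolP; exact: xilatD.
  apply: mem_boxseq; apply: hK2; rewrite embD.
  have -> : emb y + emb (comb ws j) = p - (p - emb y - emb (comb ws j)).
    by rewrite -addrA -opprD subKr.
  apply: le_trans (ler_normB _ _) _; apply: (@le_trans _ _ (K + K1)); first exact: lerD.
  by rewrite ltW// truncnS_gt.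
by rewrite opprD addrA subrr add0r embN rpredN; apply: (subvP ws_s); exact: comb_span.
Qed.

Definition good_direction c s y t := exists o d,
  [/\ t = sharp (o + d), c + o - emb y \in s, orth f s o, orth f s d & close_to f o d].

Definition polarizes s t := forall a, a \in A -> emb a.1 \notin s -> pairing (emb a.1) t != 0.

(** At a point x at bounded distance from c, only the strata at bounded distance
    from c contribute, and there are finitely many of them in each direction. *)
Lemma good_polarization c tau :
  (forall s y, s \in Fl -> xilat y -> good_direction c s y (tau (affine_subspace (emb y) s)) /\
     polarizes s (tau (affine_subspace (emb y) s))) ->
  polarization L X A tau.
Proof.
move=> h; split.
- move=> s y v sA hy vs; have [[ o [d [ -> _ so sd _]]] _] := h s y sA hy.
  by rewrite -f_pairing fC (fDl f_pairing) so// sd// addr0.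
- by move=> s y a sA hy aA as_; have [_] := h s y sA hy; apply.
- move=> s K sA.
  have [Q hQ] := f_bound_norm fC f_pairing (K + `|c|).
  have [K1 K10 hK1] := f_bounded fC f_pos f_pairing sharp_surj (12 * Q).
  have [S SX hS] := xilat_classes (`|c| + K1) sA.
  exists S => // y x hy xK; have [[ o [d [ -> cs so sd cl]]] _] := h s y sA hy.
  rewrite -f_pairing => h0; apply: (hS y (c + o) hy cs).
  apply: le_trans (ler_normD _ _) _; rewrite lerD2l; apply: hK1.
  have : f o o <= 12 * f (x - c) (x - c).
    apply: (close_estimate fC f_pos f_pairing cl).
    have e1 : x - emb y = (x - c) - o + (c + o - emb y).
      by move: (emb y) => v; apply/rowP => i; rewrite !mxE; ring.
    have e2 : f (c + o - emb y) (o + d) = 0.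
      by rewrite fC (fDl f_pairing) so// sd// addr0.
    move: h0; rewrite e1 (fDl f_pairing) e2 addr0 (fDl f_pairing) (fNl f_pairing).
    by rewrite [f o (o + d)](fDr fC f_pairing).
  move=> /le_trans; apply; rewrite ler_pM2l//; apply: hQ.
  by apply: le_trans (ler_normB _ _) _; rewrite lerD2r.
Qed.

(** Use the projections of c itself, perturbed so as to be polarizing; as c is on
    none of the smaller strata, it is strictly on their negative side. *)
Lemma regular_polarization r c : 
  (forall s y, s \in Fl -> (s <= r)%VS -> s != r -> xilat y -> c - emb y \notin s) ->
  exists2 tau, polarization L X A tau & near_vanishing L X A tau r c.
Proof.
move=> reg.
have hex (S : set E) : exists t, forall s y, s \in Fl -> xilat y ->
    S = affine_subspace (emb y) s -> good_direction c s y t /\ polarizes s t.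
  have [[s [y [sA hy SE]]]|nS] := pselect (exists s y, [/\ s \in Fl, xilat y & S = affine_subspace (emb y) s]); last first.
    by exists 0 => s y sA hy SE; case: nS; exists s, y.
  have [p ps po] := proj_ex fC f_pos f_pairing s (c - emb y).
  pose o := p - (c - emb y).
  have so : orth f s o by move=> w ws; rewrite /o -opprB (fNl f_pairing) po ?oppr0.
  pose eta := if o == 0 then 1 else f o o / 4.
  have eta0 : 0 < eta.
    by rewrite /eta; have [_|o0] := eqVneq o 0; rewrite ?divr_gt0// f_pos.
  have [|d [sd dd dA]] := @perturb _ _ f sharp fC f_pos f_pairing s o
      [seq emb a.1 | a <- A & emb a.1 \notin s] eta so eta0.
    by move=> _ /mapP[a + ->]; rewrite mem_filter => /andP[].
  exists (sharp (o + d)) => s' y' s'A hy' SE'.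
  have ss' : s' = s by rewrite -(direction_affine (emb y') s') -SE' SE direction_affine.
  rewrite {}ss' in s'A SE' *.
  have yy' : emb y - emb y' \in s.
    have : affine_subspace (emb y) s (emb y) by rewrite /affine_subspace /= subrr mem0v.
    by rewrite -SE SE'.
  split.
    exists o, d; split=> //.
      have -> : c + o - emb y' = p + (emb y - emb y').
        by rewrite /o; move: (emb y) (emb y') => v v'; apply/rowP => i; rewrite !mxE; ring.
      exact: rpredD.
    by move=> o0; move: dd; rewrite /eta (negPf o0); nra.
  move=> a aA as_; rewrite -f_pairing; apply: dA; apply/map_f.
  by rewrite mem_filter as_.
have [tau htau] := choice hex; exists tau.
  by apply: (@good_polarization c) => s y sA hy; exact: htau.
move=> s y sA sr srn hy yr; have [[ o [d [ -> cs so sd cl]]] _] := htau _ s y sA hy erefl.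
have o0 : o != 0.
  by apply: contraNneq (reg s y sA sr srn hy) => o0; rewrite o0 addr0 in cs.
rewrite -f_pairing.
have -> : c - emb y = (c + o - emb y) - o by rewrite addrAC addrK.
rewrite (fDl f_pairing) (fNl f_pairing) [f (c + o - _) _]fC (fDl f_pairing) so// sd// addr0 add0r.
rewrite oppr_lt0 (fDr fC f_pairing); apply: lt_le_trans (close_bound fC f_pos f_pairing cl).
by rewrite divr_gt0// f_pos.
Qed.

(** Projections are transitive: c + o is also the projection of c + o0 on the
    smaller stratum, so that the pairing is minus the squared length of o - o0. *)
Lemma generic_near_vanishing r o0 c tau :
  (forall s y, s \in Fl -> xilat y -> exists o, [/\ tau (affine_subspace (emb y) s) = sharp o,
     c + o - emb y \in s & orth f s o]) ->
  orth f r o0 ->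
  (forall s y, s \in Fl -> (s <= r)%VS -> s != r -> xilat y -> c + o0 - emb y \notin s) ->
  near_vanishing L X A tau r (c + o0).
Proof.
move=> htau ro0 reg s y sA sr srn hy yr; have [ o [ -> cs so]] := htau s y sA hy.
rewrite -f_pairing; set q := o - o0.
have e1 : c + o0 - emb y = (c + o - emb y) - q by rewrite /q; move: (emb y) => v; apply/rowP => i; rewrite !mxE; ring.
have q0 : q != 0.
  by apply: contraNneq (reg s y sA sr srn hy) => q0; rewrite e1 q0 subr0.
have h1 : f (c + o0 - emb y) o0 = 0 by rewrite fC ro0// -opprB rpredN.
have -> : f (c + o0 - emb y) o = f (c + o0 - emb y) q.
  by rewrite /q (fDr fC f_pairing) (fNr fC f_pairing) h1 subr0.
rewrite e1 (fDl f_pairing) (fNl f_pairing).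
have -> : f (c + o - emb y) q = 0.
  rewrite /q (fDr fC f_pairing) (fNr fC f_pairing) ![f (c + o - _) _]fC so//.
  by rewrite ro0 ?subr0//; exact: (subvP sr).
by rewrite add0r oppr_lt0 f_pos.
Qed.

End PolarizationFromInnerProduct.

(** * Constancy of the germ along a chamber *)

Section Chambers.
Context {R : realType} {n : nat} (L X : 'M[R]_n).
Hypotheses (L_unit : L \in unitmx) (LX : lattice L `<=` lattice X).
Notation M := 'rV[int]_n.
Notation C := R[i].
Notation E := 'rV[R]_n.
Local Notation D := (dual_basis L).
Local Notation emb := (emb (dual_basis L)).
Local Notation xilat := (xilat L X).
Local Notation zscale := (zscale (dual_basis L)).
Variable A : seq (M * C).
Hypothesis A_root : forall a, a \in A -> exists2 m, (0 < m)%N & a.2 ^+ m = 1.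
Implicit Types (r s : {vspace E}).
Local Notation Fl := (flats D A).
Local Notation wts_ := (wts D A).
Let D_unit : D \in unitmx := dual_basis_unit L_unit.

Definition regular r (c : E) := forall s y, s \in Fl -> (s <= r)%VS -> s != r ->
  xilat y -> c - emb y \notin s.

(** A cell is star-shaped. *)
Lemma component_cell (S : set E) r mu e : 0 < e -> (forall x, cell r mu e x -> S x) ->
  forall x, cell r mu e x -> connected_component S mu x.
Proof.
move=> e0 hS x [xr xe]; pose g (t : R) : E := mu + t *: (x - mu).
apply: (@connected_component_max _ S (g @` `[0, 1])).
- by exists 0; rewrite /g ?scale0r ?addr0//= in_itv /= lexx ler01.
- move=> _ [t /= + <-]; rewrite in_itv /= => /andP[t0 t1]; apply: hS.
  rewrite /g /cell addrAC subrr add0r; split; first exact: rpredZ.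
  by rewrite normrZ ger0_norm//; apply: le_trans xe; rewrite ler_piMl.
- apply: connected_continuous_connected; first exact: segment_connected.
  apply: continuous_subspaceT => t; apply: cvgD; first exact: cvg_cst.
  by apply: cvgZr_tmp; exact: cvg_id.
- by exists 1; rewrite /g ?scale1r ?subrKC//= in_itv /= lexx ler01.
Qed.

(** G gives the Verlinde sums in all levels on the cone over a neighbourhood of c.
    That no level is excluded is what allows propagation along a chamber. *)
Definition germ_at_point r (c : E) (G : (M * int)%type -> C) := exists2 e, 0 < e &
  forall l z, (0 < l)%N -> cell r c e (zscale l z) -> vsum L X (wts_ r) l z = G (z, l%:Z).

Variables (f : E -> E -> R) (sharp : E -> E).
Hypothesis fC : forall x y, f x y = f y x.
Hypothesis f_pos : forall x, x != 0 -> 0 < f x x.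
Hypothesis f_pairing : forall x y, f x y = pairing x (sharp y).
Hypothesis sharp_surj : forall t, exists u, sharp u = t.

Lemma local_germ r c : r \in Fl -> regular r c ->
  exists2 G, qpfun G & germ_at_point r c G.
Proof.
move=> rA reg.
have [tau tauP nv] := regular_polarization L_unit LX fC f_pos f_pairing sharp_surj reg.
have [G qG hG] := germ_qp L_unit LX A_root tauP rA nv.
have [e e0 he] := germ_near L_unit LX A_root tauP rA nv.
exists G => //; exists e => // l z l0 hz; rewrite -he// hG//.
by have /(zscale_cell _ _ _ _ _ l0)[] := hz.
Qed.

Lemma cell_half r c c' e x : c' - c \in r -> `|c' - c| < e / 2 -> cell r c' (e / 2) x ->
  cell r c e x.
Proof.
move=> cr ce [xr xe]; split; first by rewrite -[x](subrK c') -addrA rpredD.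
rewrite -[x](subrK c') -addrA; apply: le_trans (ler_normD _ _) _.
by rewrite [e](splitr e) lerD// ltW.
Qed.

Lemma germ_unique_slice r c (G G' : (M * int)%type -> C) : r \in Fl -> qpfun G -> qpfun G' ->
  germ_at_point r c G -> germ_at_point r c G' ->
  forall l z, (0 < l)%N -> emb z - l%:R *: c \in r -> G (z, l%:Z) = G' (z, l%:Z).
Proof.
move=> rA qG qG' [e e0 he] [e' e'0 he'] l z l0 zr.
have rE : r = span D (map fst (wts_ r)) by exact: flats_span.
apply/eqP; rewrite -subr_eq0; apply/eqP.
have em : 0 < Num.min e e' by rewrite lt_min e0.
pose H x := G x - G' x; rewrite -/(H (z, l%:Z)).
have qH : qpfun H by apply: qpfunD => //; exact: qpfunN.
apply: (@qp_slice_unique _ _ D C (map fst (wts_ r)) c _ 1 H qH em) => //.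
- move=> k w k0; rewrite -rE => -[wr]; rewrite le_min => /andP[w1 w2].
  by rewrite /H -he// -he'// subrr.
- by rewrite -rE.
Qed.

Lemma open_union_balls (P : E -> R -> Prop) :
  open [set x : E | exists c e, [/\ P c e, 0 < e & `|x - c| < e]].
Proof.
rewrite openE => x [c [e [Pc e0 xc]]]; apply/nbhs_ballP.
exists (e - `|x - c|); first by rewrite /= subr_gt0.
move=> y; rewrite -ball_normE /= => xy; exists c, e; split=> //.
rewrite -[y](subrK x) -addrA; apply: le_lt_trans (ler_normD _ _) _.
by rewrite -ltrBrDr distrC.
Qed.

(** The set of the points where G is the germ is open and closed in B. *)
Lemma germ_constant r mu (B : set E) (G : (M * int)%type -> C) : r \in Fl -> qpfun G ->
  connected B -> B mu -> (forall c, B c -> c - mu \in r /\ regular r c) ->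
  germ_at_point r mu G -> forall c, B c -> germ_at_point r c G.
Proof.
move=> rA qG cB Bmu Breg Gmu.
have BB c c' : B c -> B c' -> c' - c \in r.
  move=> /Breg[h _] /Breg[h' _]; rewrite -[c'](subrK mu) -addrA rpredD//.
  by rewrite -opprB rpredN.
(* at any point, either G is the germ on a neighbourhood or nowhere nearby,
   since two quasi-polynomials which are germs at a common point are equal *)
have dich c : B c -> exists2 e, 0 < e & forall c', B c' -> `|c' - c| < e ->
    germ_at_point r c' G -> germ_at_point r c G.
  move=> Bc; have [Gc qGc hGc] := local_germ rA (Breg _ Bc).2.
  have [e e0 he] := hGc; have e20 : 0 < e / 2 by rewrite divr_gt0.
  exists (e / 2) => // c' Bc' cc' Gc'.
  have hGc' : germ_at_point r c' Gc.
    by exists (e / 2) => // l z l0 hz; apply: he => //; exact: cell_half (BB _ _ Bc Bc') cc' hz.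
  have eqG := germ_unique_slice rA qG qGc Gc' hGc'.
  exists e => // l z l0 hz; rewrite he// eqG//.
  have /(zscale_cell _ _ _ _ _ l0)[zr _] := hz.
  have -> : emb z - l%:R *: c' = (emb z - l%:R *: c) - l%:R *: (c' - c).
    by rewrite scalerBr opprB addrA subrK.
  by rewrite rpredB// rpredZ// BB.
pose B1 := [set c | B c /\ germ_at_point r c G].
suff -> : B = B1 by move=> c [].
apply/esym; apply: cB.
- by exists mu.
- exists [set x : E | exists c e, [/\ (B c /\ forall l z, (0 < l)%N -> cell r c (2 * e) (zscale l z) ->
      vsum L X (wts_ r) l z = G (z, l%:Z)), 0 < e & `|x - c| < e]].
    exact: open_union_balls.
  apply/seteqP; split=> [c [Bc [e e0 he]]|c [Bc [c' [e [[Bc' he] e0 cc']]]]].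
    split=> //; exists c, (e / 2); split; last by rewrite subrr normr0 divr_gt0.
      by split=> // l z l0; rewrite mulrC divfK//; exact: he.
    by rewrite divr_gt0.
  split=> //; exists e => // l z l0 hz; apply: he => //.
  apply: (@cell_half r c' c) => //; first exact: BB.
    by rewrite [2 * e]mulrC mulfK.
  by rewrite [2 * e]mulrC mulfK.
- exists (~` [set x : E | exists c e, [/\ (B c /\ ~ germ_at_point r c G /\ forall c', B c' -> `|c' - c| < e ->
    germ_at_point r c' G -> germ_at_point r c G), 0 < e & `|x - c| < e]]).
    by apply: open_closedC; exact: open_union_balls.
  apply/seteqP; split=> [c [Bc Gc]|c [Bc nc]].
    by split=> // -[c' [e [[Bc' [nG he]] e0 cc']]]; apply: nG; exact: (he c).
  split=> //; apply: contrapT => nG; apply: nc; have [e e0 he] := dich c Bc.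
  by exists c, e; split=> //; rewrite subrr normr0.
Qed.

End Chambers.

(** * Quasi-polynomials as polynomials on cosets *)

(* The notations of multivariate polynomials clash with those of analysis. *)
Import (canonicals) mpoly.

Section NewtonExpansion.
Context {K : numFieldType}.

Lemma bpolyS (j : int) i : bpoly (j + 1) i.+1 = bpoly j i.+1 + bpoly j i :> K.
Proof.
have i1 : i.+1%:R != 0 :> K by rewrite pnatr_eq0.
have f0 : (i`!)%:R != 0 :> K by rewrite pnatr_eq0 -lt0n fact_gt0.
rewrite /bpoly big_ord_recl /= [in RHS]big_ord_recr /= factS natrM.
rewrite [X in _ * X / _](eq_bigr (fun t : 'I_i => j%:~R - t%:R)); last first.
  by move=> t _; rewrite /bump /= add1n -natr1 rmorphD /=; ring.
rewrite rmorphD /= -[i.+1%:R]natr1; move: (\prod_(t < i) _) => P.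
rewrite subr0 mulr1z; move: i1; rewrite -natr1 => i1.
by field; rewrite f0 i1.
Qed.

Lemma bpoly0 i : bpoly 0 i = (i == 0)%:R :> K.
Proof. by rewrite bpoly_nat bin0n. Qed.

Lemma int_constant (u : int -> K) : u 0 = 0 -> (forall j, u (j + 1) = u j) -> forall j, u j = 0.
Proof.
move=> u0 uS; case=> m; elim: m => [|m IH] //.
- by rewrite -addn1 PoszD uS.
- by rewrite -uS NegzE addNr u0.
- by rewrite -uS -[RHS]IH; congr u; rewrite !NegzE; lia.
Qed.

(** Newton's forward difference formula, valid for negative j as well. *)
Lemma newton1 (G : zmodType) (v : G) k (h : G -> K) x (j : int) : killed v k h ->
  h (x + v *~ j) = \sum_(i < k) bpoly j i * iter i (fdiff v) h x.
Proof.
elim: k h j => [|k IH] h j hk; first by rewrite big_ord0; exact: hk.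
apply/eqP; rewrite -subr_eq0; apply/eqP.
apply: (@int_constant (fun j => h (x + v *~ j) - \sum_(i < k.+1) bpoly j i * iter i (fdiff v) h x)).
  rewrite mulr0z addr0 big_ord_recl big1 => [|i _]; last by rewrite bpoly0 mul0r.
  by rewrite bpoly0 /= mul1r addr0 subrr.
move=> i; have -> : h (x + v *~ (i + 1)) = h (x + v *~ i) + fdiff v h (x + v *~ i).
  by rewrite /fdiff mulrzDr mulr1z addrA subrKC.
rewrite (IH _ i hk) !big_ord_recl /= (_ : bpoly (i + 1) 0 = bpoly i 0); last first.
  by rewrite /bpoly !big_ord0.
have -> : \sum_(t < k) bpoly (i + 1) (bump 0 t) * fdiff v (iter t (fdiff v) h) x =
    \sum_(t < k) bpoly i (bump 0 t) * fdiff v (iter t (fdiff v) h) x +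
    \sum_(t < k) bpoly i t * iter t (fdiff v) (fdiff v h) x.
  rewrite -big_split; apply: eq_bigr => t _ /=.
  by rewrite /bump /= add1n bpolyS mulrDl -iterSr.
move: (\sum_(t < k) _) (\sum_(t < k) _) => P Q.
by rewrite -addrA addrA; ring.
Qed.

Section PolynomialExpressions.
Context {I : Type}.

(** Polynomial functions in a family of variables, built without reference to a
    ring of polynomials. *)
Inductive polyv : ((I -> K) -> K) -> Prop :=
| polyv_cst c : polyv (fun=> c)
| polyv_var i : polyv (fun xi => xi i)
| polyv_add F F' : polyv F -> polyv F' -> polyv (fun xi => F xi + F' xi)
| polyv_mul F F' : polyv F -> polyv F' -> polyv (fun xi => F xi * F' xi).

Lemma polyv_ext F F' : (forall xi, F xi = F' xi) -> polyv F -> polyv F'.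
Proof. by move=> /funext ->. Qed.

Lemma polyv_sum (J : Type) (r : seq J) (F : J -> (I -> K) -> K) :
  (forall j, polyv (F j)) -> polyv (fun xi => \sum_(j <- r) F j xi).
Proof.
move=> h; elim: r => [|j r IH].
  by apply: polyv_ext (polyv_cst 0) => xi; rewrite big_nil.
by apply: polyv_ext (polyv_add (h j) IH) => xi; rewrite big_cons.
Qed.

Lemma polyv_prod (J : Type) (r : seq J) (F : J -> (I -> K) -> K) :
  (forall j, polyv (F j)) -> polyv (fun xi => \prod_(j <- r) F j xi).
Proof.
move=> h; elim: r => [|j r IH].
  by apply: polyv_ext (polyv_cst 1) => xi; rewrite big_nil.
by apply: polyv_ext (polyv_mul (h j) IH) => xi; rewrite big_cons.
Qed.

Lemma killed_iter_fdiff (G : zmodType) (v w : G) k a (h : G -> K) :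
  killed v k h -> killed v k (iter a (fdiff w) h).
Proof. by move=> hk; elim: a => //= a IH; exact: killed_diff. Qed.

(** Newton's formula in one direction after the other. *)
Lemma newton (G : zmodType) (v : I -> G) k (r : seq I) (h : G -> K) x :
  (forall i, killed (v i) k h) -> exists2 F, polyv F &
    forall j : I -> int, h (x + \sum_(i <- r) v i *~ j i) = F (fun i => (j i)%:~R).
Proof.
elim: r h => [|i r IH] h hk.
  by exists (fun=> h x); [exact: polyv_cst|move=> j; rewrite big_nil addr0].
have hF a : exists F, polyv F /\ forall j : I -> int,
    iter a (fdiff (v i)) h (x + \sum_(i <- r) v i *~ j i) = F (fun i => (j i)%:~R).
  have [|F pF hF] := IH (iter a (fdiff (v i)) h); last by exists F.
  by move=> i'; exact: killed_iter_fdiff.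
have [F {}hF] := choice hF.
exists (fun xi => \sum_(a < k) (\prod_(t < a) (xi i - t%:R)) / (a`!)%:R * F a xi).
  apply: polyv_sum => a; apply: polyv_mul; last exact: (hF a).1.
  apply: polyv_mul; last exact: polyv_cst.
  by apply: polyv_prod => t; apply: polyv_add; [exact: polyv_var|exact: polyv_cst].
move=> j; rewrite big_cons addrCA addrC (newton1 _ _ (hk i)).
by apply: eq_bigr => a _; rewrite (hF a).2.
Qed.

End PolynomialExpressions.
End NewtonExpansion.

Section QuasiPolynomialSets.
Context {R : realType} {n : nat}.
Notation C := R[i].
Notation E := 'rV[R]_n.
Notation M := 'rV[int]_n.

Definition polyfn (u : E * int -> C) := exists p, forall y, u y = poly_eval p y.

Lemma polyfn_ext u u' : (forall y, u y = u' y) -> polyfn u -> polyfn u'.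
Proof. by move=> uu [p hp]; exists p => y; rewrite -uu. Qed.

Lemma polyfn_cst c : polyfn (fun=> c).
Proof. by exists (mpoly.mpolyC _ c) => y; rewrite /poly_eval mpoly.mevalC. Qed.

Lemma polyfn_add u u' : polyfn u -> polyfn u' -> polyfn (fun y => u y + u' y).
Proof. by move=> [p hp] [q hq]; exists (p + q) => y; rewrite hp hq /poly_eval mpoly.mevalD. Qed.

Lemma polyfn_mul u u' : polyfn u -> polyfn u' -> polyfn (fun y => u y * u' y).
Proof. by move=> [p hp] [q hq]; exists (p * q) => y; rewrite hp hq /poly_eval mpoly.mevalM. Qed.

Lemma polyfn_coord i : polyfn (fun y => (y.1 0 i)%:C%C).
Proof.
exists (mpoly.mpolyX _ (mpoly.mnm1 (lift ord_max i))) => y.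
by rewrite /poly_eval mpoly.mevalXU liftK.
Qed.

Lemma polyfn_last : polyfn (fun y => y.2%:~R).
Proof.
exists (mpoly.mpolyX _ (mpoly.mnm1 ord_max)) => y.
by rewrite /poly_eval mpoly.mevalXU unlift_none.
Qed.

Lemma polyfn_sum (J : Type) (r : seq J) (F : J -> E * int -> C) :
  (forall j, polyfn (F j)) -> polyfn (fun y => \sum_(j <- r) F j y).
Proof.
move=> h; elim: r => [|j r IH].
  by apply: polyfn_ext (polyfn_cst 0) => y; rewrite big_nil.
by apply: polyfn_ext (polyfn_add (h j) IH) => y; rewrite big_cons.
Qed.

Lemma polyfn_comp (I : Type) (F : (I -> C) -> C) (u : I -> E * int -> C) : polyv F ->
  (forall i, polyfn (u i)) -> polyfn (fun y => F (fun i => u i y)).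
Proof.
move=> pF hu; elim: pF => [c|i|F1 F2 _ h1 _ h2|F1 F2 _ h1 _ h2].
- exact: polyfn_cst.
- exact: hu.
- exact: polyfn_add.
- exact: polyfn_mul.
Qed.

Lemma polyfn_affine (B : 'M[R]_n) (b : E) (c : R) i :
  polyfn (fun y => (((y.1 - b) *m B) 0 i * c)%:C%C).
Proof.
apply: (@polyfn_ext (fun y => \sum_k (((y.1 0 k)%:C%C + (- b 0 k)%:C%C) * (B k i * c)%:C%C))).
  move=> y; rewrite mxE mulr_suml rmorph_sum; apply: eq_bigr => k _ /=.
  by rewrite !mxE -rmorphD -rmorphM mulrA.
apply: polyfn_sum => k; apply: polyfn_mul; last exact: polyfn_cst.
by apply: polyfn_add; [exact: polyfn_coord|exact: polyfn_cst].
Qed.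

(** Along a line, a polynomial is a polynomial in the parameter, which in turn is
    killed by differences. *)
Lemma poly_eval_ray (p : mpoly.mpoly n.+1 C) (x w : E) (a b : int) :
  qpfun (fun j : int => poly_eval p (x + w *~ j, a + b * j)).
Proof.
pose one : zlin int := @Zlin _ id (fun _ _ => erefl).
have aff (c d : C) : qpfun (fun j : int => c + d * j%:~R).
  exact: qpfunD (qpfun_cst c) (qpfunM (qpfun_cst d) (qpfun_zlin one)).
suff h : qpfun (fun j : int => \sum_(m <- mpoly.msupp p) mpoly.mcoeff m p *
  \prod_(i < n.+1) \prod_(t < mpoly.fun_of_multinom m i) if unlift ord_max i is Some t then
     (x 0 t)%:C%C + (w 0 t)%:C%C * j%:~R else a%:~R + b%:~R * j%:~R).
  apply: qpfun_ext h => j.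
  rewrite /poly_eval mpoly.mevalE; apply: eq_bigr => m _; congr (_ * _).
  apply: eq_bigr => i _; rewrite prodr_const card_ord; congr (_ ^+ _).
  case: unlift => [t|]; last by rewrite rmorphD rmorphM.
  have -> : (x + w *~ j, a + b * j).1 0 t = x 0 t + w 0 t * j%:~R.
    by rewrite [LHS]/= -scaler_int !mxE mulrC.
  by rewrite rmorphD rmorphM /= rmorph_int.
apply: qpfun_sum => m; apply: qpfunM; first exact: qpfun_cst.
apply: qpfun_prod => i; apply: qpfun_prod => _.
by case: unlift => [t|]; exact: aff.
Qed.

Definition unit_vec (i : 'I_n.+1) : M * int :=
  if unlift ord_max i is Some j then (delta_mx 0 j, 0) else (0, 1).

Definition coords (w : M * int) (i : 'I_n.+1) : int :=
  if unlift ord_max i is Some j then w.1 0 j else w.2.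

Lemma sum_coords w : \sum_i unit_vec i *~ coords w i = w.
Proof.
rewrite (bigD1_ord ord_max)//= /unit_vec /coords unlift_none.
under eq_bigr => j _ do rewrite liftK pairMzE mul0rz.
have -> : \sum_(j < n) (delta_mx 0 j *~ w.1 0 j, 0) = (w.1, 0) :> M * int.
  rewrite [in RHS](row_sum_delta w.1); elim/big_rec2: _ => // i y1 y2 _ ->.
  by rewrite pairDE addr0 -scaler_int intz.
rewrite pairMzE mul0rz pairDE add0r addr0; case: w => w1 w2 /=.
by rewrite -mulrzl mulr1 intz.
Qed.

Variable L : 'M[R]_n.
Hypothesis L_unit : L \in unitmx.
Local Notation D := (dual_basis L).
Local Notation emb := (emb (dual_basis L)).
Let D_unit : D \in unitmx := dual_basis_unit L_unit.

Definition zinv (v : E) : M := xget 0 [set z | v = emb z].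

Lemma zinvK z : zinv (emb z) = z.
Proof.
rewrite /zinv; case: xgetP => [w _ /= /(emb_inj D_unit)//|/(_ z)].
by case.
Qed.

Lemma emb_zinv v : dual_lattice L v -> emb (zinv v) = v.
Proof. by move=> /(dual_latticeP L_unit)[z ->]; rewrite zinvK. Qed.

(** On a coset of N M, the Newton expansion in the directions of N times the
    standard basis is finite. *)
Lemma qpfun_quasi_polynomial (G : (M * int)%type -> C) : qpfun G ->
  quasi_polynomial [set x : E * int | dual_lattice L x.1] (fun x => G (zinv x.1, x.2)).
Proof.
move=> [N N0 [k hk]]; have NR : N%:R != 0 :> R by rewrite pnatr_eq0 -lt0n.
pose g w : E * int := (emb w.1, w.2).
exists [set x | exists w : M * int, x = g (w *+ N)]; split.
- split.
  + by move=> _ [w ->] /=; exact: dual_lattice_emb.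
  + by exists 0; rewrite mul0rn /g /= emb0.
  + move=> _ _ [w ->] [w' ->]; exists (w - w'); rewrite mulrnBl /g /=.
    by rewrite embB.
- exists [seq g (a, b%:Z) | a <- boxseq N, b <- iota 0 N] => -[v j] /= /(dual_latticeP L_unit)[z ->].
  have NZ : N%:Z != 0 by rewrite -lt0n.
  have m0 (i : int) : 0 <= (i %% N)%Z by rewrite modz_ge0.
  have mN (i : int) : (i %% N)%Z < N%:Z by rewrite ltz_mod.
  pose a : M := \row_i modz (z 0 i) N.
  exists (g (a, (absz (j %% N)%Z)%:Z)).
    apply/allpairsP; exists (a, absz (j %% N)%Z); split=> //=.
      apply: mem_boxseq => i; rewrite mxE.
      by have := m0 (z 0 i); have := mN (z 0 i); lia.
    by rewrite mem_iota add0n /=; have := m0 j; have := mN j; lia.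
  exists (\row_i divz (z 0 i) N, (j %/ N)%Z).
  rewrite /g pmulrn pairMzE /= gez0_abs//; congr (_, _); last first.
    by rewrite /= {1}(divz_eq j N) addrK mulrC -mulrzl intz.
  rewrite -embB; congr emb; apply/rowP => i.
  by rewrite -scaler_int intz !mxE {1}(divz_eq (z 0 i) N) addrK mulrC.
- move=> [v j] /= /(dual_latticeP L_unit)[z ->].
  have [F pF hF] := @newton C _ (M * int)%type (fun i => unit_vec i *+ N) k
    (index_enum 'I_n.+1) G (z, j) (fun i => hk _).
  pose u (i : 'I_n.+1) (y : E * int) : C := if unlift ord_max i is Some t then
    (((y.1 - emb z) *m invmx D) 0 t * N%:R^-1)%:C%C else (y.2%:~R + (- j)%:~R) * N%:R^-1.
  have [|p hp] := @polyfn_comp _ F u pF.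
    move=> i; rewrite /u; case: unlift => [t|]; first exact: polyfn_affine.
    apply: polyfn_mul; last exact: polyfn_cst.
    by apply: polyfn_add; [exact: polyfn_last|exact: polyfn_cst].
  exists p => -[v' j'] [w [hv hj]].
  have wN : w *+ N = (w.1 *+ N, w.2 *+ N).
    by rewrite {1}[w]surjective_pairing !pmulrn pairMzE.
  rewrite wN in hv hj.
  rewrite -hp; have -> : v' = emb (z + w.1 *+ N).
    by rewrite embD -[v'](subrK (emb z)) hv addrC.
  rewrite zinvK.
  have -> : j' = j + w.2 *+ N.
    by rewrite -[j'](subrK j) hj addrC.
  have -> : (z + w.1 *+ N, j + w.2 *+ N) = (z, j) + \sum_i (unit_vec i *+ N) *~ coords w i.
    rewrite (eq_bigr (fun i => (unit_vec i *~ coords w i) *+ N)); last first.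
      by move=> i _; rewrite pmulrn mulrzAC -pmulrn.
    by rewrite sumrMnl sum_coords wN pairDE.
  rewrite hF; congr F; apply/funext => i; rewrite /u /coords.
  case: unlift => [t|] /=.
    rewrite embD addrAC subrr add0r /emb mulmxK// mxE mulmxnE rmorphMn /=.
    by rewrite -[(w.1 0 t)%:~R *+ N]mulr_natr mulfK// rmorph_int.
  rewrite -rmorphD /= addrAC subrr add0r rmorphMn /= -[_ *+ N]mulr_natr mulfK//.
  by rewrite pnatr_eq0 -lt0n.
Qed.

End QuasiPolynomialSets.

(** * Characterization of the germs *)

Section Germs.
Context {R : realType} {n : nat} (L X : 'M[R]_n).
Hypotheses (L_unit : L \in unitmx) (LX : lattice L `<=` lattice X).
Notation M := 'rV[int]_n.
Notation C := R[i].
Notation E := 'rV[R]_n.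
Local Notation D := (dual_basis L).
Local Notation emb := (emb (dual_basis L)).
Local Notation xilat := (xilat L X).
Local Notation zscale := (zscale (dual_basis L)).
Variable A : seq (M * C).
Hypothesis A_root : forall a, a \in A -> exists2 m, (0 < m)%N & a.2 ^+ m = 1.
Implicit Types (r s : {vspace E}).
Local Notation Fl := (flats D A).
Local Notation wts_ := (wts D A).
Local Notation alpha := (lift_weights L A).
Let D_unit : D \in unitmx := dual_basis_unit L_unit.

Variables (f : E -> E -> R) (sharp : E -> E).
Hypothesis fC : forall x y, f x y = f y x.
Hypothesis f_pos : forall x, x != 0 -> 0 < f x x.
Hypothesis f_pairing : forall x y, f x y = pairing x (sharp y).
Hypothesis sharp_surj : forall t, exists u, sharp u = t.

Lemma xilat_ex nu : dual_lattice X nu -> exists2 y, xilat y & nu = emb y.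
Proof.
move=> h; have /(dual_latticeP L_unit)[y nuE] : dual_lattice L nu by move=> x /LX; exact: h.
by exists y; rewrite // /xilat -nuE.
Qed.

Lemma wspan_lift (B : seq (M * C)) : wspan D B = <<map fst (lift_weights L B)>>%VS.
Proof. by rewrite /wspan /span /lift_weights -!map_comp. Qed.

Lemma admissibleP S : admissible X alpha S <->
  exists y s, [/\ xilat y, s \in Fl & S = affine_subspace (emb y) s].
Proof.
split=> [[nu [w [/xilat_ex[y hy ->] /subseqP[m sm ->] ->]]]|[y [s [hy sA ->]]]].
  exists y, (wspan D (mask m A)); split=> //.
    by apply: mem_flats; rewrite sm !size_map.
  by rewrite wspan_lift /lift_weights map_mask map_mask.
exists (emb y), (map fst (lift_weights L (wts_ s))); split=> //.
  by apply: map_subseq; apply: map_subseq; exact: filter_subseq.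
by rewrite -wspan_lift -flats_span.
Qed.

(** The component of v orthogonal to s defines a vector annihilated by s. *)
Lemma double_annihilator s v : (forall x, (forall w, w \in s -> pairing w x = 0) -> pairing v x = 0) ->
  v \in s.
Proof.
have [p ps po] := proj_ex fC f_pos f_pairing s v; move=> h.
suff : v - p = 0 by move/eqP; rewrite subr_eq0 => /eqP ->.
apply/eqP; apply: contraTT isT => /f_pos.
rewrite {1}(fDl f_pairing) (fNl f_pairing) [f p _]fC po// subr0 f_pairing h ?ltxx// => w ws.
by rewrite -f_pairing fC po.
Qed.

Lemma parallelE v s (a : E * C) : parallel (affine_subspace v s) a = (a.1 \in s).
Proof.
apply/asboolP/idP => [h|as_ x].
  by apply: double_annihilator => x hx; apply: h => w; rewrite direction_affine; exact: hx.
by rewrite /annihilated /= direction_affine; apply.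
Qed.

Lemma weights_par_lift v s : weights_par alpha (affine_subspace v s) = lift_weights L (wts_ s).
Proof.
rewrite /weights_par /lift_weights filter_map; congr map.
by apply: eq_filter => a; rewrite /= parallelE.
Qed.

Lemma weights_compl_lift v s : weights_compl alpha (affine_subspace v s) =
  lift_weights L [seq a <- A | emb a.1 \notin s].
Proof.
rewrite /weights_compl /lift_weights filter_map; congr map.
by apply: eq_filter => a; rewrite /= parallelE.
Qed.

(** Finitely many strata meet a ball, and those which miss mu stay away from it.
    Thus regular points form an open subset of a stratum. *)
Lemma strata_near mu : exists2 e, 0 < e & forall x, `|x - mu| <= e ->
  forall s y, s \in Fl -> xilat y -> x - emb y \in s -> mu - emb y \in s.
Proof.
have [e e0 he] : exists2 e, 0 < e & forall s, s \in Fl -> forall x, `|x - mu| <= e ->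
    forall y, xilat y -> x - emb y \in s -> mu - emb y \in s.
  apply: (@common_eps R _ Fl (fun s e => forall x, `|x - mu| <= e ->
    forall y, xilat y -> x - emb y \in s -> mu - emb y \in s)).
    by move=> s e e' h _ e'e x xe; apply: h; exact: le_trans xe e'e.
  move=> s sA.
  have [S SX hS] := xilat_classes L_unit LX (`|mu| + 1) sA.
  have [e e0 he] : exists2 e, 0 < e & forall y, y \in S -> forall x, `|x - mu| <= e ->
      x - emb y \in s -> mu - emb y \in s.
    apply: (@common_eps R _ S (fun y e => forall x, `|x - mu| <= e ->
      x - emb y \in s -> mu - emb y \in s)).
      by move=> y e e' h _ e'e x xe; apply: h; exact: le_trans xe e'e.
    move=> y yS; have [ys|ns] := boolP (mu - emb y \in s); first by exists 1.
    have [p ps po] := proj_ex fC f_pos f_pairing s (mu - emb y).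
    set q := mu - emb y - p in po.
    have q0 : q != 0 by apply: contraNneq ns => /eqP; rewrite subr_eq0 => /eqP ->.
    have fq := f_pos q0; have [K K0 hK] := pairing_norm (sharp q).
    exists (f q q / (2 * (K + 1))) => [|x xe xs].
      by rewrite divr_gt0// mulr_gt0// ltr_wpDl.
    have : f q (x - emb y - p) = 0 by apply: po; rewrite rpredB.
    have -> : x - emb y - p = q + (x - mu).
      by rewrite /q; move: (emb y) => v; apply/rowP => i; rewrite !mxE; ring.
    rewrite (fDr fC f_pairing) => h.
    have h1 : `|f q (x - mu)| <= K * `|x - mu| by rewrite fC f_pairing.
    have : K * `|x - mu| <= (K + 1) * (f q q / (2 * (K + 1))).
      by apply: ler_pM => //; rewrite lerDl.
    have K10 : K + 1 != 0 by rewrite gt_eqF// ltr_wpDl.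
    have -> : (K + 1) * (f q q / (2 * (K + 1))) = f q q / 2 by field.
    have : - `|f q (x - mu)| <= f q (x - mu) by rewrite lerNl -normrN ler_norm.
    by move: h h1 fq; move: (f q q) (f q (x - mu)) `|f q (x - mu)| => a b c; lra.
  exists (Num.min e 1) => [|x]; first by rewrite lt_min e0 ltr01.
  rewrite le_min => /andP[xe x1] y hy xs.
  have [|y' y'S y's] := hS y x hy xs.
    by rewrite -[x](subrKC mu); apply: le_trans (ler_normD _ _) _; rewrite lerD2l.
  have h y1 y2 z : z - emb y1 \in s -> emb (y1 - y2) \in s -> z - emb y2 \in s.
    move=> zs; rewrite embB => ys; rewrite -[z](subrK (emb y1)) -addrA rpredD//.
  apply: (h y') (he y' y'S x xe _) _; first exact: h xs y's.
  by rewrite -opprB embN rpredN.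
by exists e => // x xe s y sA; exact: he.
Qed.

Section Chamber.
Variables (y0 : M) (r : {vspace E}) (mu : E).
Hypotheses (rA : r \in Fl) (xi0 : xilat y0).
Local Notation S0 := (affine_subspace (emb y0) r).
Hypothesis mu_reg : regular_in X alpha S0 mu.

Lemma regular_in_regular c : regular_in X alpha S0 c -> c - mu \in r /\ regular L X A r c.
Proof.
move=> [cS nc]; split.
  have [muS _] := mu_reg.
  rewrite -[c](subrK (emb y0)) -addrA; apply: rpredD => //.
  by rewrite -opprB rpredN.
move=> s y sA sr srn hy; apply/negP => cs; apply: nc.
exists (affine_subspace (emb y) s); split=> //; first by apply/admissibleP; exists y, s.
by rewrite /affine_dim !direction_affine; exact: vspace_properP.
Qed.

Lemma regular_cell : exists2 e, 0 < e & forall x, cell r mu e x ->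
  chamber X alpha S0 mu x.
Proof.
have [e e0 he] := strata_near mu; have [muS nmu] := mu_reg.
exists e => //; apply: component_cell => // x [xr xe]; split.
  by rewrite /affine_subspace /= -[x](subrK mu) -addrA rpredD.
move=> [_ [/admissibleP[y [s [hy sA ->]]] ds xs]]; apply: nmu.
exists (affine_subspace (emb y) s); split=> //; first by apply/admissibleP; exists y, s.
exact: he xe s y sA hy xs.
Qed.

Lemma chamber_regular c : chamber X alpha S0 mu c -> c - mu \in r /\ regular L X A r c.
Proof. by move=> /connected_component_sub; exact: regular_in_regular. Qed.

Variable tau : set E -> E.
Hypotheses (tauP : polarization L X A tau) (nv : near_vanishing L X A tau r mu).

Lemma dilate_emb l z : (0 < l)%N -> dilate l S0 (emb z) <-> emb z - l%:R *: mu \in r.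
Proof.
move=> l0; have lR : l%:R != 0 :> R by rewrite pnatr_eq0 -lt0n.
have [muS _] := mu_reg; rewrite /affine_subspace /= in muS.
split=> [[nu nuS <-]|h].
  rewrite -scalerBr rpredZ// -[nu](subrK (emb y0)) -addrA; apply: rpredD => //.
  by rewrite -opprB rpredN.
exists (l%:R^-1 *: emb z); last by rewrite scalerA mulfV// scale1r.
rewrite /affine_subspace /=.
have -> : l%:R^-1 *: emb z - emb y0 = l%:R^-1 *: (emb z - l%:R *: mu) + (mu - emb y0).
  by rewrite scalerBr scalerA mulVf// scale1r addrA subrK.
by rewrite rpredD// rpredZ.
Qed.

Definition germ_fun (lambda : E) (l : nat) : C :=
  if `[< [/\ dual_lattice L lambda, (0 < l)%N & dilate l S0 lambda] >]
  then germ L X A tau l r (zinv L lambda) else 0.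

Lemma germ_funE z l : (0 < l)%N -> emb z - l%:R *: mu \in r ->
  germ_fun (emb z) l = germ L X A tau l r z.
Proof.
move=> l0 zr; rewrite /germ_fun zinvK//; case: asboolP => // -[].
by split=> //; [exact: dual_lattice_emb|apply/dilate_emb].
Qed.

(** Near mu no smaller stratum contributes; from there on, the quasi-polynomial
    which gives the germ follows the chamber. *)
Lemma germ_chamber z l : (0 < l)%N -> chamber X alpha S0 mu (zscale l z) ->
  germ L X A tau l r z = vsum L X (wts_ r) l z.
Proof.
move=> l0 zc; have [G qG hG] := germ_qp L_unit LX A_root tauP rA nv.
have [e e0 he] := germ_near L_unit LX A_root tauP rA nv.
have Gmu : germ_at_point L X A r mu G.
  exists e => // k x k0 hx; rewrite -he// hG//.
  by have /(zscale_cell _ _ _ _ _ k0)[] := hx.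
have [e1 e10 he1] := regular_cell.
have chmu : chamber X alpha S0 mu mu.
  by apply: he1; rewrite /cell subrr mem0v normr0 ltW.
have [e2 e20 he2] := germ_constant L_unit LX A_root fC f_pos f_pairing sharp_surj rA qG
  (@component_connected _ _ _) chmu chamber_regular Gmu zc.
rewrite he2//; last by rewrite /cell subrr mem0v normr0 ltW.
rewrite hG//; have [zr _] := chamber_regular zc.
have -> : emb z - l%:R *: mu = l%:R *: (zscale l z - mu).
  by rewrite scalerBr zscaleE scalerA mulfV ?scale1r// pnatr_eq0 -lt0n.
exact: rpredZ.
Qed.

Lemma verlinde_on_chamber z l : (0 < l)%N -> dilate l (chamber X alpha S0 mu) (emb z) ->
  chamber X alpha S0 mu (zscale l z) /\
  verlinde_sum L X (weights_par alpha S0) (emb z) l = vsum L X (wts_ r) l z.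
Proof.
move=> l0 [nu nuc nuE]; split; last by rewrite weights_par_lift verlinde_sumE.
by rewrite zscaleE -nuE scalerA mulVf ?scale1r// pnatr_eq0 -lt0n.
Qed.

Lemma germ_fun_is_germ : is_verlinde_germ L X alpha S0 mu germ_fun.
Proof.
split.
- by move=> lambda l; rewrite /germ_fun; case: asboolP => //; rewrite eqxx.
- have [G qG hG] := germ_qp L_unit LX A_root tauP rA nv.
  exists (fun x => G (zinv L x.1, x.2)); first exact: qpfun_quasi_polynomial.
  move=> lambda l [/= /(dual_latticeP L_unit)[z ->] [k k0 [[->] /dilate_emb zr]]].
  by rewrite germ_funE ?zinvK ?hG//; exact: zr.
- move=> lambda l /(dual_latticeP L_unit)[z ->] l0 hz.
  have [zc ->] := verlinde_on_chamber l0 hz.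
  rewrite -germ_chamber// germ_funE//; apply/dilate_emb => //.
  have [nu nuc <-] := hz; exists nu => //.
  by have /connected_component_sub[] := nuc.
Qed.

(** Two of the multiples of d lie in the same coset. *)
Lemma finite_index_multiple (V : zmodType) (G' G : set V) d : subgroup_of G' G ->
  finite_index G' G -> (forall j, G (d *+ j)) -> exists2 N, (0 < N)%N & G' (d *+ N).
Proof.
move=> [_ G'0 G'B] [S hS] hd.
have {}hS j : exists y, y \in S /\ G' (d *+ j - y).
  by have [y yS hy] := hS _ (hd j); exists y.
have [g hg] := choice hS.
pose h (j : 'I_(size S).+1) : 'I_(size S).+1 := inord (index (g j) S).
have /injectivePn[i [j ij hij]] : ~~ injectiveb h.
  apply/negP => /injectiveP hi.
  have /codomP[k] : ord_max \in codom h by rewrite (inj_card_onto hi)// card_ord.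
  move/(congr1 val); rewrite /= inordK ?ltnS ?index_size// => kE.
  by have := (hg k).1; rewrite -index_mem -kE ltnn.
wlog ltij : i j ij hij / (i < j)%N.
  move=> H; have [ij'|ji|ij'] := ltngtP i j; [exact: (H i j)| |].
    by apply: (H j i) => //; rewrite eq_sym.
  by case/negP: ij; apply/eqP/val_inj.
exists (j - i)%N; first by rewrite subn_gt0.
have gij : g i = g j.
  move/(congr1 val): hij; rewrite /= !inordK ?ltnS ?index_size// => hij.
  by rewrite -(nth_index 0 (hg i).1) hij nth_index// (hg j).1.
have -> : d *+ (j - i) = (d *+ j - g j) - (d *+ i - g i).
  by rewrite gij mulrnBr 1?ltnW// opprB addrA subrK.
by apply: G'B; exact: (hg _).2.
Qed.

(** From any lattice point over the stratum, move by multiples of a lattice point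
    over the chamber belonging to the sublattice on the cosets of which g is
    polynomial. Both functions are quasi-polynomial along this ray, and agree as
    soon as it has entered the cone over the chamber. *)
Lemma germ_unique g : is_verlinde_germ L X alpha S0 mu g -> g = germ_fun.
Proof.
move=> [supp [h [G' [G'sub G'fin hp] gh] gch]].
apply/funext => lambda; apply/funext => l.
have [[/(dual_latticeP L_unit)[z ->] l0 zS]|nS] := pselect
    [/\ dual_lattice L lambda, (0 < l)%N & dilate l S0 lambda]; last first.
  rewrite /germ_fun; case: asboolP => // _.
  by apply/eqP; apply: contra_notT nS => /supp.
have /(dilate_emb _ l0) zr := zS.
have [G qG hG] := germ_qp L_unit LX A_root tauP rA nv.
have [e e0 he] := regular_cell; have e20 : 0 < e / 2 by rewrite divr_gt0.
have rE : r = span D (map fst (wts_ r)) by exact: flats_span.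
have [m [w [m0]]] : exists m w, (0 < m)%N /\ cell r mu (e / 2) (zscale m w).
  by rewrite rE; apply: (rational_cell e20 _ l0 (z0 := z)); rewrite -rE.
move=> hw; have [J hJ] := cell_ray e0 l0 m0 zr hw.
have [|N N0 hN] := finite_index_multiple (d := (emb w, m%:Z)) G'sub G'fin.
  by move=> j; rewrite /= pmulrn pairMzE /= -pmulrn -embMn; exact: dual_lattice_emb.
have G'N (j : nat) : G' ((emb w, m%:Z) *+ N *+ j).
  have [_ G'0 G'B] := G'sub; elim: j => [|j IH]; first by rewrite mulr0n.
  rewrite mulrS -[_ *+ N *+ j]opprK; apply: (G'B) => //.
  by rewrite -sub0r; exact: (G'B).
have [p hpz] := hp (emb z, l%:Z) (dual_lattice_emb L_unit z).
pose Lj j := (l + m * (N * j))%N; pose zj j := z + w *+ (N * j).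
have xj (j : nat) : (emb (zj j), (Lj j)%:Z) - (emb z, l%:Z) = (emb w, m%:Z) *+ N *+ j.
  rewrite -mulrnA pmulrn pairMzE -pmulrn -embMn; congr (_, _).
    by rewrite /= /zj embD addrAC subrr add0r.
  by rewrite /= /Lj PoszD addrAC subrr add0r -mulrzl intz PoszM mulrC.
have zrj j : emb (zj j) - (Lj j)%:R *: mu \in r.
  have [wr _] := (zscale_cell _ _ _ _ _ m0).1 hw.
  have -> : emb (zj j) - (Lj j)%:R *: mu = (emb z - l%:R *: mu) + (emb w - m%:R *: mu) *+ (N * j).
    rewrite /zj /Lj embD embMn natrD natrM scalerDl opprD addrACA mulrnBl; congr (_ + (_ - _)).
    by rewrite mulrC -scalerA scaler_nat.
  by rewrite rpredD// rpredMn.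
have Lj0 j : (0 < Lj j)%N by rewrite addn_gt0 l0.
have gE j : g (emb (zj j)) (Lj j) = poly_eval p (emb (zj j), (Lj j)%:Z).
  rewrite gh.
    by apply: hpz; rewrite xj; exact: G'N.
  split=> /=; first exact: dual_lattice_emb.
  by exists (Lj j) => //; split=> //; apply/dilate_emb.
pose H (j : int) := poly_eval p (emb z + (emb w *+ N) *~ j, l%:Z + (m * N)%N%:Z * j) -
  G ((z, l%:Z) + (w *+ N, (m * N)%N%:Z) *~ j).
have HE (j : nat) : H j = g (emb (zj j)) (Lj j) - germ_fun (emb (zj j)) (Lj j).
  rewrite gE germ_funE// hG// /H /zj /Lj embD embMn -!pmulrn -!mulrnA; congr (poly_eval p (_, _) - G _).
    by rewrite mulnA PoszD PoszM.
  by rewrite pmulrn pairMzE pairDE -pmulrn -mulrnA; congr (_, _); rewrite -mulrzl intz; lia.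
have qH : qpfun H.
  apply: qpfunD; first exact: poly_eval_ray.
  apply: qpfunN; apply: (@qpfun_comp _ _ _ (fun x => G ((z, l%:Z) + x)) (fun j : int => (w *+ N, (m * N)%N%:Z) *~ j)).
    by move=> x y; rewrite mulrzDr.
  apply: (@qpfun_ext _ _ (fun x => G (x + (z, l%:Z)))); first by move=> x; rewrite addrC.
  exact: qpfun_shift.
have H0 : H 0 = 0.
  apply: (@qpfun_ray _ _ H 1 0 J qH) => j Jj.
  rewrite add0r natz HE; apply/eqP; rewrite subr_eq0; apply/eqP.
  have cj : chamber X alpha S0 mu (zscale (Lj j) (zj j)).
    by apply: he; apply: hJ; apply: leq_trans Jj _; rewrite leq_pmull.
  have dj : dilate (Lj j) (chamber X alpha S0 mu) (emb (zj j)).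
    exists (zscale (Lj j) (zj j)) => //.
    by rewrite zscaleE scalerA mulfV ?scale1r// pnatr_eq0 -lt0n.
  rewrite gch//; last exact: dual_lattice_emb.
  by rewrite (verlinde_on_chamber (Lj0 j) dj).2 germ_funE// germ_chamber.
have := HE 0%N; rewrite H0 /zj /Lj !muln0 mulr0n addr0 addn0 => /esym/eqP.
by rewrite subr_eq0 => /eqP.
Qed.

Lemma verlinde_germ_fun : verlinde_germ L X alpha S0 mu = germ_fun.
Proof.
rewrite /verlinde_germ; case: xgetP => [g _ /germ_unique //|/(_ germ_fun)].
by move=> /(_ germ_fun_is_germ).
Qed.

End Chamber.
End Germs.

(** * The decomposition formula *)

Section InnerProductFlat.
Context {R : realType} {n : nat} (ip : {dot 'rV[R]_n for (@idfun R)}).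
Notation E := 'rV[R]_n.

Definition gram : 'M[R]_n := \matrix_(i, j) ip (delta_mx 0 i) (delta_mx 0 j).

Lemma flat_gram x : flat ip x = x *m gram.
Proof.
apply/rowP => j; rewrite !mxE [X in ip X _](row_sum_delta x) linear_sumlz /=.
by apply: eq_bigr => i _; rewrite linearZl_LR /= !mxE.
Qed.

Lemma gram_unit : gram \in unitmx.
Proof.
rewrite -row_free_unit -kermx_eq0; apply/eqP/row_matrixP => i; rewrite row0.
set x := row i _; apply/eqP; apply: contraTT isT => /(neq0_dnorm_gt0 (s := ip)).
rewrite -pairing_flat flat_gram (_ : x *m gram = 0) ?pairing0l ?ltxx//.
by apply/sub_kermxP; exact: row_sub.
Qed.

Definition sharp (y : E) : E := y *m invmx gram.

Lemma sharpK y : flat ip (sharp y) = y.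
Proof. by rewrite flat_gram /sharp mulmxKV// gram_unit. Qed.

Lemma flatK x : sharp (flat ip x) = x.
Proof. by rewrite flat_gram /sharp mulmxK// gram_unit. Qed.

Lemma flatB x y : flat ip (x - y) = flat ip x - flat ip y.
Proof. by rewrite !flat_gram mulmxBl. Qed.

Lemma sharpB x y : sharp (x - y) = sharp x - sharp y.
Proof. exact: mulmxBl. Qed.

Lemma flat_projection (S : set E) gamma : flat ip gamma + flat ip (projection_dir ip S gamma) =
  flat ip (projection_point ip S gamma).
Proof. by rewrite /projection_dir flatB addrC subrK. Qed.

Definition dual_ip (x y : E) := pairing x (sharp y).

Lemma dual_ipE x y : dual_ip x y = ip (sharp x) (sharp y).
Proof. by rewrite -pairing_flat sharpK. Qed.

Lemma dual_ipC x y : dual_ip x y = dual_ip y x.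
Proof. by rewrite !dual_ipE [LHS]hermC /= expr0 mul1r. Qed.

Lemma dual_ip_gt0 x : x != 0 -> 0 < dual_ip x x.
Proof.
move=> x0; rewrite dual_ipE; apply: neq0_dnorm_gt0; apply: contraNneq x0 => h.
by rewrite -[x]sharpK h flat_gram mul0mx.
Qed.

Lemma sharp_surj t : exists u, sharp u = t.
Proof. by exists (flat ip t); rewrite flatK. Qed.

(** The projection in t for the given inner product is the projection in the dual
    for the inner product transported by flat. *)
Lemma projection_pointP v (s : {vspace E}) gamma :
  let P := projection_point ip (affine_subspace v s) gamma in
  flat ip P - v \in s /\ orth dual_ip s (flat ip (P - gamma)).
Proof.
move=> P; set c := flat ip gamma.
have [p ps po] := proj_ex dual_ipC dual_ip_gt0 (fun _ _ => erefl) s (c - v).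
have [PS Po] : affine_subspace v s (flat ip P) /\ forall a b,
    affine_subspace v s (flat ip a) -> affine_subspace v s (flat ip b) -> ip (P - gamma) (a - b) = 0.
  rewrite /P /projection_point /orthogonal_projection; case: xgetP => [Q _ [h1 h2]|]; first by split.
  move=> /(_ (sharp (v + p))) []; split=> [|a b ha hb].
    by rewrite /= sharpK /affine_subspace /= addrAC subrr add0r.
  have -> : ip (sharp (v + p) - gamma) (a - b) = dual_ip (v + p - c) (flat ip a - flat ip b).
    by rewrite dual_ipE -flatB sharpB /c !flatK.
  rewrite (_ : v + p - c = - (c - v - p)); last by rewrite -[c - v - p]addrA -opprD opprB.
  rewrite /dual_ip pairingNl -/(dual_ip _ _) po ?oppr0//.
  have -> : flat ip a - flat ip b = (flat ip a - v) - (flat ip b - v).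
    by rewrite opprB addrA subrK.
  exact: rpredB.
split=> // w ws; rewrite dual_ipE flatK -[sharp w](addrK P); apply: Po => //.
by rewrite flat_gram mulmxDl -!flat_gram sharpK /affine_subspace /= -addrA rpredD.
Qed.

End InnerProductFlat.

Section VerlindeTerms.
Context {R : realType} {n : nat} (L X : 'M[R]_n).
Hypotheses (L_unit : L \in unitmx) (LX : lattice L `<=` lattice X).
Notation M := 'rV[int]_n.
Notation C := R[i].
Notation E := 'rV[R]_n.
Local Notation D := (dual_basis L).
Local Notation emb := (emb (dual_basis L)).
Local Notation xilat := (xilat L X).
Local Notation zscale := (zscale (dual_basis L)).
Variable A : seq (M * C).
Hypothesis A_root : forall a, a \in A -> exists2 m, (0 < m)%N & a.2 ^+ m = 1.
Implicit Types (r s : {vspace E}).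
Local Notation Fl := (flats D A).
Local Notation wts_ := (wts D A).
Local Notation alpha := (lift_weights L A).
Let D_unit : D \in unitmx := dual_basis_unit L_unit.

Variables (ip : {dot E for (@idfun R)}) (gamma : E).
Hypothesis gamma_generic : generic X ip gamma alpha.
Let ipC := dual_ipC ip.
Let ip_pos := @dual_ip_gt0 _ _ ip.
Let ipE (x y : E) : dual_ip ip x y = pairing x (sharp ip y) := erefl.
Let surj := sharp_surj ip.
Let tau S := projection_dir ip S gamma.
Let r0 := wspan D A.

Lemma projection_dirP s y : exists o, [/\ tau (affine_subspace (emb y) s) = sharp ip o,
  flat ip gamma + o - emb y \in s & orth (dual_ip ip) s o].
Proof.
have [h1 h2] := projection_pointP ip (emb y) s gamma.
exists (flat ip (projection_dir ip (affine_subspace (emb y) s) gamma)); split=> //.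
  by rewrite flatK.
by rewrite flat_projection.
Qed.

Lemma generic_polarization : polarization L X A tau.
Proof.
apply: (good_polarization L_unit LX ipC ip_pos ipE surj (c := flat ip gamma)) => s y sA hy; split.
  have [ o [h1 h2 h3]] := projection_dirP s y; exists o, 0; split=> //.
  - by rewrite addr0.
  - by move=> w ws; rewrite /dual_ip pairing0l.
  - by move=> /ip_pos/ltW; rewrite [dual_ip ip 0 0]pairing0l mulr0.
move=> a aA as_; have adm : admissible X alpha (affine_subspace (emb y) s).
  by apply/(admissibleP L_unit LX); exists y, s.
have [_] := gamma_generic adm; move=> /(_ (emb a.1, a.2)); apply.
rewrite (weights_compl_lift _ _ ipC ip_pos ipE).
by apply/mapP; exists a; rewrite // mem_filter as_.
Qed.

Let tauP := generic_polarization.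

Lemma generic_vanishing r y : r \in Fl -> xilat y -> near_vanishing L X A tau r
  (flat ip (projection_point ip (affine_subspace (emb y) r) gamma)).
Proof.
move=> rA hy; set S := affine_subspace _ _; set P := projection_point _ _ _.
have adm : admissible X alpha S by apply/(admissibleP L_unit LX); exists y, r.
have [reg _] := gamma_generic adm.
rewrite /P -flat_projection.
apply: (generic_near_vanishing ipC ip_pos ipE).
- by move=> s z _ _; exact: projection_dirP.
- by have [] := projection_pointP ip (emb y) r gamma.
- rewrite flat_projection.
  by have [] := regular_in_regular L_unit LX reg reg.
Qed.

Lemma germ_atE r y : r \in Fl -> xilat y ->
  germ_at L X ip gamma alpha (affine_subspace (emb y) r) = germ_fun L X A y r tau.
Proof.
move=> rA hy; apply: (verlinde_germ_fun L_unit LX A_root ipC ip_pos ipE surj) => //.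
- have adm : admissible X alpha (affine_subspace (emb y) r).
    by apply/(admissibleP L_unit LX); exists y, r.
  by have [] := gamma_generic adm.
- exact: generic_vanishing.
Qed.

Lemma root_normc (u : C) m : (0 < m)%N -> u ^+ m = 1 -> Normc.normc u = 1.
Proof.
move=> m0 um; have : `|u| ^+ m = 1 by rewrite -normrX um normr1.
by move/eqP; rewrite pexpr_eq1// => /eqP [].
Qed.

Lemma partition_atE r y z : r \in Fl -> xilat y ->
  partition_at L ip gamma alpha (affine_subspace (emb y) r) (emb z) =
  pf (fun x => pairing (emb x) (tau (affine_subspace (emb y) r))) (wts_diff D A r0 r) z.
Proof.
move=> rA hy; rewrite /partition_at (weights_compl_lift _ _ ipC ip_pos ipE).
have -> : wts_diff D A r0 r = [seq a <- A | emb a.1 \notin r].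
  rewrite /wts_diff (_ : wts_ r0 = A)//; apply/all_filterP/allP => a aA.
  exact: wspan_mem.
rewrite partition_function_pf// => b; rewrite mem_filter => /andP[br bA]; split.
  by have [m m0 hm] := A_root bA; exact: root_normc hm.
by have [_ pol _] := tauP; exact: pol.
Qed.

(** The summand at y of the convolution for the stratum which is parallel to s and
    passes through y / l. *)
Definition contribution l z s y : C :=
  germ L X A tau l s y * pker (dir L tau l) s (wts_diff D A r0 s) y (z - y).

Lemma dilate_zscale l y w s : (0 < l)%N ->
  dilate l (affine_subspace (emb w) s) (emb y) <->
  affine_subspace (zscale l y) s = affine_subspace (emb w) s.
Proof.
move=> l0; have lR : l%:R != 0 :> R by rewrite pnatr_eq0 -lt0n.
split=> [[nu nuS nuE]|h].
  by rewrite zscaleE -nuE scalerA mulVf// scale1r; exact: affine_subspace_eq.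
exists (zscale l y); last by rewrite zscaleE scalerA mulfV ?scale1r.
by rewrite -h /affine_subspace /= subrr mem0v.
Qed.

(** The germ is supported on the weights y with y / l on the stratum, where the
    polarization at y is that of the stratum. *)
Lemma term_summand l z r w y : (0 < l)%N -> r \in Fl -> xilat w ->
  germ_at L X ip gamma alpha (affine_subspace (emb w) r) (emb y) l *
    partition_at L ip gamma alpha (affine_subspace (emb w) r) (emb (z - y)) =
  if `[< affine_subspace (zscale l y) r = affine_subspace (emb w) r >]
  then contribution l z r y else 0.
Proof.
move=> l0 rA hw; rewrite germ_atE// partition_atE// /germ_fun zinvK//.
case: asboolP => [[_ _ /(dilate_zscale _ _ _ l0) h]|nh].
  rewrite asboolT; last exact: h.
  by rewrite /contribution; congr (_ * _); rewrite /pker /dir h.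
rewrite mul0r; case: asboolP => // /(dilate_zscale _ _ _ l0) h.
by case: nh; split=> //; exact: dual_lattice_emb.
Qed.

Lemma decomposition_termE l z r w : (0 < l)%N -> r \in Fl -> xilat w ->
  decomposition_term L X ip gamma alpha (affine_subspace (emb w) r) (emb z) l =
  \sum_(y \in [set: M]) if `[< affine_subspace (zscale l y) r = affine_subspace (emb w) r >]
    then contribution l z r y else 0.
Proof.
move=> l0 rA hw; rewrite /decomposition_term /convolution.
rewrite (reindex_fsbig (fun y : M => (emb y, emb (z - y))) [set: M]) /=; last first.
  split=> [y _|y y' _ _ [/(emb_inj D_unit)//]|[a b] /= [/(dual_latticeP L_unit)[y ->] hb ab]].
    by split=> /=; [exact: dual_lattice_emb|exact: dual_lattice_emb|rewrite -embD addrC subrK].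
  by exists y => //; rewrite embB -ab addrAC subrr add0r.
by apply: eq_fsbigr => y _; rewrite term_summand.
Qed.

Lemma contribution_finite l z : (0 < l)%N -> exists2 T : seq M, uniq T &
  forall s y, s \in Fl -> contribution l z s y != 0 -> y \in T.
Proof.
move=> l0; suff [T hT] : exists T : seq M, forall s, s \in Fl -> forall y,
    contribution l z s y != 0 -> y \in T.
  by exists (undup T); rewrite ?undup_uniq// => s y sA h; rewrite mem_undup (hT s).
have : {subset Fl <= Fl} by [].
elim: {1 3}Fl => [|s F IH] hF; first by exists [::].
have [s' s'F|T hT] := IH; first by apply: hF; rewrite in_cons s'F orbT.
have sA : s \in Fl by apply: hF; exact: mem_head.
have [S hS] := pker_locally_finite tauP l0 r0 sA z.
exists (S ++ T) => s'; rewrite in_cons => /orP[/eqP ->|s'F] y hy; rewrite mem_cat.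
  move: hy; rewrite mulf_eq0 negb_or => /andP[/(germ_supp L_unit LX A_root l0 sA) hy nz].
  by rewrite hS.
by rewrite (hT s' s'F y hy) orbT.
Qed.

Lemma contribution_stratum l z s y : (0 < l)%N -> s \in Fl -> contribution l z s y != 0 ->
  exists2 w, xilat w & affine_subspace (zscale l y) s = affine_subspace (emb w) s.
Proof.
move=> l0 sA; rewrite mulf_eq0 negb_or => /andP[/(germ_supp L_unit LX A_root l0 sA)[w hw hy] _].
by exists w => //; exact: scaled_affine.
Qed.

Lemma vsum_contributions l z (T : seq M) : (0 < l)%N -> uniq T ->
  (forall s y, s \in Fl -> contribution l z s y != 0 -> y \in T) ->
  verlinde_sum L X alpha (emb z) l = \sum_(s <- Fl) \sum_(y <- T) contribution l z s y.
Proof.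
move=> l0 uT hT; rewrite verlinde_sumE//.
have r0A : r0 \in Fl by have := mem_flats_filter D A xpredT; rewrite filter_predT.
have -> : vsum L X A l z = vsum L X (wts_ r0) l z.
  by congr vsum; apply/esym/all_filterP/allP => a; exact: wspan_mem.
rewrite [LHS](V_sum (fun r => vsum L X (wts_ r) l) (dir L tau l) z r0A).
rewrite big_seq_cond [RHS]big_seq; apply: eq_big => [s|s /andP[sA _]].
  have [sA /=|//] := boolP (s \in Fl).
  rewrite (flats_span sA); apply: wspan_sub => a; rewrite mem_filter => /andP[_ aA].
  exact: wspan_mem.
by apply: fsumTE => // y; exact: hT.
Qed.

Lemma convolution_defined_at S l : admissible X alpha S -> (0 < l)%N ->
  convolution_defined L (fun mu => germ_at L X ip gamma alpha S mu l)
    (partition_at L ip gamma alpha S).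
Proof.
move=> /(admissibleP L_unit LX)[w [r [hw rA ->]]] l0 _ /(dual_latticeP L_unit)[z ->].
have [T _ hT] := contribution_finite z l0.
apply: (@sub_finite_set _ _ [set` [seq (emb y, emb (z - y)) | y <- T]]); last exact: finite_seq.
move=> [a b] /= [/(dual_latticeP L_unit)[y ->] _ yb ny nb].
have bE : b = emb (z - y) by rewrite embB -yb addrAC subrr add0r.
apply/mapP; exists y; last by rewrite bE.
have : germ_at L X ip gamma alpha (affine_subspace (emb w) r) (emb y) l *
    partition_at L ip gamma alpha (affine_subspace (emb w) r) (emb (z - y)) != 0.
  by rewrite -bE mulf_neq0.
by rewrite term_summand//; case: asboolP; rewrite ?eqxx// => _; exact: hT.
Qed.

(** Group the pairs of a flat s and a weight y which contribute according to the
    stratum parallel to s through y / l. *)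
Lemma verlinde_decomposition lambda l : dual_lattice L lambda -> (0 < l)%N ->
  finite_set [set S | admissible X alpha S /\
                      decomposition_term L X ip gamma alpha S lambda l != 0] /\
  verlinde_sum L X alpha lambda l =
    \sum_(S \in admissible X alpha) decomposition_term L X ip gamma alpha S lambda l.
Proof.
move=> /(dual_latticeP L_unit)[z ->] l0.
have [T uT hT] := contribution_finite z l0.
pose stratum (p : {vspace E} * M) : set E := affine_subspace (zscale l p.2) p.1.
pose SS := undup [seq stratum p | p <- [seq (s, y) | s <- Fl, y <- T] &
  contribution l z p.1 p.2 != 0].
have memSS s y : s \in Fl -> contribution l z s y != 0 -> stratum (s, y) \in SS.
  move=> sA h; rewrite mem_undup; apply: (map_f stratum (x := (s, y))).
  by rewrite mem_filter h /=; apply/allpairsP; exists (s, y); rewrite /= (hT s y).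
have termE S : admissible X alpha S -> decomposition_term L X ip gamma alpha S (emb z) l =
    \sum_(s <- Fl) \sum_(y <- T) if stratum (s, y) == S then contribution l z s y else 0.
  move=> /(admissibleP L_unit LX)[w [r [hw rA ->]]]; rewrite decomposition_termE//.
  rewrite (bigD1_seq r)//= ?undup_uniq// [X in _ = _ + X]big1 ?addr0; last first.
    move=> s sr; apply: big1 => y _; case: eqP => // h; case/negP: sr.
    by rewrite -(direction_affine (zscale l y) s) -[affine_subspace _ _]/(stratum (s, y)) h direction_affine.
  rewrite (fsumTE uT); last first.
    by move=> y; case: asboolP; rewrite ?eqxx// => _; exact: hT.
  by apply: eq_bigr => y _; congr (if _ then _ else _); apply/asboolP/eqP.
have SSadm S : S \in SS -> admissible X alpha S.
  rewrite mem_undup => /mapP[[s y]]; rewrite mem_filter => /andP[/= h /allpairsP[[s' y'] /= [sA _ [ss _]]]].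
  rewrite -{}ss in sA; have [w hw hE] := contribution_stratum l0 sA h.
  by move=> ->; apply/(admissibleP L_unit LX); exists w, s.
have SSsupp S : admissible X alpha S -> S \notin SS ->
    decomposition_term L X ip gamma alpha S (emb z) l = 0.
  move=> adm nS; rewrite termE// big1_seq// => s /andP[_ sA]; apply: big1 => y _.
  case: eqP => // h; apply/eqP; apply: contraNT nS; rewrite -h.
  exact: memSS.
split.
  apply: (@sub_finite_set _ _ [set` SS]); last exact: finite_seq.
  by move=> S [adm]; apply: contraNT => nS; rewrite SSsupp.
rewrite (vsum_contributions l0 uT hT).
have -> : \sum_(S \in admissible X alpha) decomposition_term L X ip gamma alpha S (emb z) l =
    \sum_(S <- SS | S \in admissible X alpha) decomposition_term L X ip gamma alpha S (emb z) l.
  by apply: fsbigE; [exact: undup_uniq|exact: SSadm|exact: SSsupp].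
rewrite [RHS]big_seq_cond [RHS](eq_bigr (fun S => \sum_(s <- Fl) \sum_(y <- T)
    if stratum (s, y) == S then contribution l z s y else 0)); last first.
  by move=> S /andP[/SSadm adm _]; exact: termE.
rewrite [RHS](eq_bigl (mem SS)); last first.
  move=> S; change ((S \in SS) && (S \in admissible X alpha) = (S \in SS)).
  by have [/SSadm adm|//] := boolP (S \in SS); rewrite (mem_set adm).
rewrite -[RHS]big_seq [RHS]exchange_big /= big_seq [RHS]big_seq; apply: eq_bigr => s sA.
rewrite [RHS]exchange_big /=; apply: eq_bigr => y _.
have [ ->|h] := eqVneq (contribution l z s y) 0.
  by rewrite big1// => S _; case: ifP.
rewrite (bigD1_seq (stratum (s, y)))/= ?undup_uniq ?memSS// eqxx big1 ?addr0// => S.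
by rewrite eq_sym => /negPf ->.
Qed.

End VerlindeTerms.

Theorem theorem4p2 (R : realType) (n : nat) (L X : 'M[R]_n)
  (hL : L \in unitmx) (hX : X \in unitmx) (hLX : lattice L `<=` lattice X)
  (ip : {dot 'rV[R]_n for (@idfun R)})
  (alpha : seq ('rV[R]_n * R[i]))
  (halpha : forall a, a \in alpha -> augmented_weight L a)
  (gamma : 'rV[R]_n) (hgamma : generic X ip gamma alpha) :
  (forall D, admissible X alpha D -> forall l : nat, (0 < l)%N ->
     convolution_defined L
       (fun mu => germ_at L X ip gamma alpha D mu l)
       (partition_at L ip gamma alpha D)) /\
  (forall (lambda : 'rV[R]_n) (l : nat), dual_lattice L lambda -> (0 < l)%N ->
     finite_set [set D | admissible X alpha D /\
                         decomposition_term L X ip gamma alpha D lambda l != 0]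
     /\
     verlinde_sum L X alpha lambda l =
       \sum_(D \in admissible X alpha)
         decomposition_term L X ip gamma alpha D lambda l).
Proof.
pose A := [seq (zinv L a.1, a.2) | a <- alpha].
have alphaE : alpha = lift_weights L A.
  rewrite /lift_weights -map_comp -[LHS]map_id; apply/eq_in_map => -[a u] /halpha[/= ha _].
  by rewrite emb_zinv.
have A_root a : a \in A -> exists2 m, (0 < m)%N & a.2 ^+ m = 1.
  move=> /mapP[b /halpha[_ [m m0 /unity_rootP hm]] ->].
  by exists m.
clearbody A; subst alpha; split=> [S adm l l0|lambda l hl l0].
  exact: convolution_defined_at.
exact: verlinde_decomposition.
Qed.
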